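(* Let $L>0$. For $L_0>0$ let $\mathcal{S}(L_0)=\{x+\mathbf{i}y:\ x,y\in\mathbb{R},\ |x|+|y|<L_0\}\subset\mathbb{C}$, and let $\mathscr{A}(L_0)$ be the set of functions $u\in L^2(-L,L)$ (complex valued) which can be extended analytically to $\mathcal{S}(L_0)$. Then $$\bigcup_{L_0>L}\mathscr{A}(L_0)\subset\mathscr{R}_L,$$ where $\mathscr{R}_L$ is the reachable set of the heat equation on $(-L,L)$ with Dirichlet boundary controls in $L^2$ at both ends.
   Context: For $T>0$ and complex-valued controls $v_-,v_+\in L^2(0,T)$, consider the (complex-valued) solution $u$ of $$\partial_t u-\partial_{xx}u=0 \text{ in }(0,T)\times(-L,L),\quad u(t,-L)=v_-(t),\ u(t,L)=v_+(t)\text{ in }(0,T),\quad u(0,x)=0\text{ in }(-L,L),$$ understood in the standard transposition sense. Define $\mathscr{R}_L(T)=\{u(T,\cdot): u \text{ is such a solution for some } v_-,v_+\in L^2(0,T)\}$. The set $\mathscr{R}_L(T)$ is a vector space which does not depend on $T>0$ (a known fact, a consequence of null-controllability of the heat equation in arbitrarily small time), and it is denoted by $\mathscr{R}_L$. Thus $f\in\mathscr{R}_L$ means that $f\in\mathscr{R}_L(T)$ for some (equivalently every) $T>0$. *)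

(* Defs.v *)
(* MathComp-Analysis, over an abstract [R : realType]; the complex numbers are
   [R[i]] from mathcomp-real-closed. *)
From HB Require Import structures.
From mathcomp Require Import all_boot all_order all_algebra.
From mathcomp Require Import complex.
From mathcomp Require Import all_classical all_reals all_analysis.

Set Implicit Arguments.
Unset Strict Implicit.
Unset Printing Implicit Defensive.

Import Order.TTheory GRing.Theory Num.Theory.
Import numFieldNormedType.Exports.

Local Open Scope classical_set_scope.
Local Open Scope complex_scope.
Local Open Scope ring_scope.

Section Defs.
Context {R : realType}.
Local Notation mu := (@lebesgue_measure R).

(* Elements of an L^2 space are represented by functions defined on the whole
   line whose values outside of the interval are irrelevant. *)
Definition L2 (a b : R) (f : R -> R) : Prop :=
  f \_ `]a, b[ \in Lfun mu 2%:E.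

Definition L2C (a b : R) (f : R -> R[i]) : Prop :=
  L2 a b (fun x => complex.Re (f x)) /\ L2 a b (fun x => complex.Im (f x)).

Definition intC (a b : R) (f : R -> R[i]) : R[i] :=
  (\int[mu]_(x in `]a, b[) complex.Re (f x))%R +i*
  (\int[mu]_(x in `]a, b[) complex.Im (f x))%R.

(* [H10 L phi g]: phi is (the continuous representative of) a real-valued
   element of H^1_0(-L, L) and g is its weak derivative. *)
Definition H10 (L : R) (phi g : R -> R) : Prop :=
  [/\ L2 (- L) L g,
      (forall x : R, x \in `[- L, L] ->
         phi x = (\int[mu]_(y in `]- L, x[) g y)%R) &
      phi L = 0].

Definition H10_norm (L : R) (g : R -> R) : R :=
  Num.sqrt (\int[mu]_(x in `]- L, L[) (g x ^+ 2))%R.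

(* Complex-valued distributions in H^{-1}(-L, L) are represented by their
   action on real-valued test functions: they are the R-linear maps from the
   real space H^1_0(-L, L) to the complex numbers which are bounded for the
   norm [H10_norm]. Only the values on H^1_0(-L, L) matter. *)
Definition functional : Type := (R -> R) -> R[i].

Definition Hm1_le (L : R) (l : functional) (c : R) : Prop :=
  forall phi g, H10 L phi g -> `|l phi| <= (c * H10_norm L g)%:C.

Definition Hm1 (L : R) (l : functional) : Prop :=
  (forall (a : R) phi g psi h, H10 L phi g -> H10 L psi h ->
     l (fun x => a * phi x + psi x) = a%:C * l phi + l psi) /\
  (exists c, Hm1_le L l c).

Definition Hm1_continuous (L T : R) (u : R -> functional) : Prop :=
  forall t0 : R, t0 \in `[0, T] -> forall eps : R, 0 < eps ->
  exists2 delta : R, 0 < delta &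
    forall t : R, t \in `[0, T] -> `|t - t0| < delta ->
      Hm1_le L (fun phi => u t phi - u t0 phi) eps.

Definition functional_of (L : R) (f : R -> R[i]) : functional :=
  fun phi => intC (- L) L (fun x => f x * (phi x)%:C).

Definition d_t (phi : R -> R -> R) (t x : R) : R := derive1 (phi^~ x) t.
Definition d_x (phi : R -> R -> R) (t x : R) : R := derive1 (phi t) x.
Definition d_xx (phi : R -> R -> R) (t x : R) : R := derive1 (d_x phi t) x.

Definition C12 (phi : R -> R -> R) : Prop :=
  (forall t x, [/\ derivable (phi^~ x) t 1, derivable (phi t) x 1 &
                   derivable (d_x phi t) x 1]) /\
  [/\ continuous (fun p : R * R => d_t phi p.1 p.2),
      continuous (fun p : R * R => d_x phi p.1 p.2) &
      continuous (fun p : R * R => d_xx phi p.1 p.2)].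

(* Classical solutions on [0, tau] x [-L, L] of the adjoint problem. Asking phi
   to be C^{1,2} on the whole plane avoids one-sided derivatives; the equations
   are only required on the rectangle. The finite linear combinations of
   exp(-(k pi / 2L)^2 (tau - t)) sin(k pi (x + L) / 2L) are of this form, so
   that the functions [phi tau] are dense in H^1_0(-L, L). *)
Definition adjoint_solution (L tau : R) (phi : R -> R -> R) : Prop :=
  [/\ C12 phi,
      (forall t x : R, t \in `[0, tau] -> x \in `[- L, L] ->
         - d_t phi t x - d_xx phi t x = 0) &
      (forall t : R, t \in `[0, tau] -> phi t (- L) = 0 /\ phi t L = 0)].

(* u is the solution in C([0, T]; H^{-1}(-L, L)), in the sense of
   transposition, of
     u_t - u_xx = 0,  u(t, -L) = vm(t),  u(t, L) = vp(t),  u(0, .) = 0. *)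
Definition transposition_solution (L T : R) (vm vp : R -> R[i])
    (u : R -> functional) : Prop :=
  [/\ (forall t : R, t \in `[0, T] -> Hm1 L (u t)),
      Hm1_continuous L T u,
      (forall phi g, H10 L phi g -> u 0 phi = 0) &
      (forall tau : R, 0 < tau <= T ->
         forall phi, adjoint_solution L tau phi ->
           u tau (phi tau) =
           intC 0 tau (fun t => vm t * (d_x phi t (- L))%:C
                                - vp t * (d_x phi t L)%:C))].

Definition reachable_at (L T : R) : set functional :=
  [set l | exists vm vp u,
     [/\ L2C 0 T vm, L2C 0 T vp, transposition_solution L T vm vp u &
         forall phi g, H10 L phi g -> l phi = u T phi]].

Definition reachable (L : R) : set functional :=
  \bigcup_(T in [set T : R | 0 < T]) reachable_at L T.

Definition square (L0 : R) : set R[i] :=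
  [set z | `|complex.Re z| + `|complex.Im z| < L0].

Definition analytic_on (D : set R[i]) (F : R[i] -> R[i]) : Prop :=
  forall z0, D z0 -> exists (a : nat -> R[i]) (r : R), 0 < r /\
    forall z : R[i], `|z - z0| < r%:C ->
      (fun N => \sum_(0 <= n < N) a n * (z - z0) ^+ n : R[i]^o) @ \oo -->
        (F z : R[i]^o).

Definition analytic_extendable (L L0 : R) : set (R -> R[i]) :=
  [set f | L2C (- L) L f /\
     exists2 F : R[i] -> R[i], analytic_on (square L0) F &
       {ae mu, forall x : R, x \in `]- L, L[ -> f x = F x%:C}].

End Defs.

(* Main.v *)
(* Write [S(a)] for the square |x| + |y| < a. If F is analytic near the closed
   square S(a), a > L, Cauchy's formula represents F on [-L, L] by the kernels
   1/(zeta - x), zeta on the boundary. On the edge with inward normal conj(theta),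
     1/(x - zeta) = theta * int_0^oo exp(- r theta (x - zeta)) dr,
   and each exponential is the value at t = T of the heat solution
   exp(- r theta (x - zeta) + r^2 theta^2 (t - T)). For a square theta^2 is purely
   imaginary, so this gives a solution w on [0, T] x [-L, L] with w(T) = F and
   bounds independent of T. Its initial state is again analytic, on a neighbourhood
   of a flat rhombus (vertices +-b, +-ih with L < b and h < b). There the same
   superposition can be run forward in time: Re theta^2 < 0, and it yields a
   solution z with z(0) = w(0) and with z(T) entire and O(T^{-1/2}) on S(a).
   Hence w - z starts from 0 and reaches F up to an error which, for T large, is
   half as large as F in the same class of functions. Iterating and summing the
   geometric series reaches F exactly, and the controls are the boundary traces. *)
Require Import Defs.
From mathcomp Require Import all_boot all_order all_algebra.
From mathcomp Require Import complex.
From mathcomp Require Import all_classical all_reals all_analysis.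
From mathcomp Require Import measurable_realfun.
From mathcomp Require Import ring lra.

Set Implicit Arguments.
Unset Strict Implicit.
Unset Printing Implicit Defensive.

Import Order.TTheory GRing.Theory Num.Theory.
Import numFieldNormedType.Exports.

Local Open Scope classical_set_scope.
Local Open Scope complex_scope.
Local Open Scope ring_scope.

(** * Integrals of continuous functions *)

Section Integral.
Context {R : realType}.
Local Notation mu := (@lebesgue_measure R).
Implicit Types (a b c d : R) (f g : R -> R).

(** The order of choices carries the argument: the backward constant is fixed before T, and T is
    then taken large in terms of it. A large T is allowed because [reachable] is a union over all T
    > 0. The square is the flattest rhombus for which the quadratic part of the exponent does not
    grow backward in time; strictly flatter ones suit the forward step. That step must control z(T)
    on S(a), partly outside the rhombus it starts from: there the linear part of the exponent may
    grow, and the negative quadratic part, multiplied by T, has to compensate.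

    Holomorphy of the superposed solutions is never shown. What is carried through integrals and
    series is the validity of Cauchy's formula on one contour, a linear condition stable under
    uniform limits, and the next iteration asks no more of its target. Likewise [heat] is an
    integrated identity without derivatives of the solution. Each superposition is thereby reduced
    to single exponentials. *)

Definition RI a b f : R := (\int[mu]_(x in `]a, b[) f x)%R.

Definition cont a b f := {within `[a, b], continuous f}.

(** Compactness is used in its near-covering form: the modulus at x for e / 2 serves, halved, all
    points close to x, and the filter of radii near 0 replaces the choice of finitely many balls. *)
Lemma heine (U : pseudoMetricType R) (K : set U) (f : U -> R) :
  compact K -> {within K, continuous f} -> forall e : R, 0 < e ->
  exists2 d : R, 0 < d & forall x y, K x -> K y -> ball x d y ->
    `|f x - f y| <= e.
Proof.
move=> /compact_near_coveringP cK /subspace_continuousP cf e e0.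
pose P (d : R) (x : U) := forall y, K x -> K y -> ball x d y -> `|f x - f y| <= e.
have H : \forall d \near 0^'+, K `<=` P d.
  apply: cK => x Kx.
  have e2 : 0 < e / 2 by rewrite divr_gt0.
  have /cvgrPdist_le/(_ _ e2) := cf x Kx.
  rewrite near_withinE => /nbhs_ballP[d /= d0 Hd].
  have d2 : 0 < d / 2 by rewrite divr_gt0.
  exists (ball x (d / 2), [set r | 0 < r < d / 2]) => /=.
    split; first exact: nbhsx_ballx.
    near=> r; apply/andP; split; near: r.
      exact: nbhs_right_gt.
    exact: nbhs_right_lt.
  move=> [x' r] /= [xx' /andP[r0 rd]] y Kx' Ky x'y.
  have dx' : `|f x - f x'| <= e / 2.
    by apply: Hd => //; apply: (le_ball _ xx'); rewrite ler_pdivrMr// ler_peMr ?ler1n// ltW.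
  have dy : `|f x - f y| <= e / 2.
    apply: Hd => //; rewrite [d]splitr; apply: (ball_triangle xx').
    exact: (le_ball (ltW rd)).
  rewrite [e]splitr distrC (_ : f y - f x' = (f x - f x') - (f x - f y)); last by ring.
  by apply: le_trans (ler_normB _ _) _; exact: lerD.
near (0 : R)^'+ => d.
exists d => [//|x y Kx Ky xy].
have := near H d; apply => //.
Unshelve. all: by end_near. Qed.

Lemma contP a b f : cont a b f <->
  forall e : R, 0 < e -> exists2 d : R, 0 < d &
    forall x y, x \in `[a, b] -> y \in `[a, b] -> `|x - y| < d ->
      `|f x - f y| <= e.
Proof.
split=> [cf e e0|cf].
  have [d d0 H] := heine (@segment_compact _ a b) cf e0.
  exists d => // x y xab yab xy; apply: H => //.
apply/subspace_continuousP => x xab; apply/cvgrPdist_le => e e0.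
have [d d0 H] := cf e e0.
rewrite near_withinE; apply/nbhs_ballP; exists d => //= y xy yab.
exact: H.
Qed.

Lemma continuous_cont a b f : continuous f -> cont a b f.
Proof. exact: continuous_subspaceT. Qed.

Lemma cont_cst a b c : cont a b (fun=> c).
Proof. by apply: continuous_cont => x; exact: cvg_cst. Qed.

Lemma contD a b f g : cont a b f -> cont a b g -> cont a b (fun x => f x + g x).
Proof. by move=> cf cg x; apply: cvgD; [exact: cf|exact: cg]. Qed.

Lemma contB a b f g : cont a b f -> cont a b g -> cont a b (fun x => f x - g x).
Proof. by move=> cf cg x; apply: cvgB; [exact: cf|exact: cg]. Qed.

Lemma contM a b f g : cont a b f -> cont a b g -> cont a b (fun x => f x * g x).
Proof. by move=> cf cg x; apply: cvgM; [exact: cf|exact: cg]. Qed.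

Lemma eq_cont a b f g : {in `[a, b], f =1 g} -> cont a b f -> cont a b g.
Proof.
move=> fg /contP cf; apply/contP => e /cf[d d0 H].
by exists d => // x y xab yab xy; rewrite -!fg//; exact: H.
Qed.

Lemma cont_sub a b c d f : a <= c -> d <= b -> cont a b f -> cont c d f.
Proof.
move=> ac db /contP cf; apply/contP => e /cf[r r0 H].
exists r => // x y; rewrite !in_itv/= => xab yab xy.
by apply: H => //; rewrite in_itv/=; lra.
Qed.

Lemma cont_integrable a b f : cont a b f -> mu.-integrable `]a, b[ (EFin \o f).
Proof.
move=> cf; apply: (@integrableS _ _ _ mu `[a, b]) => //.
  by apply: subset_itvScc; rewrite ?bnd_simp.
by apply: continuous_compact_integrable => //; exact: segment_compact.
Qed.

Lemma eq_RI a b f g : {in `]a, b[, f =1 g} -> RI a b f = RI a b g.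
Proof. by move=> fg; apply: eq_Rintegral => x; rewrite inE => /fg. Qed.

Lemma RID a b f g : cont a b f -> cont a b g ->
  RI a b (fun x => f x + g x) = RI a b f + RI a b g.
Proof. by move=> cf cg; apply: RintegralD => //; exact: cont_integrable. Qed.

Lemma RIB a b f g : cont a b f -> cont a b g ->
  RI a b (fun x => f x - g x) = RI a b f - RI a b g.
Proof. by move=> cf cg; apply: RintegralB => //; exact: cont_integrable. Qed.

Lemma RIZ a b c f : cont a b f -> RI a b (fun x => c * f x) = c * RI a b f.
Proof. by move=> cf; apply: RintegralZl => //; exact: cont_integrable. Qed.

Lemma RI_cst a b c : a <= b -> RI a b (fun=> c) = (b - a) * c.
Proof.
move=> ab; rewrite /RI Rintegral_cst//= lebesgue_measure_itv/= lte_fin.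
case: ltgtP ab => //= [_ _|-> _]; last by rewrite subrr mul0r mulr0.
by rewrite mulrC.
Qed.

Lemma le_RI a b f g : cont a b f -> cont a b g ->
  {in `]a, b[, forall x, f x <= g x} -> RI a b f <= RI a b g.
Proof.
move=> cf cg fg; apply: le_Rintegral => //.
- exact: cont_integrable.
- exact: cont_integrable.
Qed.

Lemma RI_le a b M f : a <= b -> cont a b f ->
  {in `]a, b[, forall x, `|f x| <= M} -> `|RI a b f| <= (b - a) * M.
Proof.
move=> ab cf H; rewrite ler_norml; apply/andP; split.
  rewrite -mulrN -RI_cst//; apply: le_RI => //; first exact: cont_cst.
  by move=> x /H; rewrite ler_norml => /andP[].
rewrite -RI_cst//; apply: le_RI => //; first exact: cont_cst.
by move=> x /H; rewrite ler_norml => /andP[].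
Qed.

Lemma RIcc a b f : cont a b f -> RI a b f = (\int[mu]_(x in `[a, b]) f x)%R.
Proof.
move=> cf; have icf : mu.-integrable `[a, b] (EFin \o f).
  by apply: continuous_compact_integrable => //; exact: segment_compact.
rewrite /RI -Rintegral_itv_obnd_cbnd; last first.
  by apply: integrableS icf => //; apply: subset_itvScc; rewrite ?bnd_simp.
by rewrite Rintegral_itv_bndo_bndc//; exact: cont_integrable.
Qed.

Lemma RI_split a c b f : a <= c -> c <= b -> cont a b f ->
  RI a b f = RI a c f + RI c b f.
Proof.
move=> ac cb cf; have cf1 := cont_sub (lexx a) cb cf.
have cf2 := cont_sub ac (lexx b) cf.
rewrite (RIcc cf) (RIcc cf1) /RI.
have icf : mu.-integrable `[a, b] (EFin \o f).
  by apply: continuous_compact_integrable => //; exact: segment_compact.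
rewrite Rintegral_itv_bndo_bndc; last exact: cont_integrable.
rewrite -(@Rintegral_itvB _ f (BLeft a) (BRight b) c) ?bnd_simp//.
by rewrite addrC subrK.
Qed.

Lemma RI_FTC a b f F : a <= b -> cont a b f ->
  (forall x, x \in `[a, b] -> is_derive x 1 F (f x)) ->
  RI a b f = F b - F a.
Proof.
rewrite le_eqVlt => /predU1P[<- _ _|ab cf dF].
  by rewrite subrr /RI set_itvoo0 ?Rintegral_set0.
rewrite RIcc// /Rintegral (@continuous_FTC2 _ f F)//.
  have cF x : x \in `[a, b] -> {for x, continuous F}.
    by move=> /dF[dx _]; apply: differentiable_continuous; apply/derivable1_diffP.
  split.
  - by move=> x xab; have [] := dF x (subset_itv_oo_cc xab).
  - by apply: cvg_at_right_filter; apply: cF; rewrite in_itv/= lexx ltW.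
  - by apply: cvg_at_left_filter; apply: cF; rewrite in_itv/= lexx ltW.
move=> x xab; rewrite derive1E; have ? := dF x (subset_itv_oo_cc xab).
exact: derive_val.
Qed.

End Integral.

(** * Riemann sums and Fubini on a rectangle *)

Section Riemann.
Context {R : realType}.
Implicit Types (a b c d e : R) (f g : R -> R).

Definition riemann a b (N : nat) f : R :=
  \sum_(i < N) ((b - a) / N%:R) * f (a + i%:R * ((b - a) / N%:R)).

Lemma riemann_node a b N i : a <= b -> (i <= N)%N ->
  a + i%:R * ((b - a) / N%:R) \in `[a, b].
Proof.
case: N => [|N] ab iN.
  by rewrite invr0 !mulr0 addr0 in_itv/= lexx ab.
have h0 : 0 <= (b - a) / N.+1%:R by rewrite divr_ge0// subr_ge0.
rewrite in_itv/= lerDl mulr_ge0//= -lerBrDl mulrCA ler_piMr ?subr_ge0//.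
by rewrite ler_pdivrMr// mul1r ler_nat.
Qed.

Lemma riemann_approx a b N f e d : a <= b -> (0 < N)%N -> cont a b f ->
  (forall x y, x \in `[a, b] -> y \in `[a, b] -> `|x - y| < d ->
    `|f x - f y| <= e) ->
  (b - a) / N%:R < d -> `|RI a b f - riemann a b N f| <= (b - a) * e.
Proof.
move=> ab N0 cf H hd; rewrite /riemann; set h := (b - a) / N%:R.
have h0 : 0 <= h by rewrite divr_ge0 ?subr_ge0.
have Nh : N%:R * h = b - a by rewrite /h mulrC divfK// pnatr_eq0 -lt0n.
(* Induction on the number k of cells, the error staying proportional to the length covered. *)
have K k : (k <= N)%N -> `|RI a (a + k%:R * h) f -
    \sum_(i < k) h * f (a + i%:R * h)| <= k%:R * h * e.
  elim: k => [_|k IH kN].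
    rewrite big_ord0 !mul0r addr0 subr0 /RI set_itvoo0 Rintegral_set0.
    by rewrite normr0.
  have xk : a + k%:R * h \in `[a, b] by apply: riemann_node => //; exact: ltnW.
  have xk1 : a + k.+1%:R * h \in `[a, b] by exact: riemann_node.
  have kk : a + k%:R * h <= a + k.+1%:R * h.
    by rewrite lerD2l ler_wpM2r// ler_nat.
  move: (xk) (xk1); rewrite !in_itv/= => /andP[k1 k2] /andP[k3 k4].
  rewrite (RI_split k1 kk); last exact: (cont_sub (lexx a) k4).
  rewrite big_ord_recr/=.
  have -> : h * f (a + k%:R * h) =
      RI (a + k%:R * h) (a + k.+1%:R * h) (fun=> f (a + k%:R * h)).
    by rewrite RI_cst//; congr (_ * _); rewrite -natr1; ring.
  rewrite opprD addrACA -[X in _ + X]RIB; [|exact: (cont_sub k1 k4)|exact: cont_cst].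
  apply: le_trans (ler_normD _ _) _.
  have -> : k.+1%:R * h * e = k%:R * h * e +
      ((a + k.+1%:R * h) - (a + k%:R * h)) * e by rewrite -natr1; ring.
  apply: lerD; first exact: IH (ltnW kN).
  apply: RI_le => //; first by apply: contB; [exact: (cont_sub k1 k4)|exact: cont_cst].
  move=> x; rewrite in_itv/= => /andP[x1 x2]; apply: H => //.
    by rewrite in_itv/= (le_trans k1 (ltW x1)) (le_trans (ltW x2)).
  rewrite ger0_norm ?subr_ge0 ?ltW//; apply: le_lt_trans hd.
  by rewrite lerBlDl (le_trans (ltW x2))// -natr1 mulrDl mul1r addrA.
have := K N (leqnn N); rewrite Nh [a + _]addrC subrK.
by under eq_bigr do rewrite -/h.
Qed.

Lemma exists_mesh a b d : 0 < d -> exists2 N : nat, (0 < N)%N & (b - a) / N%:R < d.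
Proof.
move=> d0; have [N] : exists N : nat, `|(b - a) / d| < N%:R.
  by exists (Num.Def.truncn `|(b - a) / d|).+1; exact: truncnS_gt.
move=> H; have N0 : 0 < N%:R :> R by exact: le_lt_trans H.
exists N; first by rewrite -(ltr0n R).
by rewrite ltr_pdivrMr// mulrC -ltr_pdivrMr//; apply: le_lt_trans H; exact: ler_norm.
Qed.

Lemma riemann_cont a b c d N (H : R -> R -> R) : a <= b ->
  (forall x, x \in `[a, b] -> cont c d (H x)) ->
  cont c d (fun y => riemann a b N (H^~ y)) /\
  RI c d (fun y => riemann a b N (H^~ y)) = riemann a b N (fun x => RI c d (H x)).
Proof.
move=> ab cH; rewrite /riemann; set h := (b - a) / N%:R.
(* The number of terms is generalised to k <= N while the mesh h keeps its value. *)
have : (N <= N)%N by []; move: {-2}N => k kN.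
elim: k kN => [_|k IH kN].
  split; first by apply: (eq_cont (f := fun=> 0)); [move=> x _; rewrite big_ord0|exact: cont_cst].
  rewrite big_ord0 -[RHS](mul0r (RI c d (fun=> 0))) -RIZ; last exact: cont_cst.
  by apply: eq_RI => x _; rewrite big_ord0 mul0r.
have [IH1 IH2] := IH (ltnW kN).
have ck : cont c d (fun y => h * H (a + k%:R * h) y).
  by apply: contM; [exact: cont_cst|apply: cH; apply: riemann_node => //; exact: ltnW].
have E y : \sum_(i < k.+1) h * H (a + i%:R * h) y =
  \sum_(i < k) h * H (a + i%:R * h) y + h * H (a + k%:R * h) y.
  by rewrite big_ord_recr.
split; first by apply: (eq_cont _ (contD IH1 ck)) => y _; rewrite E.
rewrite (_ : (fun y => \sum_(i < k.+1) _) = fun y =>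
  \sum_(i < k) h * H (a + i%:R * h) y + h * H (a + k%:R * h) y); last exact/funext.
rewrite RID// IH2 big_ord_recr/= RIZ//.
by apply: cH; apply: riemann_node => //; exact: ltnW.
Qed.

Lemma eq_small (x y K : R) :
  (forall e, 0 < e -> `|x - y| <= K * e) -> x = y.
Proof.
move=> H; apply/eqP; rewrite -subr_eq0 -normr_le0; apply/ler_addgt0Pr => e e0.
rewrite add0r; have K1 : 0 < `|K| + 1 by rewrite ltr_wpDl.
apply: le_trans (H (e / (`|K| + 1)) _) _; first by rewrite divr_gt0.
rewrite mulrCA -[leRHS]mulr1; apply: ler_wpM2l; first exact: ltW.
rewrite ler_pdivrMr// mul1r.
by apply: le_trans (ler_norm K) _; rewrite lerDl.
Qed.

Definition ucont2 a b c d (H : R -> R -> R) := forall e : R, 0 < e ->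
  exists2 r : R, 0 < r & forall x x' y y',
    x \in `[a, b] -> x' \in `[a, b] -> y \in `[c, d] -> y' \in `[c, d] ->
    `|x - x'| < r -> `|y - y'| < r -> `|H x y - H x' y'| <= e.

Lemma continuous_ucont2 a b c d (H : R -> R -> R) :
  continuous (fun p : R * R => H p.1 p.2) -> ucont2 a b c d H.
Proof.
move=> cH e e0.
have cK : compact (`[a, b]%classic `*` `[c, d]%classic).
  by apply: compact_setX; exact: segment_compact.
have [r r0 K] := heine cK (continuous_subspaceT cH) e0.
exists r => // x x' y y' xab x'ab ycd y'cd xr yr.
by apply: (K (x, y) (x', y')).
Qed.

Lemma ucont2_1 a b c d H x : ucont2 a b c d H -> x \in `[a, b] -> cont c d (H x).
Proof.
move=> uH xab; apply/contP => e /uH[r r0 K]; exists r => // y y' ycd y'cd yr.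
by apply: K => //; rewrite subrr normr0.
Qed.

Lemma ucont2_C a b c d H : ucont2 a b c d H -> ucont2 c d a b (fun y x => H x y).
Proof. by move=> uH e /uH[r r0 K]; exists r => // *; exact: K. Qed.

Lemma ucont2_RI a b c d H : c <= d -> ucont2 a b c d H ->
  cont a b (fun x => RI c d (H x)).
Proof.
move=> cd uH; apply/contP => e e0.
have K1 : 0 < d - c + 1 by rewrite ltr_wpDl ?subr_ge0.
have [r r0 K] := uH _ (divr_gt0 e0 K1).
exists r => // x y xab yab xy.
rewrite -RIB; [|exact: (ucont2_1 uH)..].
apply: le_trans (RI_le cd (M := e / (d - c + 1)) _ _) _.
- by apply: contB; exact: (ucont2_1 uH).
- by move=> z /subset_itv_oo_cc zab; apply: K => //; rewrite subrr normr0.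
- rewrite mulrCA -[leRHS]mulr1; apply: ler_wpM2l; first exact: ltW.
  by rewrite ler_pdivrMr// mul1r lerDl.
Qed.

(** A finite sum commutes with the integral in y, so both iterated integrals lie within e times the
    area of one and the same Riemann sum in x. *)
Lemma RI_fubini a b c d H : a <= b -> c <= d -> ucont2 a b c d H ->
  RI a b (fun x => RI c d (H x)) = RI c d (fun y => RI a b (H^~ y)).
Proof.
move=> ab cd uH; apply: (@eq_small _ _ ((b - a) * (d - c) + (d - c) * (b - a))).
move=> e e0.
have [r r0 K] := uH e e0.
have [N N0 Nr] := exists_mesh a b r0.
have cH x : x \in `[a, b] -> cont c d (H x) by exact: ucont2_1.
have [c1 e1] := riemann_cont N ab cH.
rewrite -(subrKA (riemann a b N (fun x => RI c d (H x)))) mulrDl.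
apply: le_trans (ler_normD _ _) (lerD _ _).
  rewrite -mulrA; apply: (@riemann_approx _ _ _ _ _ r) => //; first exact: ucont2_RI.
  move=> x y xab yab xy; rewrite -RIB; [|exact: cH..].
  apply: RI_le => //; first by apply: contB; exact: cH.
  by move=> z /subset_itv_oo_cc zab; apply: K => //; rewrite subrr normr0.
have c2 := ucont2_RI ab (ucont2_C uH).
rewrite -e1 -RIB// -mulrA; apply: RI_le => //; first exact: contB.
move=> y /subset_itv_oo_cc ycd; rewrite distrC.
apply: (@riemann_approx _ _ _ _ _ r) => //; first exact: (ucont2_1 (ucont2_C uH)).
by move=> x x' xab x'ab xx'; apply: K => //; rewrite subrr normr0.
Qed.

End Riemann.

(** * Complex-valued integrals *)

(** The real-valued modulus: the norm of [R[i]] takes its values in [R[i]], which is awkward in real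
    estimates. *)
Notation nrm := Normc.normc.

Section ComplexNorm.
Context {R : realType}.
Implicit Types (z w : R[i]) (x : R).

Lemma nrm_ge0 z : 0 <= nrm z.
Proof. by case: z => a b; exact: sqrtr_ge0. Qed.

Lemma nrmN z : nrm (- z) = nrm z.
Proof. by case: z => a b /=; rewrite !sqrrN. Qed.

Lemma nrm0 : nrm (0 : R[i]) = 0.
Proof. by rewrite /= expr0n/= addr0 sqrtr0. Qed.

Lemma nrm_C x : nrm x%:C = `|x|.
Proof. by rewrite /= expr0n/= addr0 sqrtr_sqr. Qed.

Lemma nrmD z w : nrm (z + w) <= nrm z + nrm w.
Proof. exact: le_normcD. Qed.

Lemma nrmB z w : nrm (z - w) <= nrm z + nrm w.
Proof. by rewrite -(nrmN w) nrmD. Qed.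

Lemma nrm_distC z w : nrm (z - w) = nrm (w - z).
Proof. by rewrite -nrmN opprB. Qed.

Lemma nrmM z w : nrm (z * w) = nrm z * nrm w.
Proof. exact: Normc.normcM. Qed.

Lemma nrmV z : nrm z^-1 = (nrm z)^-1.
Proof. exact: Normc.normcV. Qed.

Lemma nrm_eq0 z : nrm z = 0 -> z = 0.
Proof. exact: Normc.eq0_normc. Qed.

Lemma nrm_gt0 z : z != 0 -> 0 < nrm z.
Proof. by move=> z0; rewrite lt_def nrm_ge0 andbT; apply: contra_neq z0 => /nrm_eq0. Qed.

Lemma Re_le z : `|complex.Re z| <= nrm z.
Proof.
by case: z => a b /=; rewrite -sqrtr_sqr ler_wsqrtr// lerDl sqr_ge0.
Qed.

Lemma Im_le z : `|complex.Im z| <= nrm z.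
Proof.
by case: z => a b /=; rewrite -sqrtr_sqr ler_wsqrtr// lerDr sqr_ge0.
Qed.

Lemma nrm_le z : nrm z <= `|complex.Re z| + `|complex.Im z|.
Proof.
case: z => a b /=; rewrite -[leRHS]ger0_norm ?addr_ge0// -sqrtr_sqr ler_wsqrtr//.
by rewrite sqrrD !real_normK ?num_real// addrAC lerDl mulrn_wge0 ?mulr_ge0.
Qed.

Lemma normC_nrm z : `|z| = (nrm z)%:C.
Proof. by rewrite normc_def; case: z. Qed.

Lemma cReD z w : complex.Re (z + w) = complex.Re z + complex.Re w.
Proof. by case: z w => [a b] [c d]. Qed.
Lemma cImD z w : complex.Im (z + w) = complex.Im z + complex.Im w.
Proof. by case: z w => [a b] [c d]. Qed.
Lemma cReN z : complex.Re (- z) = - complex.Re z.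
Proof. by case: z. Qed.
Lemma cImN z : complex.Im (- z) = - complex.Im z.
Proof. by case: z. Qed.
Lemma cReM z w : complex.Re (z * w) =
  complex.Re z * complex.Re w - complex.Im z * complex.Im w.
Proof. by case: z w => [a b] [c d]. Qed.
Lemma cImM z w : complex.Im (z * w) =
  complex.Re z * complex.Im w + complex.Im z * complex.Re w.
Proof. by case: z w => [a b] [c d]. Qed.

Lemma complex_ext z w : complex.Re z = complex.Re w ->
  complex.Im z = complex.Im w -> z = w.
Proof. by case: z w => [a b] [c d] /= -> ->. Qed.

Lemma nrm_sum n (f : 'I_n -> R[i]) (g : 'I_n -> R) :
  (forall j, nrm (f j) <= g j) -> nrm (\sum_j f j) <= \sum_j g j.
Proof.
move=> fg; elim/big_ind2: _ => [|z x1 w x2 zx wx|j _]; rewrite ?nrm0//.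
exact: le_trans (nrmD _ _) (lerD zx wx).
Qed.

Lemma nrm_small z w K : (forall e, 0 < e -> nrm (z - w) <= K * e) -> z = w.
Proof.
move=> H; apply/eqP; rewrite -subr_eq0; apply/eqP/nrm_eq0.
apply: (eq_small (K := K)) => e e0; rewrite subr0 ger0_norm ?nrm_ge0//.
exact: H.
Qed.

End ComplexNorm.

Section ComplexIntegral.
Context {R : realType}.
Implicit Types (f g : R -> R[i]).

Definition ccont f := cont 0 1 (fun x => complex.Re (f x)) /\
  cont 0 1 (fun x => complex.Im (f x)).

Definition cint f : R[i] :=
  Complex (RI 0 1 (fun x => complex.Re (f x))) (RI 0 1 (fun x => complex.Im (f x))).

Lemma ccontP f : ccont f <-> forall e : R, 0 < e -> exists2 d : R, 0 < d &
    forall x y, x \in `[0, 1] -> y \in `[0, 1] -> `|x - y| < d ->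
      nrm (f x - f y) <= e.
Proof.
split=> [[/contP c1 /contP c2] e e0|H].
  have e2 : 0 < e / 2 by rewrite divr_gt0.
  have [d1 d10 H1] := c1 _ e2; have [d2 d20 H2] := c2 _ e2.
  exists (Num.min d1 d2); first by rewrite lt_min d10.
  move=> x y x1 y1; rewrite lt_min => /andP[xy1 xy2].
  apply: le_trans (nrm_le _) _; rewrite cReD cImD cReN cImN [leRHS]splitr.
  by apply: lerD; [exact: H1|exact: H2].
split; apply/contP => e /H[d d0 K]; exists d => // x y x1 y1 xy;
  apply: le_trans (K x y x1 y1 xy).
- by rewrite -cReN -cReD Re_le.
- by rewrite -cImN -cImD Im_le.
Qed.

Lemma ccont_cst (z : R[i]) : ccont (fun=> z).
Proof. by split; exact: cont_cst. Qed.

Lemma ccontD f g : ccont f -> ccont g -> ccont (fun x => f x + g x).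
Proof.
move=> [f1 f2] [g1 g2]; split.
- by apply: eq_cont (contD f1 g1) => x _; rewrite cReD.
- by apply: eq_cont (contD f2 g2) => x _; rewrite cImD.
Qed.

Lemma ccontB f g : ccont f -> ccont g -> ccont (fun x => f x - g x).
Proof.
move=> [f1 f2] [g1 g2]; split.
- by apply: eq_cont (contB f1 g1) => x _; rewrite cReD cReN.
- by apply: eq_cont (contB f2 g2) => x _; rewrite cImD cImN.
Qed.

Lemma ccontM f g : ccont f -> ccont g -> ccont (fun x => f x * g x).
Proof.
move=> [f1 f2] [g1 g2]; split.
- by apply: eq_cont (contB (contM f1 g1) (contM f2 g2)) => x _; rewrite cReM.
- by apply: eq_cont (contD (contM f1 g2) (contM f2 g1)) => x _; rewrite cImM.
Qed.

Lemma eq_ccont f g : {in `[0, 1], f =1 g} -> ccont f -> ccont g.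
Proof.
by move=> fg [f1 f2]; split; [apply: eq_cont f1|apply: eq_cont f2] => x /fg ->.
Qed.

Lemma ccontV f (m : R) : 0 < m -> (forall x, x \in `[0, 1] -> m <= nrm (f x)) ->
  ccont f -> ccont (fun x => (f x)^-1).
Proof.
move=> m0 Hm /ccontP cf; apply/ccontP => e e0.
have [d d0 H] := cf (e * (m * m)) (mulr_gt0 e0 (mulr_gt0 m0 m0)).
exists d => // x y x1 y1 xy.
have nx := lt_le_trans m0 (Hm x x1); have ny := lt_le_trans m0 (Hm y y1).
have fx : f x != 0 by apply: contraTneq nx => ->; rewrite nrm0 ltxx.
have fy : f y != 0 by apply: contraTneq ny => ->; rewrite nrm0 ltxx.
have -> : (f x)^-1 - (f y)^-1 = (f y - f x) * ((f x)^-1 * (f y)^-1).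
  by field; apply/andP.
rewrite !nrmM !nrmV -invfM ler_pdivrMr ?mulr_gt0// nrm_distC.
apply: le_trans (H x y x1 y1 xy) _.
by rewrite ler_pM2l// ler_pM ?Hm// ltW.
Qed.

Lemma ccont_bounded f : ccont f ->
  exists2 M : R, 0 < M & forall x, x \in `[0, 1] -> nrm (f x) <= M.
Proof.
move=> /ccontP cf; have [d d0 H] := cf 1 ltr01.
have [N N0 Nd] := exists_mesh 0 1 d0; rewrite subr0 in Nd.
(* The sum over the nodes stands for their maximum; N + 1 of them, because x = 1 is its own left
   node. *)
exists (1 + \sum_(i < N.+1) nrm (f (i%:R / N%:R))).
  by rewrite ltr_pwDl// sumr_ge0// => i _; exact: nrm_ge0.
move=> x; rewrite in_itv/= => /andP[x0 x1].
have N0' : 0 < N%:R :> R by rewrite ltr0n.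
pose k := Num.Def.truncn (x * N%:R).
have xN : 0 <= x * N%:R by rewrite mulr_ge0// ltW.
have := truncn_itv xN; rewrite -/k => /andP[k1 k2].
have kN : (k < N.+1)%N.
  by rewrite ltnS -(ler_nat R); apply: le_trans k1 _; rewrite ler_piMl// ltW.
have kx : k%:R / N%:R <= x by rewrite ler_pdivrMr.
have xk : x - k%:R / N%:R < d.
  apply: le_lt_trans Nd; rewrite lerBlDr -mulrDl ler_pdivlMr// -[1%R]/(1%:R) -natrD.
  by rewrite add1n ltW.
have : nrm (f x) <= 1 + nrm (f (k%:R / N%:R)).
  rewrite -[f x](subrK (f (k%:R / N%:R))); apply: le_trans (nrmD _ _) _.
  rewrite lerD2r; apply: H.
  - by rewrite in_itv/= x0.
  - by rewrite in_itv/= divr_ge0// (le_trans kx).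
  - by rewrite ger0_norm ?subr_ge0.
move=> /le_trans; apply; rewrite lerD2l (bigD1 (Ordinal kN))//= lerDl.
by apply: sumr_ge0 => i _; exact: nrm_ge0.
Qed.

Lemma eq_cint f g : {in `]0, 1[, f =1 g} -> cint f = cint g.
Proof. by move=> fg; congr Complex; apply: eq_RI => x /fg ->. Qed.

Lemma cintD f g : ccont f -> ccont g ->
  cint (fun x => f x + g x) = cint f + cint g.
Proof.
move=> [f1 f2] [g1 g2]; apply: complex_ext; rewrite ?cReD ?cImD/= -RID//.
- by apply: eq_RI => x _; rewrite cReD.
- by apply: eq_RI => x _; rewrite cImD.
Qed.

Lemma cintZ (z : R[i]) f : ccont f -> cint (fun x => z * f x) = z * cint f.
Proof.
move=> [f1 f2]; apply: complex_ext; rewrite ?cReM ?cImM/= -!RIZ//.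
- rewrite -RIB; [|by apply: contM => //; exact: cont_cst..].
  by apply: eq_RI => x _; rewrite cReM.
- rewrite -RID; [|by apply: contM => //; exact: cont_cst..].
  by apply: eq_RI => x _; rewrite cImM.
Qed.

Lemma cintB f g : ccont f -> ccont g ->
  cint (fun x => f x - g x) = cint f - cint g.
Proof.
move=> cf cg; rewrite -[- cint g]mulN1r -cintZ// -cintD//.
  by apply: eq_cint => x _; rewrite mulN1r.
by apply: ccontM => //; exact: ccont_cst.
Qed.

(** Real and imaginary parts are bounded separately; the resulting factor 2 is harmless everywhere
    below. *)
Lemma cint_le (M : R) f : ccont f -> {in `]0, 1[, forall x, nrm (f x) <= M} ->
  nrm (cint f) <= 2 * M.
Proof.
move=> [f1 f2] H; apply: le_trans (nrm_le _) _; rewrite mulr2n mulrDl !mul1r.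
apply: lerD; rewrite /cint [_ (_ +i* _)]/=; rewrite -[leRHS]mul1r -{2}(subr0 1);
  apply: RI_le => // x /H; apply: le_trans; [exact: Re_le|exact: Im_le].
Qed.

Lemma cint_cst (z : R[i]) : cint (fun=> z) = z.
Proof. by apply: complex_ext; rewrite /= RI_cst// subr0 mul1r. Qed.

Definition cderiv (F : R -> R[i]) (x : R) (l : R[i]) :=
  is_derive x (1 : R) (fun y : R => complex.Re (F y)) (complex.Re l) /\
  is_derive x (1 : R) (fun y : R => complex.Im (F y)) (complex.Im l).

Lemma cint_FTC f F : ccont f ->
  (forall x, x \in `[0, 1] -> cderiv F x (f x)) -> cint f = F 1 - F 0.
Proof.
move=> [f1 f2] dF; apply: complex_ext; rewrite /= ?cReD ?cImD ?cReN ?cImN.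
- by apply: (RI_FTC (F := fun y => complex.Re (F y)) ler01 f1) => x /dF[].
- by apply: (RI_FTC (F := fun y => complex.Im (F y)) ler01 f2) => x /dF[].
Qed.

Definition criemann (N : nat) f : R[i] :=
  \sum_(i < N) (N%:R^-1)%:C * f (i%:R / N%:R).

Lemma criemann_approx N f (e d : R) : (0 < N)%N -> ccont f ->
  (forall x y, x \in `[0, 1] -> y \in `[0, 1] -> `|x - y| < d ->
    nrm (f x - f y) <= e) ->
  N%:R^-1 < d -> nrm (cint f - criemann N f) <= 2 * e.
Proof.
move=> N0 [f1 f2] H Nd; apply: le_trans (nrm_le _) _.
(* Stated for any R-linear [hC], to serve both components. *)
have R1 (h : R -> R) (hC : R[i] -> R) : h = (fun x => hC (f x)) ->
    (forall z w, hC (z + w) = hC z + hC w) ->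
    (forall (x : R) z, hC (x%:C * z) = x * hC z) ->
    hC (criemann N f) = riemann 0 1 N h.
  move=> -> hD hZ; rewrite /riemann /criemann.
  have h0 : hC 0 = 0 by have := hD 0 0; rewrite addr0 => /(congr1 (fun t => t - hC 0)); rewrite subrr addrK.
  rewrite (big_morph hC hD h0); apply: eq_bigr => i _.
  by rewrite hZ subr0 !add0r !mul1r.
rewrite mulr2n mulrDl !mul1r cReD cImD cReN cImN.
rewrite (R1 _ (@complex.Re R) erefl (@cReD R)) ?(R1 _ (@complex.Im R) erefl (@cImD R)); first last.
- by move=> x z; rewrite cReM/= mul0r subr0.
- by move=> x z; rewrite cImM/= mul0r addr0.
have Nd' : (1 - 0) / N%:R < d by rewrite subr0 mul1r.
have step h : cont 0 1 h -> (forall x y, x \in `[0, 1] -> y \in `[0, 1] ->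
    `|x - y| < d -> `|h x - h y| <= e) -> `|RI 0 1 h - riemann 0 1 N h| <= e.
  by move=> ch Hh; have := riemann_approx ler01 N0 ch Hh Nd'; rewrite subr0 mul1r.
apply: lerD; apply: step => // x y x1 y1 xy; apply: le_trans (H x y x1 y1 xy).
- by rewrite -cReN -cReD Re_le.
- by rewrite -cImN -cImD Im_le.
Qed.

End ComplexIntegral.

(** * Complex exponential and strict differentiability *)

Section ComplexExp.
Context {R : realType}.
Implicit Types (z w : R[i]) (s : R).

Definition cexp z : R[i] :=
  Complex (expR (complex.Re z) * cos (complex.Im z))
          (expR (complex.Re z) * sin (complex.Im z)).

Lemma nrm_cexp z : nrm (cexp z) = expR (complex.Re z).
Proof.
rewrite /cexp/= !exprMn -mulrDr cos2Dsin2 mulr1 sqrtr_sqr gtr0_norm//.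
exact: expR_gt0.
Qed.

Lemma cexpD z w : cexp (z + w) = cexp z * cexp w.
Proof.
by apply: complex_ext; rewrite ?cReM ?cImM /cexp/= ?cReD ?cImD expRD ?cosD ?sinD; ring.
Qed.

Lemma cexp0 : cexp 0 = 1.
Proof. by apply: complex_ext; rewrite /cexp/= expR0 ?cos0 ?sin0 ?mulr1 ?mulr0. Qed.

Lemma cexp_cderiv (al be : R[i]) s :
  cderiv (fun y : R => cexp (be + y%:C * al)) s (al * cexp (be + s%:C * al)).
Proof.
have E1 : (fun y : R => complex.Re (be + y%:C * al)) =
    (fun y : R => complex.Re be + y * complex.Re al).
  by apply/funext => y; rewrite cReD cReM/= mul0r subr0.
have E2 : (fun y : R => complex.Im (be + y%:C * al)) =
    (fun y : R => complex.Im be + y * complex.Im al).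
  by apply/funext => y; rewrite cImD cImM/= mul0r addr0.
rewrite /cderiv /cexp [complex.Re (al * _)]cReM [complex.Im (al * _)]cImM /=.
have -> : complex.Re (be + s%:C * al) = complex.Re be + s * complex.Re al.
  exact: (congr1 (@^~ s) E1).
have -> : complex.Im (be + s%:C * al) = complex.Im be + s * complex.Im al.
  exact: (congr1 (@^~ s) E2).
have -> : (fun y : R => expR (complex.Re (be + y%:C * al)) * cos (complex.Im (be + y%:C * al)))
 = (fun y => expR (complex.Re be + y * complex.Re al) * cos (complex.Im be + y * complex.Im al)).
  by apply/funext => y; rewrite -(congr1 (@^~ y) E1) -(congr1 (@^~ y) E2).
have -> : (fun y : R => expR (complex.Re (be + y%:C * al)) * sin (complex.Im (be + y%:C * al)))
 = (fun y => expR (complex.Re be + y * complex.Re al) * sin (complex.Im be + y * complex.Im al)).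
  by apply/funext => y; rewrite -(congr1 (@^~ y) E1) -(congr1 (@^~ y) E2).
move: (complex.Re be) (complex.Re al) (complex.Im be) (complex.Im al) => b1 a1 b2 a2.
have d1 (b a : R) : is_derive s (1 : R) (fun y : R => b + y * a) a.
  apply: is_derive_eq; rewrite /= ?scaler0 ?add0r ?scale1r.
  by rewrite mul1r /GRing.scale/= mulr1.
have de : is_derive s (1 : R) (fun y : R => expR (b1 + y * a1)) (expR (b1 + s * a1) * a1).
  have := is_derive1_comp (f := expR) (g := fun y => b1 + y * a1) (x := s).
  by move=> /(_ _ _ (is_derive_expR _) (d1 b1 a1)); rewrite mulrC.
have dc : is_derive s (1 : R) (fun y : R => cos (b2 + y * a2)) (- sin (b2 + s * a2) * a2).
  have := is_derive1_comp (f := cos) (g := fun y => b2 + y * a2) (x := s).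
  by move=> /(_ _ _ (is_derive_cos _) (d1 b2 a2)); rewrite mulrC.
have ds : is_derive s (1 : R) (fun y : R => sin (b2 + y * a2)) (cos (b2 + s * a2) * a2).
  have := is_derive1_comp (f := sin) (g := fun y => b2 + y * a2) (x := s).
  by move=> /(_ _ _ (is_derive_sin _) (d1 b2 a2)); rewrite mulrC.
split.
- have := @is_deriveM _ _ _ _ _ _ _ _ de dc => H; apply: is_derive_eq.
  by rewrite /GRing.scale/=; ring.
- have := @is_deriveM _ _ _ _ _ _ _ _ de ds => H; apply: is_derive_eq.
  by rewrite /GRing.scale/=; ring.
Qed.

Lemma ccont_cexp (al be : R[i]) : ccont (fun s => cexp (be + s%:C * al)).
Proof.
split; apply: derivable_within_continuous => x _.
- by have [[]] := cexp_cderiv al be x.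
- by have [_ []] := cexp_cderiv al be x.
Qed.

(** The mean value theorem fails for complex values; this integral along the segment replaces it,
    for the Lipschitz bound and for strict differentiability. *)
Lemma cexp_sub z w : cexp z - cexp w =
  cint (fun s => (z - w) * cexp (w + s%:C * (z - w))).
Proof.
rewrite (cint_FTC (F := fun s : R => cexp (w + s%:C * (z - w)))).
- by rewrite mul1r mul0r addr0 [w + _]addrC subrK.
- by apply: ccontM; [exact: ccont_cst|exact: ccont_cexp].
- by move=> x _; exact: cexp_cderiv.
Qed.

Lemma Re_segment z w B s : complex.Re z <= B -> complex.Re w <= B ->
  s \in `[0, 1] -> complex.Re (w + s%:C * (z - w)) <= B.
Proof.
rewrite in_itv/= => zB wB /andP[s0 s1].
rewrite cReD cReM/= mul0r subr0 cReD cReN.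
have -> : complex.Re w + s * (complex.Re z - complex.Re w) =
  (1 - s) * complex.Re w + s * complex.Re z by ring.
have -> : B = (1 - s) * B + s * B by ring.
by rewrite lerD// ler_wpM2l// subr_ge0.
Qed.

Lemma cexp_lip z w B : complex.Re z <= B -> complex.Re w <= B ->
  nrm (cexp z - cexp w) <= 2 * expR B * nrm (z - w).
Proof.
move=> zB wB; rewrite cexp_sub -mulrA; apply: cint_le.
  by apply: ccontM; [exact: ccont_cst|exact: ccont_cexp].
move=> s /subset_itv_oo_cc s01; rewrite nrmM nrm_cexp mulrC ler_wpM2r ?nrm_ge0//.
by rewrite ler_expR; exact: Re_segment.
Qed.

End ComplexExp.

Section StrictDiff.
Context {R : realType}.
Implicit Types (F : R[i] -> R[i]) (z w l : R[i]).

(* Strict differentiability at z0: both points move. It makes F' continuous. *)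
Definition sdiff F l z0 := forall e : R, 0 < e -> exists2 d : R, 0 < d &
  forall z w, nrm (z - z0) < d -> nrm (w - z0) < d ->
    nrm (F w - F z - l * (w - z)) <= e * nrm (w - z).

Lemma sdiff_cexp z0 : sdiff cexp (cexp z0) z0.
Proof.
move=> e e0; pose B := complex.Re z0 + 1.
(* Radius 1 keeps the real parts below B; the 4 collects the factors 2 of [cint_le] and
   [cexp_lip]. *)
pose d := Num.min 1 (e / (4 * expR B)).
have d0 : 0 < d by rewrite lt_min ltr01 divr_gt0// mulr_gt0// expR_gt0.
exists d => // z w zd wd.
have ReB y : nrm (y - z0) < d -> complex.Re y <= B.
  rewrite lt_min => /andP[H _]; rewrite /B -lerBlDl -cReN -cReD.
  exact: le_trans (ler_norm _) (le_trans (Re_le _) (ltW H)).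
rewrite cexp_sub.
have -> : cint (fun s => (w - z) * cexp (z + s%:C * (w - z))) - cexp z0 * (w - z)
  = cint (fun s => (w - z) * (cexp (z + s%:C * (w - z)) - cexp z0)).
  rewrite [LHS](congr1 (fun t => t - _) (cintZ _ (ccont_cexp (w - z) z))).
  rewrite [RHS](cintZ _ (ccontB (ccont_cexp (w - z) z) (ccont_cst (cexp z0)))).
  rewrite (cintB (ccont_cexp (w - z) z) (ccont_cst (cexp z0))) cint_cst.
  by ring.
have -> : e * nrm (w - z) = 2 * (nrm (w - z) * (2 * expR B * (e / (4 * expR B)))).
  by field; rewrite gt_eqF// expR_gt0.
apply: cint_le.
  apply: ccontM; first exact: ccont_cst.
  by apply: ccontB; [exact: ccont_cexp|exact: ccont_cst].
move=> s /subset_itv_oo_cc s01; rewrite nrmM ler_wpM2l ?nrm_ge0//.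
apply: le_trans (cexp_lip (B := B) _ _) _.
- by apply: Re_segment => //; exact: ReB.
- by rewrite /B lerDl.
rewrite ler_wpM2l ?mulr_ge0 ?expR_ge0//.
have -> : z + s%:C * (w - z) - z0 = (1 - s)%:C * (z - z0) + s%:C * (w - z0).
  by rewrite rmorphB rmorph1; ring.
move: s01; rewrite in_itv/= => /andP[s0 s1].
apply: le_trans (nrmD _ _) _; rewrite !nrmM !nrm_C !ger0_norm ?subr_ge0//.
have le_d x : x < d -> x <= e / (4 * expR B) by rewrite lt_min => /andP[_ /ltW].
have -> : e / (4 * expR B) = (1 - s) * (e / (4 * expR B)) + s * (e / (4 * expR B)) by ring.
by apply: lerD; rewrite ler_wpM2l ?subr_ge0//; exact: le_d.
Qed.

Lemma sdiff_affine F l (al be : R[i]) z0 : sdiff F l (be + al * z0) ->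
  sdiff (fun z => F (be + al * z)) (al * l) z0.
Proof.
move=> HF e e0; have A1 : 0 < nrm al + 1 by rewrite ltr_wpDl ?nrm_ge0.
have [d d0 H] := HF _ (divr_gt0 e0 A1).
exists (d / (nrm al + 1)); first exact: divr_gt0.
have K y : nrm (y - z0) < d / (nrm al + 1) ->
    nrm (be + al * y - (be + al * z0)) < d.
  move=> yd; have -> : be + al * y - (be + al * z0) = al * (y - z0) by ring.
  rewrite nrmM; apply: le_lt_trans (_ : (nrm al + 1) * nrm (y - z0) < _).
    by rewrite ler_wpM2r ?nrm_ge0// lerDl.
  by rewrite mulrC -ltr_pdivlMr.
move=> z w /K zd /K wd.
have -> : al * l * (w - z) = l * (be + al * w - (be + al * z)) by ring.
apply: le_trans (H _ _ zd wd) _.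
have -> : be + al * w - (be + al * z) = al * (w - z) by ring.
rewrite nrmM mulrA ler_wpM2r ?nrm_ge0// -mulrA ler_piMr ?(ltW e0)// mulrC.
by rewrite ler_pdivrMr// mul1r lerDl.
Qed.

Lemma sdiffZ F l c z0 : sdiff F l z0 -> sdiff (fun z => c * F z) (c * l) z0.
Proof.
move=> HF e e0; have A1 : 0 < nrm c + 1 by rewrite ltr_wpDl ?nrm_ge0.
have [d d0 H] := HF _ (divr_gt0 e0 A1).
exists d => // z w zd wd.
have -> : c * F w - c * F z - c * l * (w - z) = c * (F w - F z - l * (w - z)) by ring.
rewrite nrmM; apply: le_trans (ler_wpM2l (nrm_ge0 _) (H z w zd wd)) _.
rewrite mulrA ler_wpM2r ?nrm_ge0// mulrCA ler_piMr ?(ltW e0)//.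
by rewrite ler_pdivrMr// mul1r lerDl.
Qed.

Lemma sdiff_inv z0 : z0 != 0 -> sdiff (fun z => z^-1) (- (z0 ^+ 2)^-1) z0.
Proof.
move=> z00 e e0; have n0 := nrm_gt0 z00; set n := nrm z0 in n0.
(* Within n / 2 of z0 the denominator below is at least n^4 / 4, and the numerator is at most d * 2
   n + n * d = 3 n d. *)
pose d := Num.min (n / 2) (e * n ^+ 3 / 12).
have d0 : 0 < d by rewrite lt_min divr_gt0//= divr_gt0// mulr_gt0// exprn_gt0.
exists d => // z w zd wd.
have low y : nrm (y - z0) < d -> n / 2 <= nrm y.
  rewrite lt_min => /andP[H _]; rewrite -(lerD2r (n / 2)) -splitr.
  rewrite /n -{1}(subKr y z0); apply: le_trans (nrmB _ _) _.
  by rewrite lerD2l ltW.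
have nz y : nrm (y - z0) < d -> y != 0.
  by move=> /low; apply: contraTneq => ->; rewrite nrm0 -ltNge divr_gt0.
have z1 := nz _ zd; have w1 := nz _ wd.
have -> : w^-1 - z^-1 - - (z0 ^+ 2)^-1 * (w - z) =
    (w - z) * (((z - z0) * w + z0 * (w - z0)) / (z0 ^+ 2 * (z * w))).
  by field; rewrite z1 w1.
rewrite nrmM mulrC ler_wpM2r ?nrm_ge0// nrmM nrmV.
have P : 0 < nrm (z0 ^+ 2 * (z * w)) by rewrite nrm_gt0// !mulf_neq0// expf_neq0.
rewrite ler_pdivrMr//.
have Q : n ^+ 4 / 4 <= nrm (z0 ^+ 2 * (z * w)).
  rewrite !nrmM -/n.
  have -> : n ^+ 4 / 4 = n * n * (n / 2 * (n / 2)) by field.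
  rewrite ler_wpM2l ?mulr_ge0 ?(ltW n0)//.
  by rewrite ler_pM ?low ?divr_ge0 ?(ltW n0).
apply: le_trans (_ : _ <= e * (n ^+ 4 / 4)) _; last by rewrite ler_wpM2l ?(ltW e0).
have wn : nrm w <= 2 * n.
  rewrite -(subrK z0 w); apply: le_trans (nrmD _ _) _.
  move: wd; rewrite lt_min -/n => /andP[wd _].
  by apply: le_trans (lerD (ltW wd) (lexx n)) _; lra.
apply: le_trans (nrmD _ _) _; rewrite !nrmM -/n.
move: zd wd; rewrite !lt_min => /andP[_ /ltW zd] /andP[_ /ltW wd].
apply: le_trans (lerD (ler_pM (nrm_ge0 _) (nrm_ge0 _) zd wn)
  (ler_wpM2l (ltW n0) wd)) _.
by rewrite le_eqVlt; apply/orP; left; apply/eqP; field.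
Qed.

Lemma nrm_line z0 (h : R[i]) d : 0 < d -> exists2 t : R, 0 < t & nrm (t%:C * h) < d.
Proof.
move=> d0; have A1 : 0 < nrm h + 1 by rewrite ltr_wpDl ?nrm_ge0.
exists (d / (nrm h + 1)); first exact: divr_gt0.
rewrite nrmM nrm_C gtr0_norm ?divr_gt0// mulrAC -mulrA gtr_pMr//.
by rewrite ltr_pdivrMr// mul1r ltrDl.
Qed.

(** One increment F (z + t) - F z, with t tiny, is compared with F' z0 * t by strictness at z0 and
    with F' z * t by strictness at z. Ordinary differentiability at z0 would not allow the base
    point z. *)
Lemma sdiff_deriv_continuous (F F' : R[i] -> R[i]) (D : set R[i]) z0 :
  (forall z, D z -> sdiff F (F' z) z) -> D z0 -> forall e : R, 0 < e ->
  exists2 d : R, 0 < d & forall z, D z -> nrm (z - z0) < d ->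
    nrm (F' z - F' z0) <= e.
Proof.
move=> HF Dz0 e e0; have e2 : 0 < e / 2 by rewrite divr_gt0.
have [d d0 H] := HF _ Dz0 _ e2.
exists d => // z Dz zd; have [d' d'0 H'] := HF _ Dz _ e2.
pose m := Num.min d' (d - nrm (z - z0)).
have m0 : 0 < m by rewrite lt_min d'0 subr_gt0.
have [t t0 tm] := nrm_line z 1 m0; rewrite mulr1 in tm.
move: (tm); rewrite lt_min => /andP[td' td].
have K1 := H z (z + t%:C) zd.
have K2 := H' z (z + t%:C).
have E : z + t%:C - z = t%:C by ring.
rewrite subrr nrm0 !E in K2; rewrite E in K1.
have {}K2 := K2 d'0 td'.
have {}K1 : nrm (F (z + t%:C) - F z - F' z0 * t%:C) <= e / 2 * nrm t%:C.
  apply: K1; rewrite addrAC; apply: le_lt_trans (nrmD _ _) _.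
  by rewrite -ltrBrDl.
have T0 : 0 < nrm t%:C by rewrite nrm_C gtr0_norm.
rewrite -(ler_pM2r T0) -nrmM.
have -> : (F' z - F' z0) * t%:C = (F (z + t%:C) - F z - F' z0 * t%:C) -
  (F (z + t%:C) - F z - F' z * t%:C) by ring.
apply: le_trans (nrmB _ _) _.
by rewrite [e]splitr mulrDl lerD.
Qed.

Lemma sdiff_cderiv F l (al be : R[i]) (s : R) : sdiff F l (be + s%:C * al) ->
  cderiv (fun y : R => F (be + y%:C * al)) s (al * l).
Proof.
move=> HF.
have step (h : R[i] -> R) : (forall z w, h (z + w) = h z + h w) ->
    (forall (x : R) z, h (x%:C * z) = x * h z) ->
    (forall z, `|h z| <= nrm z) ->
    is_derive s (1 : R) (fun y : R => h (F (be + y%:C * al))) (h (al * l)).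
  move=> hD hZ hle.
  have hB z w : h (z - w) = h z - h w.
    by rewrite hD -mulN1r -[-1](rmorphN1 (real_complex R)) hZ mulN1r.
  suff H : (fun x : R => x^-1 *: (h (F (be + (x *: 1 + s)%:C * al)) -
      h (F (be + s%:C * al)))) @ 0^' --> h (al * l).
    by split; [apply/cvg_ex; exists (h (al * l))|exact: cvg_lim H].
  apply/cvgrPdist_le => e e0.
  have A1 : 0 < nrm al + 1 by rewrite ltr_wpDl ?nrm_ge0.
  have [d d0 H] := HF _ (divr_gt0 e0 A1).
  apply/nbhs_ballP; exists (d / (nrm al + 1)); first exact: divr_gt0.
  move=> x; rewrite /ball/= sub0r normrN => xd x0.
  have E : be + (x *: 1 + s)%:C * al = be + s%:C * al + x%:C * al.
    by rewrite /GRing.scale/= mulr1 rmorphD/=; ring.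
  have := H (be + s%:C * al) (be + s%:C * al + x%:C * al).
  rewrite subrr nrm0 [_ + _ * al - _]addrAC subrr add0r nrmM nrm_C => /(_ d0).
  have -> : `|x| * nrm al < d.
    apply: le_lt_trans (_ : `|x| * (nrm al + 1) < d); first by rewrite ler_wpM2l ?lerDl.
    by rewrite -ltr_pdivlMr.
  move=> /(_ isT) K; rewrite E distrC.
  rewrite -hB /GRing.scale/= -[x^-1 * _]hZ -hB.
  apply: le_trans (hle _) _.
  have x0' : x%:C != 0 :> R[i] by rewrite -(inj_eq (@complexI R)) in x0 *.
  have -> : x^-1%:C * (F (be + s%:C * al + x%:C * al) - F (be + s%:C * al)) - al * l =
     x^-1%:C * (F (be + s%:C * al + x%:C * al) - F (be + s%:C * al) - l * (x%:C * al)).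
    by rewrite fmorphV; field.
  rewrite nrmM nrm_C normfV ler_pdivrMl ?normr_gt0//.
  apply: le_trans K _; rewrite mulrCA ler_wpM2l//.
  rewrite mulrAC -mulrA ger_pMr//.
  by rewrite ler_pdivrMr// mul1r lerDl.
split.
- apply: (step (@complex.Re R)); [exact: cReD|by move=> x z; rewrite cReM/= mul0r subr0|exact: Re_le].
- apply: (step (@complex.Im R)); [exact: cImD|by move=> x z; rewrite cImM/= mul0r addr0|exact: Im_le].
Qed.

End StrictDiff.

(** * Cauchy's formula on a rhombus *)

Section ComplexFubini.
Context {R : realType}.
Implicit Types (H : R -> R -> R[i]).

(** Continuity at each point of the unit square, which is how the estimates come; [ucont2_pointwise]
    makes it uniform by compactness. *)
Definition ccont2 H := forall s0 p0 : R, s0 \in `[0, 1] -> p0 \in `[0, 1] ->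
  forall e : R, 0 < e -> exists2 d : R, 0 < d & forall s p : R,
    s \in `[0, 1] -> p \in `[0, 1] -> `|s0 - s| < d -> `|p0 - p| < d ->
    nrm (H s0 p0 - H s p) <= e.

Lemma ucont2_pointwise (a b c d : R) (H : R -> R -> R) :
  (forall x y, x \in `[a, b] -> y \in `[c, d] -> forall e : R, 0 < e ->
    exists2 r : R, 0 < r & forall x' y', x' \in `[a, b] -> y' \in `[c, d] ->
      `|x - x'| < r -> `|y - y'| < r -> `|H x y - H x' y'| <= e) ->
  ucont2 a b c d H.
Proof.
move=> HH e e0.
have cK : compact (`[a, b]%classic `*` `[c, d]%classic).
  by apply: compact_setX; exact: segment_compact.
have cH : {within `[a, b]%classic `*` `[c, d]%classic,
    continuous (fun p : R * R => H p.1 p.2)}.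
  apply/subspace_continuousP => -[x y] [/= xab ycd]; apply/cvgrPdist_le => r r0.
  have [r' r'0 K] := HH x y xab ycd _ r0.
  rewrite near_withinE; apply/nbhs_ballP; exists r' => //=.
  by move=> [x' y'] [/= xr yr] [/= x'ab y'cd]; exact: K.
have [r r0 K] := heine cK cH e0.
exists r => // x x' y y' xab x'ab ycd y'cd xr yr.
by apply: (K (x, y) (x', y')).
Qed.

Lemma ccont2_ucont2 H : ccont2 H -> ucont2 0 1 0 1 (fun s p => complex.Re (H s p)) /\
  ucont2 0 1 0 1 (fun s p => complex.Im (H s p)).
Proof.
move=> cH; split; apply: ucont2_pointwise => x y x1 y1 e e0;
  have [d d0 K] := cH x y x1 y1 e e0; exists d => // x' y' x'1 y'1 xx yy;
  apply: le_trans (K x' y' x'1 y'1 xx yy).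
- by rewrite -cReN -cReD Re_le.
- by rewrite -cImN -cImD Im_le.
Qed.

Lemma ccont2_l H s : ccont2 H -> s \in `[0, 1] -> ccont (H s).
Proof. by move=> /ccont2_ucont2[u1 u2] s1; split; [exact: (ucont2_1 u1)|exact: (ucont2_1 u2)]. Qed.

Lemma ccont2_C H : ccont2 H -> ccont2 (fun p s => H s p).
Proof.
move=> cH p0 s0 p01 s01 e e0; have [d d0 K] := cH s0 p0 s01 p01 e e0.
by exists d => // p s p1 s1 pd sd; exact: K.
Qed.

Lemma ccont2_cint H : ccont2 H -> ccont (fun s => cint (H s)).
Proof. by move=> /ccont2_ucont2[u1 u2]; split; exact: ucont2_RI. Qed.

Lemma cint_fubini H : ccont2 H ->
  cint (fun s => cint (H s)) = cint (fun p => cint (H^~ p)).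
Proof. by move=> /ccont2_ucont2[u1 u2]; congr Complex; exact: RI_fubini. Qed.

End ComplexFubini.

Section Homotopy.
Context {R : realType}.
Implicit Types (F : R[i] -> R[i]) (D : set R[i]) (u v w q : R[i]) (s p : R).

(** One shape covers the translation zeta - s x, the contraction x + s (zeta - x) and the exponents
    r theta zeta with r affine in s and zeta affine in p. *)
Definition biaffine u v w q s p : R[i] :=
  u + s%:C * v + p%:C * w + (s * p)%:C * q.

Lemma biaffine_continuous u v w q : ccont2 (biaffine u v w q).
Proof.
move=> s0 p0 s01 p01 e e0; pose K := nrm v + nrm w + 2 * nrm q.
have K1 : 0 < K + 1 by rewrite ltr_wpDl// !addr_ge0 ?nrm_ge0 ?mulr_ge0 ?nrm_ge0.
exists (e / (K + 1)); first exact: divr_gt0.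
move=> s p s1 p1 /ltW ss /ltW pp.
have -> : biaffine u v w q s0 p0 - biaffine u v w q s p =
    (s0 - s)%:C * v + (p0 - p)%:C * w + (s0 * (p0 - p) + (s0 - s) * p)%:C * q.
  by rewrite /biaffine !(rmorphD, rmorphB, rmorphM)/=; ring.
apply: le_trans (nrmD _ _) _; apply: le_trans (lerD (nrmD _ _) (lexx _)) _.
rewrite !nrmM !nrm_C.
have B : `|s0 * (p0 - p) + (s0 - s) * p| <= 2 * (e / (K + 1)).
  apply: le_trans (ler_normD _ _) _; rewrite [leRHS]mulr_natl mulr2n !normrM.
  move: s01 p1; rewrite !in_itv/= => /andP[s00 s01] /andP[p0' p1].
  apply: lerD.
    by apply: le_trans pp; rewrite ler_piMl// ger0_norm.
  by apply: le_trans ss; rewrite ler_piMr// ger0_norm.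
have E : e = e / (K + 1) * nrm v + e / (K + 1) * nrm w +
    2 * (e / (K + 1)) * nrm q + e / (K + 1).
  by rewrite /K in K1 *; field; rewrite gt_eqF.
rewrite E; apply: ler_wpDr; first by rewrite divr_ge0 ?(ltW e0) ?(ltW K1).
by rewrite !lerD// ler_wpM2r ?nrm_ge0.
Qed.

Variables (F F' : R[i] -> R[i]) (D : set R[i]).
Hypothesis HF : forall z, D z -> sdiff F (F' z) z.
Variables (u v w q : R[i]).
Let ga := biaffine u v w q.
Hypothesis Dga : forall s p, s \in `[0, 1] -> p \in `[0, 1] -> D (ga s p).

Lemma sdiff_biaffine_ccont2 : ccont2 (fun s p => F' (ga s p)).
Proof.
move=> s0 p0 s01 p01 e e0.
have [d d0 K] := sdiff_deriv_continuous HF (Dga s01 p01) e0.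
have d2 : 0 < d / 2 by rewrite divr_gt0.
have [r r0 K'] := @biaffine_continuous u v w q _ _ s01 p01 _ d2.
exists r => // s p s1 p1 ss pp; rewrite nrm_distC; apply: K; first exact: Dga.
rewrite nrm_distC; apply: le_lt_trans (K' _ _ s1 p1 ss pp) _.
by rewrite ltr_pdivrMr// ltr_pMr// ltr1n.
Qed.

(** With [biaffine_int_p], the two orders of integrating F' over the image of the square: v + p q
    and w + s q are the partial derivatives of [ga], each constant in the variable integrated, so
    the inner integral is an increment of F. *)
Lemma biaffine_int_s p : p \in `[0, 1] ->
  (v + p%:C * q) * cint (fun s => F' (ga s p)) = F (ga 1 p) - F (ga 0 p).
Proof.
move=> p1; have cF := ccont2_l (ccont2_C sdiff_biaffine_ccont2) p1.
have E s : ga s p = (u + p%:C * w) + s%:C * (v + p%:C * q).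
  by rewrite /ga /biaffine rmorphM/=; ring.
rewrite -cintZ// (cint_FTC (F := fun s => F (ga s p)))//.
  by apply: ccontM => //; exact: ccont_cst.
move=> s s1; rewrite (_ : (fun s => F (ga s p)) =
  (fun s => F ((u + p%:C * w) + s%:C * (v + p%:C * q)))); last first.
  by apply/funext => y; rewrite E.
by apply: sdiff_cderiv; rewrite -E; apply: HF; exact: Dga.
Qed.

Lemma biaffine_int_p s : s \in `[0, 1] ->
  (w + s%:C * q) * cint (fun p => F' (ga s p)) = F (ga s 1) - F (ga s 0).
Proof.
move=> s1; have cF := ccont2_l sdiff_biaffine_ccont2 s1.
have E p : ga s p = (u + s%:C * v) + p%:C * (w + s%:C * q).
  by rewrite /ga /biaffine rmorphM/=; ring.
rewrite -cintZ// (cint_FTC (F := fun p => F (ga s p)))//.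
  by apply: ccontM => //; exact: ccont_cst.
move=> p p1; rewrite (_ : (fun p => F (ga s p)) =
  (fun p => F ((u + s%:C * v) + p%:C * (w + s%:C * q)))); last first.
  by apply/funext => y; rewrite E.
by apply: sdiff_cderiv; rewrite -E; apply: HF; exact: Dga.
Qed.

End Homotopy.

(** * Geometry of the rhombus *)

Section Rhombus.
Context {R : realType}.
Variables (a h : R).

(** Counterclockwise; the default case closes the contour, since it makes [vtx 4] equal to
    [vtx 0]. *)
Definition vtx (j : nat) : R[i] :=
  match j with
  | 1 => Complex 0 h | 2 => Complex (- a) 0 | 3 => Complex 0 (- h)
  | _ => Complex a 0
  end.

Definition dir (j : nat) := vtx j.+1 - vtx j.

Definition zeta (j : nat) (p : R) := vtx j + p%:C * dir j.

(** The conjugate of i * [dir j], not normalised: Re (theta (z - zeta)) is the length of the edge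
    times the signed distance from z to its line, positive inside. *)
Definition theta (j : nat) : R[i] :=
  Complex (- complex.Im (dir j)) (- complex.Re (dir j)).

Definition rhombus : set R[i] :=
  [set z | h * `|complex.Re z| + a * `|complex.Im z| <= a * h].

Hypotheses (a0 : 0 < a) (h0 : 0 < h).

(** Since theta * dir is imaginary, the right side does not depend on p: it is a h minus one of the
    four sums of +-h x and +-a y. The bound also holds, with a negative left side, outside the
    rhombus, as [forward] requires. *)
Lemma Re_theta_zeta (j : 'I_4) p (z : R[i]) :
  a * h - h * `|complex.Re z| - a * `|complex.Im z| <=
  complex.Re (theta j * (z - zeta j p)).
Proof.
case: z => x y; rewrite /zeta /theta /dir.
have hx : h * `|x| >= h * x /\ h * `|x| >= - (h * x).
  by rewrite -mulrN !ler_pM2l// ler_norm -normrN ler_norm.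
have ay : a * `|y| >= a * y /\ a * `|y| >= - (a * y).
  by rewrite -mulrN !ler_pM2l// ler_norm -normrN ler_norm.
by case: j => [[|[|[|[|//]]]] jlt] /=; nra.
Qed.

(** The same sign on all four edges: it decides in which direction of time the quadratic part of the
    exponent is harmless. *)
Lemma Re_theta_sqr (j : 'I_4) : complex.Re (theta j ^+ 2) = h ^+ 2 - a ^+ 2.
Proof. by rewrite /theta /dir; case: j => [[|[|[|[|//]]]] jlt] /=; ring. Qed.

(** The product is common to the four edges, so the superposition has a single coefficient. *)
Lemma theta_dir (j : 'I_4) : theta j * dir j = Complex 0 (- (a ^+ 2 + h ^+ 2)).
Proof.
rewrite /theta /dir; case: j => [[|[|[|[|//]]]] jlt] /=;
by apply: complex_ext; rewrite ?cReM ?cImM/=; ring.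
Qed.

Lemma rhombus_zeta (j : 'I_4) p : p \in `[0, 1] -> rhombus (zeta j p).
Proof.
rewrite in_itv/= => /andP[p0 p1]; rewrite /rhombus/= /zeta /dir.
have -> : a * h = (1 - p) * (a * h) + p * (a * h) by ring.
have H (x y X Y : R) : `|x| = X -> `|y| = Y ->
  h * X + a * Y = a * h -> h * `|x| + a * `|y| <= (1 - p) * (a * h) + p * (a * h).
  by move=> -> -> ->; lra.
have p1' : 0 <= 1 - p by rewrite subr_ge0.
case: j => [[|[|[|[|//]]]] jlt] /=.
- apply: (@H _ _ ((1 - p) * a) (p * h)); last by ring.
  + by rewrite -[RHS]ger0_norm ?mulr_ge0 ?(ltW a0)//; congr `|_|; ring.
  + by rewrite -[RHS]ger0_norm ?mulr_ge0 ?(ltW h0)//; congr `|_|; ring.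
- apply: (@H _ _ (p * a) ((1 - p) * h)); last by ring.
  + by rewrite -[RHS]ger0_norm ?mulr_ge0 ?(ltW a0)// -normrN; congr `|_|; ring.
  + by rewrite -[RHS]ger0_norm ?mulr_ge0 ?(ltW h0)//; congr `|_|; ring.
- apply: (@H _ _ ((1 - p) * a) (p * h)); last by ring.
  + by rewrite -[RHS]ger0_norm ?mulr_ge0 ?(ltW a0)// -normrN; congr `|_|; ring.
  + by rewrite -[RHS]ger0_norm ?mulr_ge0 ?(ltW h0)// -normrN; congr `|_|; ring.
- apply: (@H _ _ (p * a) ((1 - p) * h)); last by ring.
  + by rewrite -[RHS]ger0_norm ?mulr_ge0 ?(ltW a0)//; congr `|_|; ring.
  + by rewrite -[RHS]ger0_norm ?mulr_ge0 ?(ltW h0)// -normrN; congr `|_|; ring.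
Qed.

Lemma rhombus_Re_Im z : rhombus z -> `|complex.Re z| <= a /\ `|complex.Im z| <= h.
Proof.
rewrite /rhombus/= => H; split.
- rewrite -(ler_pM2l h0) [leRHS]mulrC; apply: le_trans H.
  by rewrite lerDl mulr_ge0// ltW.
- by rewrite -(ler_pM2l a0); apply: le_trans H; rewrite lerDr mulr_ge0// ltW.
Qed.

Lemma rhombus_real (x : R) : - a < x < a -> rhombus x%:C.
Proof.
move=> xa; rewrite /rhombus/= normr0 mulr0 addr0 mulrC ler_wpM2r ?(ltW h0)//.
by rewrite ler_norml; lra.
Qed.

Lemma rhombus_convex z w s : rhombus z -> rhombus w -> s \in `[0, 1] ->
  rhombus (z + s%:C * (w - z)).
Proof.
case: z w => [x y] [x' y']; rewrite in_itv/= /rhombus/= => H1 H2 /andP[s0 s1].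
have s1' : 0 <= 1 - s by rewrite subr_ge0.
have K (b c : R) : `|b + s * (c - b)| <= (1 - s) * `|b| + s * `|c|.
  have -> : b + s * (c - b) = (1 - s) * b + s * c by ring.
  by apply: le_trans (ler_normD _ _) _; rewrite !normrM (ger0_norm s0) (ger0_norm s1').
rewrite !mul0r subr0 addr0.
have Kx := ler_wpM2l (ltW h0) (K x x').
have Ky := ler_wpM2l (ltW a0) (K y y').
apply: le_trans (lerD Kx Ky) _.
have := ler_wpM2l s1' H1; have := ler_wpM2l s0 H2; lra.
Qed.

Lemma theta_neq0 (j : 'I_4) : theta j != 0.
Proof.
apply/eqP => /(congr1 (fun z => complex.Re z ^+ 2 + complex.Im z ^+ 2))/=.
rewrite expr0n/= addr0 /theta /dir => /eqP.
by case: j => [[|[|[|[|//]]]] jlt] /=; rewrite gt_eqF//;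
  have := exprn_gt0 2 a0; have := exprn_gt0 2 h0; nra.
Qed.

(** Distance from x to the line of the edge; it keeps the Cauchy kernel bounded for |x| < a. *)
Lemma zeta_sub_gt (j : 'I_4) p (x : R) :
  h * (a - `|x|) / nrm (theta j) <= nrm (zeta j p - x%:C).
Proof.
have t0 := nrm_gt0 (theta_neq0 j).
rewrite ler_pdivrMr// nrm_distC [leRHS]mulrC -nrmM.
apply: le_trans (le_trans (Re_theta_zeta j p x%:C) (le_trans (ler_norm _) (Re_le _))).
by rewrite /= normr0 mulr0 subr0; lra.
Qed.

End Rhombus.

Section CintSum.
Context {R : realType}.

Lemma ccont_sum n (f : 'I_n -> R -> R[i]) : (forall j, ccont (f j)) ->
  ccont (fun p => \sum_(j < n) f j p).
Proof.
move=> cf; elim: n f cf => [|n IH] f cf.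
  by apply: eq_ccont (ccont_cst 0) => p _; rewrite big_ord0.
apply: (@eq_ccont _ (fun p => (\sum_(j < n) f (widen_ord (leqnSn n) j) p) + f ord_max p)).
  by move=> p _; rewrite big_ord_recr.
by apply: ccontD => //; exact: IH.
Qed.

Lemma cint_sum n (f : 'I_n -> R -> R[i]) : (forall j, ccont (f j)) ->
  cint (fun p => \sum_(j < n) f j p) = \sum_(j < n) cint (f j).
Proof.
move=> cf; elim: n f cf => [|n IH] f cf.
  by rewrite big_ord0 -[RHS](cint_cst 0); apply: eq_cint => p _; rewrite big_ord0.
rewrite big_ord_recr/= -IH// -cintD//.
  by apply: eq_cint => p _; rewrite big_ord_recr.
by apply: ccont_sum.
Qed.

Lemma ccont_affine (u w : R[i]) : ccont (fun p : R => u + p%:C * w).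
Proof.
apply: ccontD; first exact: ccont_cst.
apply: ccontM; last exact: ccont_cst.
split; apply: continuous_cont => x.
- exact: cvg_id.
- exact: cvg_cst.
Qed.

Lemma ccont_sdiff (F F' : R[i] -> R[i]) (u w : R[i]) :
  (forall p : R, p \in `[0, 1] -> sdiff F (F' (u + p%:C * w)) (u + p%:C * w)) ->
  ccont (fun p : R => F (u + p%:C * w)).
Proof.
move=> HF; split; apply: derivable_within_continuous => x /HF /sdiff_cderiv.
- by move=> [[]].
- by move=> [_ []].
Qed.

(** Fubini edge by edge: a sum of contour integrals that vanishes for each s still vanishes when s
    is integrated first. The open interval for s leaves out s = 0, where a contraction
    degenerates. *)
Lemma cint_closed (Hs : 'I_4 -> R -> R -> R[i]) (d : 'I_4 -> R[i]) :
  (forall j, ccont2 (Hs j)) ->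
  (forall s : R, s \in `]0, 1[ -> \sum_j d j * cint (Hs j s) = 0) ->
  \sum_j cint (fun p => d j * cint ((Hs j)^~ p)) = 0.
Proof.
move=> cH E; rewrite -[RHS](cint_cst 0).
rewrite -(eq_cint E) cint_sum; last first.
  by move=> j; apply: ccontM; [exact: ccont_cst|exact: ccont2_cint].
apply: eq_bigr => j _.
rewrite (cintZ (d j) (ccont2_cint (cH j))).
rewrite (cintZ (d j) (ccont2_cint (ccont2_C (cH j)))).
by rewrite (cint_fubini (cH j)).
Qed.

End CintSum.

Section Cauchy.
Context {R : realType}.
Variables (a h : R).
Hypotheses (a0 : 0 < a) (h0 : 0 < h).
Local Notation zeta := (zeta a h).
Local Notation dir := (dir a h).
Local Notation vtx := (vtx a h).

Definition ckernel (x : R) (j : nat) (p : R) : R[i] := dir j / (zeta j p - x%:C).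

Definition cauchy (G : R[i] -> R[i]) (x : R) : R[i] :=
  \sum_(j < 4) cint (fun p => G (zeta j p) * ckernel x j p).

Definition winding : R[i] := \sum_(j < 4) cint (ckernel 0 j).

Lemma zeta_neq (x : R) (j : 'I_4) p : - a < x < a -> zeta j p - x%:C != 0.
Proof.
move=> xa; have := zeta_sub_gt a0 h0 j p x.
apply: contraTneq => ->; rewrite nrm0 -ltNge divr_gt0//.
  by rewrite mulr_gt0// subr_gt0 ltr_norml.
exact/nrm_gt0/theta_neq0.
Qed.

Lemma zeta0 j : zeta j 0 = vtx j.
Proof. by rewrite /zeta mul0r addr0. Qed.

Lemma zeta1 j : zeta j 1 = vtx j.+1.
Proof. by rewrite /zeta mul1r addrC subrK. Qed.

Lemma sum_edges (g : R[i] -> R[i]) :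
  \sum_(j < 4) (g (vtx j.+1) - g (vtx j)) = 0.
Proof.
rewrite -(big_mkord xpredT (fun j => g (vtx j.+1) - g (vtx j))) telescope_sumr//.
exact: subrr.
Qed.

Lemma ccont_zeta j : ccont (zeta j).
Proof. exact: ccont_affine. Qed.

Lemma ccont_ckernel (x : R) (j : 'I_4) : - a < x < a -> ccont (ckernel x j).
Proof.
move=> xa; apply: ccontM; first exact: ccont_cst.
apply: (ccontV (m := h * (a - `|x|) / nrm (theta a h j))).
- rewrite divr_gt0//; first by rewrite mulr_gt0// subr_gt0 ltr_norml.
  exact/nrm_gt0/theta_neq0.
- by move=> p _; exact: zeta_sub_gt.
- by apply: ccontB; [exact: ccont_zeta|exact: ccont_cst].
Qed.

(* Same homotopy for the primitive 1 / (zeta - s x), so that the contour integral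
   need not be evaluated: it only matters that it is constant and nonzero. *)
Lemma winding_eq (x : R) : - a < x < a -> \sum_(j < 4) cint (ckernel x j) = winding.
Proof.
move=> xa; have aa : - a < 0 < a by rewrite oppr_lt0 a0.
have [->//|x0] := eqVneq x 0.
apply/eqP; rewrite -subr_eq0 -sumrB; apply/eqP.
pose F' (z : R[i]) := - (z ^+ 2)^-1.
pose D : set R[i] := [set z | z != 0].
have HF z : D z -> sdiff (fun z => z^-1) (F' z) z by exact: sdiff_inv.
pose ga (j : 'I_4) := biaffine (vtx j) (- x%:C) (dir j) 0.
have gaE j s p : biaffine (vtx j) (- x%:C) (dir j) 0 s p = zeta j p - (s * x)%:C.
  by rewrite /biaffine /zeta rmorphM/=; ring.
have Dga j s p : s \in `[0, 1] -> p \in `[0, 1] -> D (ga j s p).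
  rewrite in_itv/= => /andP[s0 s1] _; rewrite /D/= /ga gaE; apply: zeta_neq.
  rewrite -ltr_norml normrM (ger0_norm s0).
  by rewrite (le_lt_trans (ler_piMl _ s1))// ltr_norml.
have cF j := sdiff_biaffine_ccont2 HF (Dga j).
have x0' : x%:C != 0 :> R[i] by rewrite -(inj_eq (@complexI R)) in x0.
rewrite -[RHS](@cint_closed R (fun j s p => F' (ga j s p)) (fun j => (- x%:C) * dir j) cF);
  last first.
  move=> s /subset_itv_oo_cc s01.
  under eq_bigr => j _.
    rewrite -mulrA -[X in X * cint _]addr0 -[X in _ + X](mulr0 s%:C).
    rewrite (biaffine_int_p HF (Dga j) s01) !gaE.
    rewrite zeta0 zeta1; over.
  by rewrite -mulr_sumr (sum_edges (fun z => (z - (s * x)%:C)^-1)) mulr0.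
apply: eq_bigr => j _; rewrite -cintB; [|exact: ccont_ckernel..].
apply: eq_cint => p /subset_itv_oo_cc p01.
have := biaffine_int_s HF (Dga j) p01; rewrite !gaE mulr0 addr0 => E.
rewrite mulrAC E /ckernel mul1r mul0r; ring.
Qed.

(** Im (dir / zeta) is the angular speed seen from 0, equal to a h / |zeta|^2, and |zeta| <= a + h
    on the rhombus: every edge contributes at least [m]. *)
Lemma winding_neq0 : winding != 0.
Proof.
have aa : - a < 0 < a by rewrite oppr_lt0 a0.
suff : 0 < complex.Im winding by apply: contraTneq => ->; rewrite ltxx.
have S (n : nat) (f : 'I_n -> R[i]) :
    complex.Im (\sum_j f j) = \sum_j complex.Im (f j).
  by rewrite (big_morph _ (@cImD R) erefl).
rewrite /winding S; pose m := a * h / (a + h) ^+ 2.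
have m0 : 0 < m by rewrite divr_gt0 ?exprn_gt0 ?addr_gt0 ?mulr_gt0.
have K (j : 'I_4) : m <= complex.Im (cint (ckernel 0 j)).
  have [_ c2] := ccont_ckernel j aa.
  rewrite -[m]mul1r -[in X in X * _](subr0 1) -RI_cst//.
  rewrite [leRHS]/=; apply: le_RI => //; first exact: cont_cst.
  move=> p; rewrite in_itv/= => /andP[p0 p1].
  have z0 : zeta j p != 0 by rewrite -(subr0 (zeta j p)); exact: (zeta_neq j p aa).
  rewrite /ckernel subr0; move: z0.
  have : complex.Im (dir j) * complex.Re (zeta j p) -
      complex.Re (dir j) * complex.Im (zeta j p) = a * h.
    rewrite /zeta /dir; case: j {c2} => [[|[|[|[|//]]]] jlt] /=; ring.
  have : complex.Re (zeta j p) ^+ 2 + complex.Im (zeta j p) ^+ 2 <= (a + h) ^+ 2.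
    have p01 : p \in `[0, 1] by rewrite in_itv/= !ltW.
    have [X Y] := rhombus_Re_Im a0 h0 (rhombus_zeta a0 h0 j p01).
    rewrite -(real_normK (num_real (complex.Re _))).
    rewrite -(real_normK (num_real (complex.Im _))).
    have := mulr_ge0 (ltW a0) (ltW h0).
    have := ler_pM (normr_ge0 _) (normr_ge0 _) X X.
    have := ler_pM (normr_ge0 _) (normr_ge0 _) Y Y.
    by rewrite sqrrD -!expr2; lra.
  case: (zeta j p) (dir j) => u v [d1 d2] /= Hle E z0.
  have N : 0 < u ^+ 2 + v ^+ 2.
    rewrite lt_def addr_ge0 ?sqr_ge0// andbT paddr_eq0 ?sqr_ge0// !sqrf_eq0.
    by apply: contra z0; rewrite eq_complex/=.
  have -> : d1 * - (v / (u ^+ 2 + v ^+ 2)) + d2 * (u / (u ^+ 2 + v ^+ 2)) =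
      a * h / (u ^+ 2 + v ^+ 2) by rewrite -E; field; rewrite gt_eqF.
  rewrite ler_wpM2l ?mulr_ge0 ?(ltW a0) ?(ltW h0)//.
  by rewrite lef_pV2 ?posrE// exprn_gt0// addr_gt0.
rewrite !big_ord_recr big_ord0/= add0r.
have k0 := lt_le_trans m0 (K (@Ordinal 4 0 isT)).
have k1 := lt_le_trans m0 (K (@Ordinal 4 1 isT)).
have k2 := lt_le_trans m0 (K (@Ordinal 4 2 isT)).
have k3 := lt_le_trans m0 (K (@Ordinal 4 3 isT)).
by rewrite !addr_gt0.
Qed.

(* Integrate F' (x + s (zeta - x)) over (s, p): in s first it gives
   (F zeta - F x) / (zeta - x), in p first it telescopes around the contour. *)
Theorem cauchy_formula (F F' : R[i] -> R[i]) (x : R) : - a < x < a ->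
  (forall z, rhombus a h z -> sdiff F (F' z) z) ->
  cauchy F x = winding * F x%:C.
Proof.
move=> xa HF; rewrite -(winding_eq xa) mulrC mulr_sumr.
apply/eqP; rewrite -subr_eq0 -sumrB; apply/eqP.
pose ga (j : 'I_4) := biaffine x%:C (vtx j - x%:C) 0 (dir j).
have gaE j s p : biaffine x%:C (vtx j - x%:C) 0 (dir j) s p =
    x%:C + s%:C * (zeta j p - x%:C).
  by rewrite /biaffine /zeta rmorphM/=; ring.
have Dga j s p : s \in `[0, 1] -> p \in `[0, 1] -> rhombus a h (ga j s p).
  move=> s01 p01; rewrite /ga gaE; apply: rhombus_convex => //.
    exact: rhombus_real.
  exact: rhombus_zeta.
have cF j := sdiff_biaffine_ccont2 HF (Dga j).
rewrite -[RHS](@cint_closed R (fun j s p => F' (ga j s p)) (fun j => dir j) cF);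
  last first.
  move=> s s01; have s01' := subset_itv_oo_cc s01.
  (* The p-derivative of [ga] is s * dir, so the factor s must be divided out before telescoping. *)
  have s0 : s%:C != 0 :> R[i].
    by rewrite (inj_eq (@complexI R)) gt_eqF//; case/andP: s01.
  apply: (mulfI s0); rewrite mulr0 mulr_sumr.
  under eq_bigr => j _.
    rewrite mulrA -[X in X * cint _]add0r.
    rewrite (biaffine_int_p HF (Dga j) s01') !gaE.
    rewrite zeta0 zeta1; over.
  exact: (sum_edges (fun z => F (x%:C + s%:C * (z - x%:C)))).
apply: eq_bigr => j _; rewrite -cintZ; last exact: ccont_ckernel.
have ce : ccont (fun p => F (zeta j p) * ckernel x j p).
  apply: ccontM; last exact: ccont_ckernel.
  by apply: (ccont_sdiff (F' := F')) => p p01; apply/HF/rhombus_zeta.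
rewrite -cintB//; last by apply: ccontM; [exact: ccont_cst|exact: ccont_ckernel].
apply: eq_cint => p /subset_itv_oo_cc p01.
have := biaffine_int_s HF (Dga j) p01; rewrite !gaE.
rewrite mul1r mul0r addr0 [x%:C + _]addrC subrK => E.
have z0 := zeta_neq j p xa.
have -> : cint (fun s => F' (ga j s p)) = (F (zeta j p) - F x%:C) / (zeta j p - x%:C).
  by rewrite -E /zeta; field.
by rewrite /ckernel; ring.
Qed.

End Cauchy.

(** * Uniformly closed classes of functions *)

Section ClosedClass.
Context {R : realType} {I : Type}.
Variables (D : set I) (K : set (I -> R[i])).

(** Exactly what survives Riemann sums and series. Closeness is measured on D alone, so the values
    elsewhere are free. *)
Definition uniformly_closed :=
  [/\ K (fun=> 0),
      (forall f g, K f -> K g -> K (fun i => f i + g i)),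
      (forall (c : R) f, K f -> K (fun i => c%:C * f i)) &
      (forall f, (forall e : R, 0 < e ->
         exists2 g, K g & forall i, D i -> nrm (f i - g i) <= e) -> K f)].

Definition ucurve (E : R -> I -> R[i]) := forall e : R, 0 < e ->
  exists2 d : R, 0 < d & forall p q : R, p \in `[0, 1] -> q \in `[0, 1] ->
    `|p - q| < d -> forall i, D i -> nrm (E p i - E q i) <= e.

Lemma ucurve_ccont E i : ucurve E -> D i -> ccont (E^~ i).
Proof.
move=> uE Di; apply/ccontP => e /uE[d d0 H].
by exists d => // p q p1 q1 pq; exact: H.
Qed.

(** Riemann sums are real combinations of members of K; [ucurve] makes their convergence uniform on
    D. *)
Lemma uniformly_closed_cint (E : R -> I -> R[i]) : uniformly_closed ->
  (forall p : R, p \in `[0, 1] -> K (E p)) -> ucurve E ->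
  K (fun i => cint (E^~ i)).
Proof.
move=> [K0 KD KZ Klim] KE uE; apply: Klim => e e0.
have e2 : 0 < e / 2 by rewrite divr_gt0.
have [d d0 H] := uE _ e2.
have [N N0 Nd] := exists_mesh 0 1 d0; rewrite subr0 mul1r in Nd.
exists (fun i => criemann N (E^~ i)).
  suff KK k : (k <= N)%N ->
    K (fun i => \sum_(j < k) N%:R^-1%:C * E (j%:R / N%:R) i) by exact: KK (leqnn N).
  elim: k => [_|k IH kN].
    by rewrite (_ : (fun i => _) = fun=> 0)//; apply/funext => i; rewrite big_ord0.
  rewrite (_ : (fun i => _) = fun i => \sum_(j < k) N%:R^-1%:C * E (j%:R / N%:R) i +
    N%:R^-1%:C * E (k%:R / N%:R) i); last by apply/funext => i; rewrite big_ord_recr.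
  apply: KD; first exact: IH (ltnW kN).
  apply: (KZ _ (E (k%:R / N%:R))); apply: KE; rewrite in_itv/= divr_ge0//=.
  by rewrite ler_pdivrMr ?ltr0n// mul1r ler_nat ltnW.
move=> i Di; have -> : e = 2 * (e / 2) by field.
apply: (criemann_approx N0 _ _ Nd); first exact: ucurve_ccont.
by move=> p q p1 q1 pq; exact: H.
Qed.

End ClosedClass.

(** * Regularity of test functions *)

Section Regularity.
Context {R : realType}.

Lemma cont_bounded (a b : R) f : a <= b -> cont a b f ->
  exists M : R, forall x, x \in `[a, b] -> `|f x| <= M.
Proof.
move=> ab cf; have cn : cont a b (fun x => `|f x|).
  by move=> x; apply: cvg_norm; exact: cf.
by have [c _ H] := EVT_max ab cn; exists `|f c|.
Qed.

Lemma lip_derive (f df : R -> R) (x0 x M r : R) : `|x - x0| < r ->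
  (forall y, `|y - x0| < r -> is_derive y (1 : R) f (df y)) ->
  (forall y, `|y - x0| < r -> `|df y| <= M) -> `|f x - f x0| <= M * `|x - x0|.
Proof.
move=> xr dfx HM.
(* The ball is centred at x0, so exchanging x and x0 is not a symmetry; the case x < x0 is treated
   directly. *)
wlog: x x0 xr dfx HM / x0 < x => [W|x0x].
  have [x0x|xx0|->] := ltgtP x0 x; first exact: W.
    have B y : y \in `[x, x0] -> `|y - x0| < r.
      rewrite in_itv/= => /andP[y1 y2]; apply: le_lt_trans xr.
      by rewrite !ler0_norm ?subr_le0// ?(ltW xx0)// lerN2 lerB.
    have cf : {within `[x, x0], continuous f}.
      apply: derivable_within_continuous => y /B yr.
      by have [] := dfx y yr.
    have [c /subset_itv_oo_cc/B cr E] := MVT xx0 (fun y yi => dfx y (B y (subset_itv_oo_cc yi))) cf.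
    by rewrite -normrN opprB E normrM [`|x - x0|]distrC ler_wpM2r// HM.
  by rewrite !subrr normr0 mulr0.
have B y : y \in `[x0, x] -> `|y - x0| < r.
  rewrite in_itv/= => /andP[y1 y2]; apply: le_lt_trans xr.
  by rewrite !ger0_norm ?subr_ge0// ?(ltW x0x)// lerB.
have cf : {within `[x0, x], continuous f}.
  apply: derivable_within_continuous => y /B yr.
  by have [] := dfx y yr.
have [c /subset_itv_oo_cc/B cr E] := MVT x0x (fun y yi => dfx y (B y (subset_itv_oo_cc yi))) cf.
by rewrite E normrM ler_wpM2r// HM.
Qed.

(** [C12] gives joint continuity of the derivatives only; that of phi follows by moving first in t,
    then in x, with partial derivatives locally bounded by M. *)
Lemma partial_continuous (f ft fx : R -> R -> R) :
  (forall t x, is_derive t (1 : R) (f^~ x) (ft t x)) ->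
  (forall t x, is_derive x (1 : R) (f t) (fx t x)) ->
  continuous (fun p : R * R => ft p.1 p.2) ->
  continuous (fun p : R * R => fx p.1 p.2) ->
  continuous (fun p : R * R => f p.1 p.2).
Proof.
move=> dt dx ct cx [t0 x0]; apply/cvgrPdist_le => e e0.
have /cvgrPdist_le/(_ 1 ltr01) := ct (t0, x0).
have /cvgrPdist_le/(_ 1 ltr01) := cx (t0, x0).
move=> /nbhs_ballP[r1 /= r10 H1] /nbhs_ballP[r2 /= r20 H2].
pose M := `|ft t0 x0| + `|fx t0 x0| + 1.
have M0 : 0 < M by rewrite ltr_wpDl// addr_ge0.
pose r := Num.min (Num.min r1 r2) (e / (2 * M)).
have r0 : 0 < r by rewrite !lt_min r10 r20/= divr_gt0// mulr_gt0.
apply: (filterS _ (@nbhsx_ballx R (R * R)%type (t0, x0) r r0)) => -[t x] [/= tr xr].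
have tr1 s : `|s - t0| < r -> `|s - t0| < r2 by rewrite !lt_min => /andP[/andP[]].
have xr1 s : `|s - x0| < r -> `|s - x0| < r1 by rewrite !lt_min => /andP[/andP[]].
have xr2 s : `|s - x0| < r -> `|s - x0| < r2 by rewrite !lt_min => /andP[/andP[]].
have rM (s : R) : `|s| < r -> M * `|s| <= e / 2.
  rewrite lt_min => /andP[_ /ltW H].
  apply: le_trans (ler_wpM2l (ltW M0) H) _.
  by rewrite le_eqVlt; apply/orP; left; apply/eqP; field; rewrite gt_eqF.
have {}tr : `|t - t0| < r by rewrite distrC; exact: tr.
have {}xr : `|x - x0| < r by rewrite distrC; exact: xr.
have K1 : `|f t x - f t0 x| <= e / 2.
  apply: (le_trans _ (rM _ tr)).
  apply: (@lip_derive (f^~ x) (ft^~ x) t0 t M r tr) => //.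
  move=> s sr; have := H2 (s, x).
  rewrite /ball/= /prod_ball/= /ball/= distrC tr1// distrC xr2// => /(_ (conj isT isT)) K.
  rewrite -(subKr (ft t0 x0) (ft s x)); apply: le_trans (ler_normB _ _) _.
  by rewrite /M -addrA lerD2l (le_trans K)// lerDr.
have K2 : `|f t0 x - f t0 x0| <= e / 2.
  apply: (le_trans _ (rM _ xr)).
  apply: (@lip_derive (f t0) (fx t0) x0 x M r xr) => //.
  move=> s sr; have := H1 (t0, s).
  rewrite /ball/= /prod_ball/= /ball/= subrr normr0 r10 distrC xr1// => /(_ (conj isT isT)) K.
  rewrite -(subKr (fx t0 x0) (fx t0 s)); apply: le_trans (ler_normB _ _) _.
  by rewrite /M -addrA addrC -addrA lerD2l (le_trans K)// lerDl.
rewrite distrC -(subrKA (f t0 x)) [e]splitr.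
by apply: le_trans (ler_normD _ _) _; exact: lerD.
Qed.

End Regularity.

(** * Solutions of the heat equation *)

Section Heat.
Context {R : realType}.
Variables (L T : R).
Hypotheses (L0 : 0 < L) (T0 : 0 < T).
Implicit Types (w v : R -> R -> R) (phi : R -> R -> R).

(** The transposition identity with the initial state kept. No derivative of w occurs, so it passes
    to uniform limits. *)
Definition green w := forall tau : R, 0 < tau <= T ->
  forall phi, adjoint_solution L tau phi ->
  RI (- L) L (fun x => w tau x * phi tau x) - RI (- L) L (fun x => w 0 x * phi 0 x) =
  RI 0 tau (fun t => w t (- L) * d_x phi t (- L) - w t L * d_x phi t L).

Definition heat w := ucont2 0 T (- L) L w /\ green w.

Let LLe : - L <= L.
Proof. by rewrite ge0_cp ?ltW. Qed.

Lemma C12_is_derive phi : C12 phi ->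
  [/\ (forall t x : R, is_derive t (1 : R) (phi^~ x) (d_t phi t x)),
      (forall t x : R, is_derive x (1 : R) (phi t) (d_x phi t x)) &
      (forall t x : R, is_derive x (1 : R) (d_x phi t) (d_xx phi t x))].
Proof.
move=> [d _]; have aux (f : R -> R) (x : R) : derivable f x 1 -> is_derive x (1 : R) f (derive1 f x).
  by move=> df; rewrite derive1E; exact: derivableP.
by split=> t x; apply: aux; have [] := d t x.
Qed.

Lemma C12_continuous phi : C12 phi -> continuous (fun p : R * R => phi p.1 p.2).
Proof.
move=> c; have [dt dx _] := C12_is_derive c; have [_ [ct cx _]] := c.
exact: partial_continuous dt dx ct cx.
Qed.

Lemma cont_row (f : R -> R -> R) (a b t : R) :
  continuous (fun p : R * R => f p.1 p.2) -> cont a b (f t).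
Proof.
move=> cf; apply: continuous_cont => x.
apply: (@continuous_comp _ _ _ (fun x => (t, x)) (fun p : R * R => f p.1 p.2)).
  exact: (@cvg_pair _ _ _ (nbhs x) (nbhs t) (nbhs x) _ _ _ (fun=> t) id (cvg_cst t) cvg_id).
exact: cf.
Qed.

Lemma cont_col (f : R -> R -> R) (a b x : R) :
  continuous (fun p : R * R => f p.1 p.2) -> cont a b (f^~ x).
Proof.
move=> cf; apply: continuous_cont => t.
apply: (@continuous_comp _ _ _ (fun t => (t, x)) (fun p : R * R => f p.1 p.2)).
  exact: (@cvg_pair _ _ _ (nbhs t) (nbhs t) (nbhs x) _ _ _ id (fun=> x) cvg_id (cvg_cst x)).
exact: cf.
Qed.

(** wt * phi + w * phi_t is at once the t-derivative of w * phi and, as phi_t = - phi_xx, the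
    x-derivative of wx * phi - w * phi_x. Fubini equates the two boundary contributions, and phi = 0
    at both ends removes wx. *)
Lemma green_smooth w (wt wx : R -> R -> R) :
  (forall t x : R, is_derive t (1 : R) (w^~ x) (wt t x)) ->
  (forall t x : R, is_derive x (1 : R) (w t) (wx t x)) ->
  (forall t x : R, is_derive x (1 : R) (wx t) (wt t x)) ->
  continuous (fun p : R * R => w p.1 p.2) ->
  continuous (fun p : R * R => wt p.1 p.2) -> heat w.
Proof.
move=> dwt dwx dwxx cw cwt; split; first exact: continuous_ucont2.
move=> tau /andP[tau0 tauT] phi [cphi eqn bnd].
have cp := C12_continuous cphi.
have [dpt dpx dpxx] := C12_is_derive cphi; have [_ [cpt cpx _]] := cphi.
have LL := LLe.
pose H t x := wt t x * phi t x + w t x * d_t phi t x.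
have cH : continuous (fun p : R * R => H p.1 p.2).
  by move=> p; apply: cvgD; apply: cvgM; [exact: cwt|exact: cp|exact: cw|exact: cpt].
have := RI_fubini (ltW tau0) LL (@continuous_ucont2 _ 0 tau (- L) L _ cH).
have -> : RI (- L) L (fun y => RI 0 tau (H^~ y)) =
    RI (- L) L (fun x => w tau x * phi tau x - w 0 x * phi 0 x).
  apply: eq_RI => x _; apply: (RI_FTC (F := fun t => w t x * phi t x) (ltW tau0)).
    exact: cont_col cH.
  move=> t _; have := @is_deriveM _ _ _ _ _ _ _ _ (dwt t x) (dpt t x) => K.
  by apply: is_derive_eq; rewrite /H /GRing.scale/=; ring.
rewrite RIB; [|by apply: contM; exact: cont_row..] => <-.
apply: eq_RI => t /subset_itv_oo_cc t0.
have [pL pR] := bnd t t0.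
have dF (x : R) : x \in `[- L, L] ->
    is_derive x (1 : R) (fun x => wx t x * phi t x - w t x * d_x phi t x) (H t x).
  move=> xL.
  have K1 := @is_deriveM _ _ _ _ _ _ _ _ (dwxx t x) (dpx t x).
  have K2 := @is_deriveM _ _ _ _ _ _ _ _ (dwx t x) (dpxx t x).
  have K := @is_deriveB _ _ _ _ _ _ _ _ _ K1 K2.
  apply: is_derive_eq; have := eqn t x t0 xL.
  rewrite /H /GRing.scale/= => E.
  have -> : d_t phi t x = - d_xx phi t x by lra.
  by ring.
by rewrite (RI_FTC LL (cont_row cH) dF) pL pR; ring.
Qed.

Lemma heat_row w t : heat w -> t \in `[0, T] -> cont (- L) L (w t).
Proof. by move=> [uw _]; exact: ucont2_1. Qed.

Lemma heat_col w x tau : heat w -> tau <= T -> x \in `[- L, L] -> cont 0 tau (w^~ x).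
Proof.
move=> [uw _] tT xL; apply: (cont_sub (lexx 0) tT).
exact: (ucont2_1 (ucont2_C uw)).
Qed.

Let LL : - L \in `[- L, L] /\ L \in `[- L, L].
Proof. by rewrite !in_itv/= !lexx LLe. Qed.

Lemma heat_comb (c : R) w v : heat w -> heat v -> heat (fun t x => c * w t x + v t x).
Proof.
move=> hw hv; have [uw gw] := hw; have [uv gv] := hv; split.
  move=> e e0; have c1 : 0 < `|c| + 1 by rewrite ltr_wpDl.
  have e1 : 0 < e / 2 / (`|c| + 1) by rewrite !divr_gt0.
  have e2 : 0 < e / 2 by rewrite divr_gt0.
  have [d1 d10 H1] := uw _ e1; have [d2 d20 H2] := uv _ e2.
  exists (Num.min d1 d2); first by rewrite lt_min d10.
  move=> t t' x x' t0 t'0 x0 x'0; rewrite !lt_min => /andP[t1 t2] /andP[x1 x2].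
  have -> : c * w t x + v t x - (c * w t' x' + v t' x') =
    c * (w t x - w t' x') + (v t x - v t' x') by ring.
  rewrite [e]splitr; apply: le_trans (ler_normD _ _) (lerD _ (H2 _ _ _ _ _ _ _ _ t2 x2)) => //.
  rewrite normrM; apply: le_trans (ler_wpM2l (normr_ge0 c) (H1 _ _ _ _ t0 t'0 x0 x'0 t1 x1)) _.
  rewrite mulrCA ler_piMr ?(ltW e2)// ler_pdivrMr// mul1r.
  by rewrite lerDl.
move=> tau tauT phi aphi; have := gw tau tauT phi aphi; have := gv tau tauT phi aphi.
have [cphi eqn bnd] := aphi; have cp := C12_continuous cphi.
have [_ [_ cpx _]] := cphi.
move: (tauT) => /andP[tau0 tT].
have t1 : tau \in `[0, T] by rewrite in_itv/= (ltW tau0).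
have t2 : 0 \in `[0, T] by rewrite in_itv/= lexx ltW.
have [L1 L2] := LL.
have step t : t \in `[0, T] -> RI (- L) L (fun x => (c * w t x + v t x) * phi t x) =
    c * RI (- L) L (fun x => w t x * phi t x) + RI (- L) L (fun x => v t x * phi t x).
  move=> tt; have c1 : cont (- L) L (fun x => w t x * phi t x).
    by apply: contM; [exact: heat_row|exact: cont_row].
  have c2 : cont (- L) L (fun x => v t x * phi t x).
    by apply: contM; [exact: heat_row|exact: cont_row].
  rewrite -RIZ// -RID//; last by apply: contM => //; exact: cont_cst.
  by apply: eq_RI => x _; ring.
have side x (u : R -> R -> R) : heat u -> x \in `[- L, L] ->
    cont 0 tau (fun t => u t x * d_x phi t x).
  by move=> hu xL; apply: contM; [exact: heat_col|exact: (cont_col (f := d_x phi))].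
have sides u : heat u ->
  cont 0 tau (fun t => u t (- L) * d_x phi t (- L) - u t L * d_x phi t L).
  by move=> hu; apply: contB; exact: side.
move=> Ev Ew; rewrite !step//.
rewrite (_ : RI 0 tau _ = c * RI 0 tau (fun t => w t (- L) * d_x phi t (- L) - w t L * d_x phi t L) +
  RI 0 tau (fun t => v t (- L) * d_x phi t (- L) - v t L * d_x phi t L)).
  by rewrite -Ev -Ew; ring.
rewrite -RIZ; last exact: sides.
rewrite -RID; [|by apply: contM; [exact: cont_cst|exact: sides]|exact: sides].
by apply: eq_RI => t _; ring.
Qed.

Lemma heat0 : heat (fun _ _ => 0).
Proof.
apply: (@green_smooth _ (fun _ _ => 0) (fun _ _ => 0)) => //.
- by move=> t _; exact: (is_derive_cst (0 : R) t (1 : R)).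
- by move=> p; exact: (@cst_continuous _ _ (0 : R)).
- by move=> p; exact: (@cst_continuous _ _ (0 : R)).
Qed.

(** Each term of [green] integrates w against a bounded factor, phi or its x-derivative, hence is
    continuous for uniform convergence on the rectangle. *)
Lemma heat_lim w : (forall e : R, 0 < e -> exists2 v, heat v &
    forall t x, t \in `[0, T] -> x \in `[- L, L] -> `|w t x - v t x| <= e) ->
  heat w.
Proof.
move=> H.
have uw : ucont2 0 T (- L) L w.
  move=> e e0; have e3 : 0 < e / 3 by rewrite divr_gt0.
  have [v [uv _] wv] := H _ e3; have [d d0 K] := uv _ e3.
  exists d => // t t' x x' t0 t'0 x0 x'0 tt xx.
  have -> : w t x - w t' x' = (w t x - v t x) + (v t x - v t' x') - (w t' x' - v t' x') by ring.
  have -> : e = e / 3 + e / 3 + e / 3 by field.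
  apply: le_trans (ler_normB _ _) (lerD _ (wv _ _ t'0 x'0)).
  by apply: le_trans (ler_normD _ _) (lerD (wv _ _ t0 x0) _); exact: K.
split => // tau tauT phi aphi.
have [cphi eqn bnd] := aphi; have cp := C12_continuous cphi.
have [_ [_ cpx _]] := cphi.
move: (tauT) => /andP[tau0 tT].
have t1 : tau \in `[0, T] by rewrite in_itv/= (ltW tau0).
have t2 : 0 \in `[0, T] by rewrite in_itv/= lexx ltW.
have [L1 L2] := LL; have LL' := LLe.
have [M1 B1] := cont_bounded LL' (@cont_row phi (- L) L tau cp).
have [M2 B2] := cont_bounded LL' (@cont_row phi (- L) L 0 cp).
have [M3 B3] := cont_bounded (ltW tau0) (@cont_col (d_x phi) 0 tau (- L) cpx).
have [M4 B4] := cont_bounded (ltW tau0) (@cont_col (d_x phi) 0 tau L cpx).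
apply: (eq_small (K := (L - - L) * M1 + (L - - L) * M2 + tau * (M3 + M4))) => e e0.
have [v hv wv] := H e e0; have [uv gv] := hv; have := gv tau tauT phi aphi.
have hw t : t \in `[0, T] -> cont (- L) L (w t) by exact: ucont2_1.
have hwc x : x \in `[- L, L] -> cont 0 tau (w^~ x).
  by move=> xL; apply: (cont_sub (lexx 0) tT); exact: (ucont2_1 (ucont2_C uw)).
move=> Ev.
have step t M : t \in `[0, T] -> (forall x, x \in `[- L, L] -> `|phi t x| <= M) ->
    `|RI (- L) L (fun x => w t x * phi t x) - RI (- L) L (fun x => v t x * phi t x)|
    <= (L - - L) * (e * M).
  move=> tt BM.
  have c1 : cont (- L) L (fun x => w t x * phi t x).
    by apply: contM; [exact: hw|exact: cont_row].
  have c2 : cont (- L) L (fun x => v t x * phi t x).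
    by apply: contM; [exact: heat_row|exact: cont_row].
  rewrite -RIB//; apply: RI_le => //; first exact: contB.
  move=> x /subset_itv_oo_cc xL; rewrite -mulrBl normrM.
  by apply: ler_pM => //; [exact: wv|exact: BM].
have side x (u : R -> R) : cont 0 tau u ->
    cont 0 tau (fun t => u t * d_x phi t x).
  by move=> hu; apply: contM; [exact: hu|exact: (cont_col (f := d_x phi))].
have S3 : `|RI 0 tau (fun t => w t (- L) * d_x phi t (- L) - w t L * d_x phi t L) -
   RI 0 tau (fun t => v t (- L) * d_x phi t (- L) - v t L * d_x phi t L)| <=
   (tau - 0) * (e * M3 + e * M4).
  have c1 : cont 0 tau (fun t => w t (- L) * d_x phi t (- L) - w t L * d_x phi t L).
    by apply: contB; apply: side; exact: hwc.
  have c2 : cont 0 tau (fun t => v t (- L) * d_x phi t (- L) - v t L * d_x phi t L).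
    by apply: contB; apply: side; exact: heat_col.
  rewrite -RIB//; apply: RI_le => //; [exact: ltW|exact: contB|].
  move=> t /subset_itv_oo_cc tt.
  have tt' : t \in `[0, T] by move: tt; rewrite !in_itv/=; lra.
  have -> : w t (- L) * d_x phi t (- L) - w t L * d_x phi t L -
     (v t (- L) * d_x phi t (- L) - v t L * d_x phi t L) =
     (w t (- L) - v t (- L)) * d_x phi t (- L) - (w t L - v t L) * d_x phi t L by ring.
  apply: le_trans (ler_normB _ _) _; rewrite !normrM; apply: lerD; apply: ler_pM => //;
    [exact: wv|exact: B3|exact: wv|exact: B4].
have S1 := step tau M1 t1 B1; have S2 := step 0 M2 t2 B2.
have G (x1 x2 x3 y1 y2 c1 c2 c3 : R) : `|x1 - y1| <= c1 -> `|x2 - y2| <= c2 ->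
    `|x3 - (y1 - y2)| <= c3 -> `|x1 - x2 - x3| <= c1 + c2 + c3.
  move=> H1 H2 H3; have -> : x1 - x2 - x3 = (x1 - y1) - (x2 - y2) - (x3 - (y1 - y2)) by ring.
  by apply: le_trans (ler_normB _ _) (lerD (le_trans (ler_normB _ _) (lerD H1 H2)) H3).
rewrite -Ev in S3; apply: le_trans (G _ _ _ _ _ _ _ _ S1 S2 S3) _.
by rewrite le_eqVlt; apply/orP; left; apply/eqP; ring.
Qed.

End Heat.

(** * Exponential solutions *)

Section HeatExp.
Context {R : realType}.
Variables (L T : R).
Hypotheses (L0 : 0 < L) (T0 : 0 < T).

(** The space variable is complex, so that one formula gives both the solution on the real interval
    and its values on a contour; [be] will shift the time origin. *)
Definition hexp (C al be : R[i]) (tz : R * R[i]) : R[i] :=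
  C * cexp (be + (al * tz.2 + tz.1%:C * al ^+ 2)).

Lemma cderivZ (F : R -> R[i]) (s : R) (c l : R[i]) : cderiv F s l ->
  cderiv (fun y => c * F y) s (c * l).
Proof.
move=> [d1 d2]; split.
- rewrite (_ : (fun y => _) = fun y => complex.Re c * complex.Re (F y) -
    complex.Im c * complex.Im (F y)); last by apply/funext => y; rewrite cReM.
  have K1 := @is_deriveZ _ _ _ _ (complex.Re c) _ _ _ d1.
  have K2 := @is_deriveZ _ _ _ _ (complex.Im c) _ _ _ d2.
  have K := @is_deriveB _ _ _ _ _ _ _ _ _ K1 K2.
  by apply: is_derive_eq; rewrite cReM.
- rewrite (_ : (fun y => _) = fun y => complex.Re c * complex.Im (F y) +
    complex.Im c * complex.Re (F y)); last by apply/funext => y; rewrite cImM.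
  have K1 := @is_deriveZ _ _ _ _ (complex.Re c) _ _ _ d2.
  have K2 := @is_deriveZ _ _ _ _ (complex.Im c) _ _ _ d1.
  have K := @is_deriveD _ _ _ _ _ _ _ _ _ K1 K2.
  by apply: is_derive_eq; rewrite cImM.
Qed.

Lemma hexp_dt C al be t (z : R[i]) :
  cderiv (fun t => hexp C al be (t, z)) t (hexp (al ^+ 2 * C) al be (t, z)).
Proof.
have E y : hexp C al be (y, z) = C * cexp (be + al * z + y%:C * al ^+ 2).
  by rewrite /hexp/=; congr (_ * cexp _); ring.
rewrite (_ : (fun t => _) = fun y => C * cexp (be + al * z + y%:C * al ^+ 2)); last first.
  by apply/funext => y.
have -> : hexp (al ^+ 2 * C) al be (t, z) =
    C * (al ^+ 2 * cexp (be + al * z + t%:C * al ^+ 2)).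
  by rewrite mulrCA mulrA -[RHS]mulrA -E /hexp/=; ring.
exact/cderivZ/cexp_cderiv.
Qed.

Lemma hexp_dx C al be t (x : R) :
  cderiv (fun x => hexp C al be (t, x%:C)) x (hexp (al * C) al be (t, x%:C)).
Proof.
have E y : hexp C al be (t, y%:C) = C * cexp (be + t%:C * al ^+ 2 + y%:C * al).
  by rewrite /hexp/=; congr (_ * cexp _); ring.
rewrite (_ : (fun x => _) = fun y => C * cexp (be + t%:C * al ^+ 2 + y%:C * al)); last first.
  by apply/funext => y.
have -> : hexp (al * C) al be (t, x%:C) =
    C * (al * cexp (be + t%:C * al ^+ 2 + x%:C * al)).
  by rewrite mulrCA -E /hexp/=; ring.
exact/cderivZ/cexp_cderiv.
Qed.

Lemma linear_continuous2 (u v b : R) :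
  continuous (fun p : R * R => b + (p.2 * u + p.1 * v)).
Proof.
move=> p; apply: cvgD; first exact: cvg_cst.
by apply: cvgD; apply: cvgMl; [exact: cvg_snd|exact: cvg_fst].
Qed.

Lemma hexp_continuous C al be :
  continuous (fun p : R * R => complex.Re (hexp C al be (p.1, p.2%:C))).
Proof.
pose u := fun p : R * R => complex.Re be + (p.2 * complex.Re al + p.1 * complex.Re (al ^+ 2)).
pose v := fun p : R * R => complex.Im be + (p.2 * complex.Im al + p.1 * complex.Im (al ^+ 2)).
have -> : (fun p : R * R => complex.Re (hexp C al be (p.1, p.2%:C))) =
  (fun p => complex.Re C * (expR (u p) * cos (v p)) - complex.Im C * (expR (u p) * sin (v p))).
  apply/funext => p; rewrite /hexp cReM /cexp/=.
  have -> : complex.Re (be + (al * p.2%:C + p.1%:C * al ^+ 2)) = u p.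
    by rewrite !cReD [complex.Re (al * _)]cReM [complex.Re (_ * al ^+ 2)]cReM/= /u; ring.
  have -> : complex.Im (be + (al * p.2%:C + p.1%:C * al ^+ 2)) = v p.
    by rewrite !cImD [complex.Im (al * _)]cImM [complex.Im (_ * al ^+ 2)]cImM/= /v; ring.
  by [].
have cu : continuous u by exact: linear_continuous2.
have cv : continuous v by exact: linear_continuous2.
move=> p; have eu : continuous_at p (fun p => expR (u p)).
  by apply: continuous_comp; [exact: cu|exact: continuous_expR].
have cc : continuous_at p (fun p => cos (v p)).
  by apply: continuous_comp; [exact: cv|exact: continuous_cos].
have cs : continuous_at p (fun p => sin (v p)).
  by apply: continuous_comp; [exact: cv|exact: continuous_sin].
by apply: cvgB; apply: cvgMr; apply: cvgM.
Qed.

(** A derivative only multiplies the amplitude, by al in x and by al ^+ 2 in t, so the heat equation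
    is read off the amplitudes. *)
Lemma heat_Re_hexp C al be : heat L T (fun t x => complex.Re (hexp C al be (t, x%:C))).
Proof.
apply: (@green_smooth _ _ _ L0 _ (fun t x => complex.Re (hexp (al ^+ 2 * C) al be (t, x%:C)))
  (fun t x => complex.Re (hexp (al * C) al be (t, x%:C)))).
- by move=> t x; have [] := hexp_dt C al be t x%:C.
- by move=> t x; have [] := hexp_dx C al be t x.
- by move=> t x; rewrite expr2 -mulrA; have [] := hexp_dx (al * C) al be t x.
- exact: hexp_continuous.
- exact: hexp_continuous.
Qed.

Lemma heat_Im_hexp C al be : heat L T (fun t x => complex.Im (hexp C al be (t, x%:C))).
Proof.
rewrite (_ : (fun t x => _) =
  (* Im z = Re (- i z). *)
  fun t x => complex.Re (hexp (Complex 0 (-1) * C) al be (t, x%:C))).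
  exact: heat_Re_hexp.
apply/funext => t; apply/funext => x; rewrite /hexp -mulrA.
by rewrite [RHS]cReM/= mul0r sub0r mulN1r opprK.
Qed.

End HeatExp.

(** * Solutions with Cauchy's formula on one time slice *)

Section HeatClass.
Context {R : realType}.
Variables (L T s a h : R).
Hypotheses (L0 : 0 < L) (T0 : 0 < T) (sT : s \in `[0, T]) (La : L < a) (h0 : 0 < h).
Local Notation zeta := (zeta a h).

(* Solutions on the rectangle whose slice at time [s] satisfies Cauchy's formula
   on the boundary of a rhombus; both conditions survive uniform limits on the
   set [hdom]. *)
Definition hclass (W : R * R[i] -> R[i]) : Prop :=
  [/\ heat L T (fun t x => complex.Re (W (t, x%:C))),
      heat L T (fun t x => complex.Im (W (t, x%:C))),
      (forall j : 'I_4, ccont (fun p => W (s, zeta j p))) &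
      (forall x : R, x \in `[- L, L] ->
         cauchy a h (fun z => W (s, z)) x = winding a h * W (s, x%:C))].

(** The heat identity reads W on the first piece, the contour integral reads it on the second.
    Estimates are asked on these two pieces only. *)
Definition hdom : set (R * R[i]) := [set tz |
  (tz.1 \in `[0, T] /\ exists2 x : R, x \in `[- L, L] & tz.2 = x%:C) \/
  (tz.1 = s /\ exists (j : 'I_4) (p : R), p \in `[0, 1] /\ tz.2 = zeta j p)].

Let a0 : 0 < a. Proof. exact: lt_trans La. Qed.

Let La' (x : R) : x \in `[- L, L] -> - a < x < a.
Proof. by rewrite in_itv/=; have := La; lra. Qed.

Lemma hclass_hexp C al be : hclass (hexp C al be).
Proof.
split.
- exact: heat_Re_hexp.
- exact: heat_Im_hexp.
- move=> j; apply: (@eq_ccont _ (fun p : R => C *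
    cexp (be + s%:C * al ^+ 2 + al * vtx a h j + p%:C * (al * dir a h j)))).
    by move=> p _; rewrite /hexp/= /zeta; congr (_ * cexp _); ring.
  by apply: ccontM; [exact: ccont_cst|exact: ccont_cexp].
- move=> x xL; pose F z := C * cexp ((be + s%:C * al ^+ 2) + al * z).
  have -> : (fun z => hexp C al be (s, z)) = F.
    by apply/funext => z; rewrite /hexp /F/=; congr (_ * cexp _); ring.
  have -> : hexp C al be (s, x%:C) = F x%:C.
    by rewrite /hexp /F/=; congr (_ * cexp _); ring.
  apply: (@cauchy_formula _ _ _ a0 h0 F
    (fun z => C * (al * cexp ((be + s%:C * al ^+ 2) + al * z)))); first exact: La'.
  move=> z _; apply: sdiffZ; apply: (sdiff_affine (F := cexp)).
  exact: sdiff_cexp.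
Qed.

Lemma heat_ext (w v : R -> R -> R) : (forall t x, w t x = v t x) ->
  heat L T w -> heat L T v.
Proof. by move=> wv; rewrite (_ : w = v)//; apply/funext => t; apply/funext => x. Qed.

Lemma hclass_comb (c : R) V W : hclass V -> hclass W ->
  hclass (fun i => c%:C * V i + W i).
Proof.
move=> [v1 v2 v3 v4] [w1 w2 w3 w4]; split.
- apply: heat_ext (heat_comb L0 T0 c v1 w1) => t x.
  by rewrite cReD cReM/= mul0r subr0.
- apply: heat_ext (heat_comb L0 T0 c v2 w2) => t x.
  by rewrite cImD cImM/= mul0r addr0.
- by move=> j; apply: ccontD => //; apply: ccontM => //; exact: ccont_cst.
- move=> x xL; rewrite mulrDr mulrCA -v4// -w4// /cauchy mulr_sumr -big_split/=.
  apply: eq_bigr => j _.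
  have ck := ccont_ckernel a0 h0 j (La' xL).
  have c1 : ccont (fun p => V (s, zeta j p) * ckernel a h x j p) by exact: ccontM.
  have c2 : ccont (fun p => W (s, zeta j p) * ckernel a h x j p) by exact: ccontM.
  rewrite -(cintZ c%:C c1) -cintD//; last by apply: ccontM => //; exact: ccont_cst.
  by apply: eq_cint => p _; ring.
Qed.

Lemma hclass0 : hclass (fun=> 0).
Proof.
have E : (fun=> 0) = hexp 0 0 0 :> (R * R[i] -> R[i]).
  by apply/funext => tz; rewrite /hexp mul0r.
by rewrite E; exact: hclass_hexp.
Qed.

Lemma hdom_rect t x : t \in `[0, T] -> x \in `[- L, L] -> hdom (t, x%:C).
Proof. by move=> tT xL; left; split => //; exists x. Qed.

Lemma hdom_zeta (j : 'I_4) p : p \in `[0, 1] -> hdom (s, zeta j p).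
Proof. by move=> p1; right; split => //; exists j, p. Qed.

(** Cauchy's formula passes to the limit for each x separately, because the kernel at x is bounded
    along every edge. *)
Lemma hclass_lim W : (forall e : R, 0 < e ->
    exists2 V, hclass V & forall i, hdom i -> nrm (W i - V i) <= e) -> hclass W.
Proof.
move=> H.
have cW (j : 'I_4) : ccont (fun p => W (s, zeta j p)).
  apply/ccontP => e e0; have e3 : 0 < e / 3 by rewrite divr_gt0.
  have [V [_ _ cV _] WV] := H _ e3.
  have /ccontP/(_ _ e3)[d d0 K] := cV j; exists d => // x y x1 y1 xy.
  have -> : W (s, zeta j x) - W (s, zeta j y) = (W (s, zeta j x) - V (s, zeta j x)) +
    (V (s, zeta j x) - V (s, zeta j y)) - (W (s, zeta j y) - V (s, zeta j y)) by ring.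
  have -> : e = e / 3 + e / 3 + e / 3 by field.
  apply: le_trans (nrmB _ _) (lerD _ (WV _ (hdom_zeta _ y1))).
  by apply: le_trans (nrmD _ _) (lerD (WV _ (hdom_zeta _ x1)) _); exact: K.
split => //.
- apply: heat_lim => // e /H[V [hV _ _ _] WV].
  exists (fun t x => complex.Re (V (t, x%:C))) => // t x tT xL.
  rewrite -cReN -cReD; apply: le_trans (Re_le _) (WV _ _).
  exact: hdom_rect.
- apply: heat_lim => // e /H[V [_ hV _ _] WV].
  exists (fun t x => complex.Im (V (t, x%:C))) => // t x tT xL.
  rewrite -cImN -cImD; apply: le_trans (Im_le _) (WV _ _).
  exact: hdom_rect.
- move=> x xL; have ck j := ccont_ckernel a0 h0 j (La' xL).
  have /choice[M HM] : forall j : 'I_4, exists M : R, 0 < M /\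
      forall p, p \in `[0, 1] -> nrm (ckernel a h x j p) <= M.
    by move=> j; have [M M0 HM] := ccont_bounded (ck j); exists M.
  apply: (nrm_small (K := \sum_j (2 * M j) + nrm (winding a h))) => e e0.
  have [V [_ _ cV EV] WV] := H e e0.
  have -> : cauchy a h (fun z => W (s, z)) x - winding a h * W (s, x%:C) =
    (cauchy a h (fun z => W (s, z)) x - cauchy a h (fun z => V (s, z)) x) -
    winding a h * (W (s, x%:C) - V (s, x%:C)) by rewrite EV//; ring.
  rewrite mulrDl; apply: le_trans (nrmB _ _) (lerD _ _); last first.
    by rewrite nrmM ler_wpM2l ?nrm_ge0//; apply: WV; exact: hdom_rect.
  rewrite /cauchy -sumrB mulr_suml.
  apply: nrm_sum => j; have [M0 Mj] := HM j.
  have cWk : ccont (fun p => W (s, zeta j p) * ckernel a h x j p) by exact: ccontM.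
  have cVk : ccont (fun p => V (s, zeta j p) * ckernel a h x j p) by exact: ccontM.
  rewrite -cintB// -mulrA; apply: cint_le; first exact: ccontB.
  move=> p /subset_itv_oo_cc p1; rewrite -mulrBl nrmM mulrC ler_pM ?nrm_ge0//.
    exact: Mj.
  by apply: WV; exact: hdom_zeta.
Qed.

Lemma hclass_closed : uniformly_closed hdom hclass.
Proof.
split.
- exact: hclass0.
- move=> f g cf cg; have := hclass_comb 1 cf cg.
  by under [fun i => _]funext => i do rewrite mul1r.
- move=> c f cf; have := hclass_comb c cf hclass0.
  by under [fun i => _]funext => i do rewrite addr0.
- exact: hclass_lim.
Qed.

End HeatClass.

(** * Superposition of exponential solutions *)

Section GeometricSeries.
Context {R : realType}.

Lemma geometric_lim (A rho : R) : 0 <= rho < 1 ->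
  forall e : R, 0 < e -> exists N : nat, A * rho ^+ N <= e.
Proof.
move=> /andP[r0 r1] e e0; have A1 : 0 < `|A| + 1 by rewrite ltr_wpDl.
have := @cvg_expr R rho; rewrite ger0_norm// => /(_ r1).
move=> /cvgrPdist_le/(_ _ (divr_gt0 e0 A1)) [N _ H]; exists N.
have := H N (leqnn N); rewrite /= sub0r normrN ger0_norm ?exprn_ge0// => K.
apply: le_trans (ler_wpM2r (exprn_ge0 _ r0) (ler_norm A)) _.
apply: le_trans (ler_wpM2l (normr_ge0 A) K) _.
by rewrite mulrCA ler_piMr ?(ltW e0)// ler_pdivrMr// mul1r lerDl.
Qed.

Lemma series_geometric (f : nat -> R) (A rho : R) : 0 <= A -> 0 <= rho < 1 ->
  (forall n, `|f n| <= A * rho ^+ n) ->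
  exists l : R, forall N, `|l - \sum_(n < N) f n| <= A * rho ^+ N / (1 - rho).
Proof.
move=> A0 /andP[r0 r1] H; have r1' : 0 < 1 - rho by rewrite subr_gt0.
have T (N k : nat) : `|\sum_(N <= n < N + k) f n| <= A * rho ^+ N / (1 - rho).
  (* The remaining tail is subtracted to make the bound inductive in k. *)
  suff K : `|\sum_(N <= n < N + k) f n| <=
      A * rho ^+ N / (1 - rho) - A * rho ^+ (N + k) / (1 - rho).
    apply: le_trans K _; rewrite lerBlDr lerDl divr_ge0 ?(ltW r1')//.
    by rewrite mulr_ge0// exprn_ge0.
  elim: k => [|k IH]; first by rewrite addn0 big_geq// normr0 subrr.
  rewrite addnS big_nat_recr ?leq_addr//=.
  apply: le_trans (ler_normD _ _) (le_trans (lerD IH (H _)) _).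
  by rewrite exprS le_eqVlt; apply/orP; left; apply/eqP; field; rewrite gt_eqF.
have D (N k : nat) : `|\sum_(n < N + k) f n - \sum_(n < N) f n| <= A * rho ^+ N / (1 - rho).
  rewrite -!(big_mkord xpredT f) (big_cat_nat (n := N)) ?leq_addr//=.
  by rewrite addrAC subrr add0r.
have cu : cvgn (fun N => \sum_(n < N) f n).
  apply/cauchy_cvgP/cauchy_exP => e e0.
  have e1 : 0 < (1 - rho) * (e / 2) by rewrite mulr_gt0// divr_gt0.
  have r01 : 0 <= rho < 1 by rewrite r0.
  have [N HN] := geometric_lim A r01 e1.
  exists (\sum_(n < N) f n); exists N => // k /= Nk.
  have := D N (k - N)%N; rewrite subnKC// distrC => K.
  rewrite -ball_normE/=; apply: le_lt_trans K _.
  rewrite ltr_pdivrMr// [ltRHS]mulrC; apply: le_lt_trans HN _.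
  by rewrite ltr_pM2l// ltr_pdivrMr// ltr_pMr// ltr1n.
exists (limn (fun N => \sum_(n < N) f n)) => N.
have c1 : (fun k => `|\sum_(n < k) f n - \sum_(n < N) f n|) @ \oo -->
    `|limn (fun N => \sum_(n < N) f n) - \sum_(n < N) f n|.
  by apply: cvg_norm; apply: cvgB; [exact: cu|exact: cvg_cst].
rewrite -(cvg_lim _ c1)//; apply: limr_le; first exact: cvgP c1.
by exists N => // k /= Nk; have := D N (k - N)%N; rewrite subnKC.
Qed.

Lemma cseries_geometric (f : nat -> R[i]) (A rho : R) : 0 <= A -> 0 <= rho < 1 ->
  (forall n, nrm (f n) <= A * rho ^+ n) ->
  exists l : R[i], forall N,
    nrm (l - \sum_(n < N) f n) <= 2 * A * rho ^+ N / (1 - rho).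
Proof.
move=> A0 rr H.
have [l1 H1] := series_geometric A0 rr (fun n => le_trans (Re_le (f n)) (H n)).
have [l2 H2] := series_geometric A0 rr (fun n => le_trans (Im_le (f n)) (H n)).
exists (Complex l1 l2) => N; apply: le_trans (nrm_le _) _.
rewrite cReD cImD cReN cImN (big_morph _ (@cReD R) erefl) (big_morph _ (@cImD R) erefl)/=.
by apply: le_trans (lerD (H1 N) (H2 N)) _; rewrite -!mulrA [leRHS]mulr_natl mulr2n.
Qed.

End GeometricSeries.

Section ClosedSeries.
Context {R : realType} {I : Type}.
Variables (D : set I) (K : set (I -> R[i])).
Hypothesis clK : uniformly_closed D K.

Lemma uniformly_closed_sum n (f : 'I_n -> I -> R[i]) : (forall j, K (f j)) ->
  K (fun i => \sum_j f j i).
Proof.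
have [K0 KD _ _] := clK; elim: n f => [|n IH] f Kf.
  by under [fun i => _]funext => i do rewrite big_ord0.
under [fun i => _]funext => i do rewrite big_ord_recr/=.
by apply: KD => //; exact: IH.
Qed.

(** The geometric remainder is part of the conclusion because it later identifies the values of
    W. *)
Lemma uniformly_closed_series (V : nat -> I -> R[i]) (A rho : R) : 0 <= A ->
  0 <= rho < 1 -> (forall n, K (V n)) ->
  (forall n i, D i -> nrm (V n i) <= A * rho ^+ n) ->
  exists2 W, K W & forall i, D i -> forall N,
    nrm (W i - \sum_(n < N) V n i) <= 2 * A * rho ^+ N / (1 - rho).
Proof.
move=> A0 rr KV HV; have [_ _ _ Klim] := clK.
have /choice[W HW] : forall i, exists l, D i -> forall N,
    nrm (l - \sum_(n < N) V n i) <= 2 * A * rho ^+ N / (1 - rho).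
  (* Outside D nothing is known of the series; the value 0 is arbitrary. *)
  move=> i; have [Di|nDi] := pselect (D i); last by exists 0.
  have [l Hl] := cseries_geometric A0 rr (fun n => HV n i Di).
  by exists l.
exists W => //; apply: Klim => e e0.
have [N HN] := geometric_lim (2 * A / (1 - rho)) rr e0.
exists (fun i => \sum_(n < N) V n i).
  exact: (uniformly_closed_sum (f := fun n : 'I_N => V n)).
by move=> i Di; apply: le_trans (HW i Di N) _; rewrite mulrAC.
Qed.

End ClosedSeries.

Section Ccont2.
Context {R : realType}.
Implicit Types (H K : R -> R -> R[i]).

Lemma ccont2M H K : ccont2 H -> ccont2 K -> ccont2 (fun s p => H s p * K s p).
Proof.
move=> cH cK s0 p0 s01 p01 e e0.
have h1 : 0 < nrm (H s0 p0) + 1 by rewrite ltr_wpDl ?nrm_ge0.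
have k1 : 0 < nrm (K s0 p0) + 1 by rewrite ltr_wpDl ?nrm_ge0.
have e2 : 0 < e / 2 by rewrite divr_gt0.
have [d1 d10 H1] := cH _ _ s01 p01 _ (divr_gt0 e2 k1).
have [d2 d20 H2] := cK _ _ s01 p01 _ (divr_gt0 e2 h1).
have [d3 d30 H3] := cK _ _ s01 p01 _ ltr01.
exists (Num.min (Num.min d1 d2) d3); first by rewrite !lt_min d10 d20.
move=> s p s1 p1; rewrite !lt_min => /andP[/andP[sd1 sd2] sd3] /andP[/andP[pd1 pd2] pd3].
have {}H1 := H1 _ _ s1 p1 sd1 pd1; have {}H2 := H2 _ _ s1 p1 sd2 pd2.
have {}H3 := H3 _ _ s1 p1 sd3 pd3.
have -> : H s0 p0 * K s0 p0 - H s p * K s p =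
  (H s0 p0 - H s p) * K s p + H s0 p0 * (K s0 p0 - K s p) by ring.
apply: le_trans (nrmD _ _) _; rewrite !nrmM [e]splitr; apply: lerD.
  have Ks : nrm (K s p) <= nrm (K s0 p0) + 1.
    by rewrite -(subKr (K s0 p0) (K s p)) (le_trans (nrmB _ _))// lerD2l.
  apply: le_trans (ler_pM (nrm_ge0 _) (nrm_ge0 _) H1 Ks) _.
  by rewrite divfK// gt_eqF.
apply: le_trans (ler_wpM2l (nrm_ge0 _) H2) _.
rewrite mulrCA ler_piMr ?(ltW e2)// ler_pdivrMr// mul1r.
by rewrite lerDl.
Qed.

Lemma ccont2_r (f : R -> R[i]) : ccont f -> ccont2 (fun _ p => f p).
Proof.
move=> /ccontP cf s0 p0 s01 p01 e /cf[d d0 H].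
by exists d => // s p s1 p1 _ pp; exact: H.
Qed.

Lemma ccont2_cexp u v w q : ccont2 (fun s p => cexp (@biaffine R u v w q s p)).
Proof.
by apply: (sdiff_biaffine_ccont2 (F := cexp) (F' := cexp) (D := setT)) => // z _; exact: sdiff_cexp.
Qed.

End Ccont2.

Lemma eq_ccont2 {R : realType} (H K : R -> R -> R[i]) :
  (forall s p, H s p = K s p) -> ccont2 K -> ccont2 H.
Proof. by move=> HK; rewrite (_ : H = K)//; apply/funext => s; apply/funext. Qed.

(** * The superposition integral *)

Section Superposition.
Context {R : realType}.
Variables (L T s a' h' a h t0 eta B0 ka0 M : R) (G : R[i] -> R[i]).
Hypotheses (L0 : 0 < L) (T0 : 0 < T) (sT : s \in `[0, T]) (t0T : t0 \in `[0, T]).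
Hypotheses (La' : L < a') (h'0 : 0 < h') (La : L < a) (h0 : 0 < h).
Hypotheses (eta0 : 0 < eta) (ka00 : 0 < ka0) (M0 : 0 <= M).
Hypothesis cG : forall j : 'I_4, ccont (fun p => G (zeta a h j p)).
Hypothesis GM : forall (j : 'I_4) (p : R), p \in `[0, 1] -> nrm (G (zeta a h j p)) <= M.
Hypothesis cauchyG : forall x : R, x \in `[- L, L] ->
  cauchy a h G x = winding a h * G x%:C.

Local Notation hdom := (hdom L T s a' h').
Local Notation hclass := (hclass L T s a' h').
Local Notation zeta := (zeta a h).
Local Notation theta := (theta a h).

(** Exponent of the solution that equals exp(- r theta (z - zeta)) at time t0. Two rhombi are
    involved: (a, h) carries the data G, reproduced at t0, and (a', h') is where the result is
    examined at time s. *)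
Definition phase (j : nat) (p r : R) (tz : R * R[i]) : R[i] :=
  - (r%:C * theta j) * (tz.2 - zeta j p) + (r ^+ 2 * (tz.1 - t0))%:C * theta j ^+ 2.

Hypothesis phase_le : forall tz, hdom tz -> forall (j : 'I_4) (p r : R), p \in `[0, 1] ->
  0 <= r -> complex.Re (phase j p r tz) <= B0 - ka0 * r.

Let a0 : 0 < a. Proof. exact: lt_trans La. Qed.
Let a'0 : 0 < a'. Proof. exact: lt_trans La'. Qed.

Let La_ (x : R) : x \in `[- L, L] -> - a < x < a.
Proof. by rewrite in_itv/=; have := La; lra. Qed.

Let node (n : nat) (q : R) : R := eta * (n%:R + q).

Let node_ge n q : q \in `[0, 1] -> eta * n%:R <= node n q.
Proof. by rewrite in_itv/= => /andP[q0 _]; rewrite /node ler_pM2l// lerDl. Qed.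

Let node_ge0 n q : q \in `[0, 1] -> 0 <= node n q.
Proof. by move=> /(node_ge n); apply: le_trans; rewrite mulr_ge0// ltW. Qed.

Let node_le n q : q \in `[0, 1] -> node n q <= eta * n.+1%:R.
Proof. by rewrite in_itv/= => /andP[_ q1]; rewrite /node ler_pM2l// -natr1 lerD2l. Qed.

Let H (j : nat) (n : nat) (q p : R) : R[i] :=
  G (zeta j p) * cexp ((node n q)%:C * theta j * zeta j p).

Let cH (j : 'I_4) n : ccont2 (H j n).
Proof.
apply: ccont2M; first exact: ccont2_r.
apply: (eq_ccont2 _ (@ccont2_cexp R
  ((eta * n%:R)%:C * theta j * vtx a h j) (eta%:C * theta j * vtx a h j)
  ((eta * n%:R)%:C * theta j * dir a h j) (eta%:C * theta j * dir a h j))) => q p.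
by rewrite /biaffine /node /zeta !(rmorphM, rmorphD)/=; congr cexp; ring.
Qed.

(** exp(phase) is exp(r theta zeta) times a factor free of p. Integrating over the edge first
    therefore leaves, for each r, a single exponential solution [E] with amplitude proportional to
    [m]. *)
Let m (j : nat) (n : nat) (q : R) : R[i] := cint (H j n q).

Let cm (j : 'I_4) n : ccont (m j n). Proof. exact: ccont2_cint. Qed.

Let al (j : nat) (n : nat) (q : R) : R[i] := - ((node n q)%:C * theta j).

Let c : R[i] := Complex 0 (a ^+ 2 + h ^+ 2) / winding a h.

Let E (j : nat) (n : nat) (q : R) : R * R[i] -> R[i] :=
  hexp (c * eta%:C * m j n q) (al j n q) (- (t0%:C * al j n q ^+ 2)).

Let psi (j : nat) (n : nat) (q : R) (tz : R * R[i]) : R[i] :=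
  al j n q * tz.2 + ((tz.1 - t0)%:C * al j n q ^+ 2).

Let E_psi j n q tz : E j n q tz = c * eta%:C * m j n q * cexp (psi j n q tz).
Proof. by rewrite /E /hexp /psi rmorphB/=; congr (_ * cexp _); ring. Qed.

Let ZZ : R := L + a' + h'.

Let hdom_bound tz : hdom tz -> nrm tz.2 <= ZZ /\ `|tz.1 - t0| <= T.
Proof.
have t1 t : t \in `[0, T] -> `|t - t0| <= T.
  by move: t0T; rewrite !in_itv/= ler_norml; lra.
case: tz => t z [/= [tT [x xL ->]]|/= [-> [j [p [p1 ->]]]]]; split.
- rewrite nrm_C; apply: (@le_trans _ _ L).
    by rewrite ler_norml; move: xL; rewrite in_itv.
  by rewrite /ZZ -addrA lerDl addr_ge0// ltW.
- exact: t1.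
- have [X Y] := rhombus_Re_Im a'0 h'0 (rhombus_zeta a'0 h'0 j p1).
  apply: le_trans (nrm_le _) (le_trans (lerD X Y) _).
  by rewrite /ZZ -addrA lerDr ltW.
- exact: t1.
Qed.

Let th (j : nat) : R := nrm (theta j).

Let psi_lip (j : 'I_4) n q q' tz : hdom tz -> q \in `[0, 1] -> q' \in `[0, 1] ->
  nrm (psi j n q tz - psi j n q' tz) <=
  (eta * th j * ZZ + T * (2 * eta * n.+1%:R * eta) * th j ^+ 2) * `|q - q'|.
Proof.
move=> /hdom_bound[zZ tT] q1 q'1.
(* The difference of the squared nodes is factored as their sum times eta (q - q'). *)
have -> : psi j n q tz - psi j n q' tz =
   (eta * (q' - q))%:C * theta j * tz.2 +
   ((tz.1 - t0) * ((node n q + node n q') * (eta * (q - q'))))%:C * (theta j * theta j).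
  rewrite /psi /al /node !(rmorphM, rmorphD, rmorphB, rmorphN)/=; ring.
rewrite [leRHS]mulrDl; apply: le_trans (nrmD _ _) _; rewrite !nrmM !nrm_C !normrM.
rewrite (gtr0_norm eta0) [`|q' - q|]distrC -/(th j); apply: lerD.
  have -> : eta * th j * ZZ * `|q - q'| = eta * `|q - q'| * th j * ZZ by ring.
  by rewrite ler_wpM2l// !mulr_ge0 ?nrm_ge0 ?(ltW eta0).
have -> : T * (2 * eta * n.+1%:R * eta) * th j ^+ 2 * `|q - q'| =
  T * (2 * (eta * n.+1%:R) * (eta * `|q - q'|)) * (th j * th j) by ring.
have D0 : 0 <= eta * `|q - q'| by rewrite mulr_ge0 ?(ltW eta0).
rewrite ler_wpM2r ?mulr_ge0 ?nrm_ge0//; apply: ler_pM => //.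
  by rewrite mulr_ge0.
rewrite ler_wpM2r// ger0_norm ?addr_ge0 ?node_ge0// [leRHS]mulr_natl mulr2n.
by rewrite lerD// node_le.
Qed.

Let psi_bound (j : 'I_4) n q tz : hdom tz -> q \in `[0, 1] ->
  complex.Re (psi j n q tz) <=
  eta * n.+1%:R * th j * ZZ + T * (eta * n.+1%:R) ^+ 2 * th j ^+ 2.
Proof.
move=> /hdom_bound[zZ tT] q1.
apply: le_trans (ler_norm _) (le_trans (Re_le _) _).
rewrite /psi /al; apply: le_trans (nrmD _ _) _.
rewrite !nrmM nrmN nrmM !nrm_C (ger0_norm (node_ge0 n q1)) -/(th j).
have K0 : 0 <= node n q * th j by rewrite mulr_ge0 ?nrm_ge0 ?node_ge0.
have K : node n q * th j <= eta * n.+1%:R * th j.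
  by rewrite ler_wpM2r ?nrm_ge0 ?node_le.
apply: lerD; first exact: (ler_pM K0 (nrm_ge0 _) K zZ).
have -> : T * (eta * n.+1%:R) ^+ 2 * th j ^+ 2 =
  T * (eta * n.+1%:R * th j * (eta * n.+1%:R * th j)) by ring.
apply: (ler_pM _ _ tT) => //; first exact: mulr_ge0.
exact: (ler_pM K0 K0 K K).
Qed.

(** Needed for [uniformly_closed_cint]. It holds because [hdom] is bounded and r stays in one step,
    so exponents are bounded by B and Lipschitz in q with constant K. *)
Let E_ucurve (j : 'I_4) n : ucurve hdom (E j n).
Proof.
pose B := eta * n.+1%:R * th j * ZZ + T * (eta * n.+1%:R) ^+ 2 * th j ^+ 2.
pose K := eta * th j * ZZ + T * (2 * eta * n.+1%:R * eta) * th j ^+ 2.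
have K0 : 0 <= K.
  rewrite /K addr_ge0 ?mulr_ge0 ?exprn_ge0 ?nrm_ge0 ?(ltW eta0) ?(ltW T0)//.
  by rewrite /ZZ !addr_ge0// ltW.
have [N N0 HN] := ccont_bounded (cm j n).
move=> e e0; pose k := nrm c * eta + 1.
have k0 : 0 < k by rewrite ltr_wpDl// mulr_ge0 ?nrm_ge0// ltW.
(* Two error terms of size f * expR B, multiplied by |c| * eta <= k, add up to at most e. *)
pose f := e / (2 * k * expR B).
have eB := expR_gt0 B.
have f0 : 0 < f by rewrite divr_gt0// !mulr_gt0.
have /ccontP/(_ f f0)[d d0 Hd] := cm j n.
(* N bounds the amplitude and 2 * expR B is the constant of [cexp_lip], so the second error term is
   below f * expR B. *)
pose g := f / (2 * N * (K + 1)).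
have g0 : 0 < g by rewrite divr_gt0// !mulr_gt0// ltr_wpDl.
exists (Num.min d g); first by rewrite lt_min d0.
move=> q q' q1 q'1; rewrite lt_min => /andP[qd qg] tz Dtz.
rewrite !E_psi -!(mulrA (c * _)) -mulrBr nrmM nrmM nrm_C (gtr0_norm eta0).
have -> : m j n q * cexp (psi j n q tz) - m j n q' * cexp (psi j n q' tz) =
  (m j n q - m j n q') * cexp (psi j n q tz) +
  m j n q' * (cexp (psi j n q tz) - cexp (psi j n q' tz)) by ring.
have X1 : nrm ((m j n q - m j n q') * cexp (psi j n q tz)) <= f * expR B.
  rewrite nrmM nrm_cexp ler_pM ?nrm_ge0 ?expR_ge0//; first exact: Hd.
  by rewrite ler_expR; exact: psi_bound.
have X2 : nrm (m j n q' * (cexp (psi j n q tz) - cexp (psi j n q' tz))) <= f * expR B.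
  rewrite nrmM; apply: le_trans (ler_pM (nrm_ge0 _) (nrm_ge0 _) (HN _ q'1)
    (cexp_lip (psi_bound j n Dtz q1) (psi_bound j n Dtz q'1))) _.
  rewrite -/B; apply: le_trans (_ : N * (2 * expR B * (K * g)) <= _).
    apply: ler_wpM2l; first exact: ltW.
    apply: ler_wpM2l; first by rewrite mulr_ge0 ?(ltW eB).
    apply: le_trans (psi_lip j n Dtz q1 q'1) _.
    by apply: ler_wpM2l => //; exact: ltW.
  have -> : N * (2 * expR B * (K * g)) = f * expR B * (K / (K + 1)).
    by rewrite /g; field; rewrite (gt_eqF N0) gt_eqF// ltr_wpDl.
  have fB : 0 <= f * expR B by rewrite mulr_ge0 ?(ltW f0) ?(ltW eB).
  apply: (ler_piMr fB); have K1 : 0 < K + 1 by rewrite ltr_wpDl.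
  by rewrite ler_pdivrMr// mul1r lerDl.
have -> : e = k * (f * expR B + f * expR B).
  by rewrite /f; field; rewrite (gt_eqF k0) gt_eqF.
apply: ler_pM; rewrite ?nrm_ge0//; last exact: le_trans (nrmD _ _) (lerD X1 X2).
  by rewrite mulr_ge0 ?nrm_ge0// ltW.
by rewrite /k lerDl.
Qed.

(* The integral in r is cut into steps of length eta; with eta of order 1 / ka the
   final bound is O(1 / ka). The coefficient c is - theta * dir / winding. *)
Let V (n : nat) (tz : R * R[i]) : R[i] := \sum_(j < 4) cint (fun q => E j n q tz).

Let V_class n : hclass (V n).
Proof.
have cl := hclass_closed L0 T0 sT La' h'0.
apply: (uniformly_closed_sum cl (f := fun (j : 'I_4) tz => cint (fun q => E j n q tz))) => j.
apply: (uniformly_closed_cint cl); last exact: E_ucurve.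
by move=> q _; exact: hclass_hexp.
Qed.

(** B and ka belong to the point tz: different points may be given different rates. The 16 is 4
    edges times the factor 2 of [cint_le] for q and again for p. *)
Let V_le tz (B ka : R) n : hdom tz -> 0 < ka ->
  (forall (j : 'I_4) (p r : R), p \in `[0, 1] -> 0 <= r ->
     complex.Re (phase j p r tz) <= B - ka * r) ->
  nrm (V n tz) <= 16 * nrm c * eta * M * expR B * expR (- (ka * eta)) ^+ n.
Proof.
move=> Dtz ka0' Hph; set rho := expR (- _).
have -> : 16 * nrm c * eta * M * expR B * rho ^+ n =
    \sum_(j < 4) 2 * (nrm c * eta * (2 * (M * expR B * rho ^+ n))).
  by rewrite sumr_const card_ord -mulr_natl; ring.
apply: nrm_sum => j; apply: cint_le; first exact: (ucurve_ccont (E_ucurve j n)).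
move=> q /subset_itv_oo_cc q1; rewrite E_psi -mulrA nrmM nrmM nrm_C (gtr0_norm eta0).
rewrite ler_wpM2l ?mulr_ge0 ?nrm_ge0 ?(ltW eta0)// mulrC /m.
have cHq : ccont (H j n q) := ccont2_l (cH j n) q1.
rewrite -cintZ//; apply: cint_le; first by apply: ccontM => //; exact: ccont_cst.
move=> p /subset_itv_oo_cc p1; rewrite /H mulrCA -cexpD nrmM -[leRHS]mulrA.
apply: ler_pM; rewrite ?nrm_ge0//; first exact: GM.
rewrite nrm_cexp /rho -expRM_natr -expRD ler_expR.
have -> : psi j n q tz + (node n q)%:C * theta j * zeta j p = phase j p (node n q) tz.
  by rewrite /psi /phase /al !(rmorphM, rmorphB)/=; ring.
apply: le_trans (Hph j p _ p1 (node_ge0 n q1)) _.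
by rewrite lerD2l mulNr lerN2 -mulrA ler_pM2l// node_ge.
Qed.

Let X (x : R) (j N : nat) (p : R) : R[i] :=
  cexp ((eta * N%:R)%:C * theta j * (zeta j p - x%:C)).

Let tail (x : R) (N : nat) : R[i] :=
  \sum_(j < 4) cint (fun p => G (zeta j p) * ckernel a h x j p * X x j N p).

Let cX x (j : 'I_4) N : ccont (X x j N).
Proof.
apply: (@eq_ccont _ (fun p : R => cexp ((eta * N%:R)%:C * theta j * (vtx a h j - x%:C) +
  p%:C * ((eta * N%:R)%:C * theta j * dir a h j)))); last exact: ccont_cexp.
by move=> p _; rewrite /X /zeta; congr cexp; ring.
Qed.

Let cGk x (j : 'I_4) : x \in `[- L, L] -> ccont (fun p => G (zeta j p) * ckernel a h x j p).
Proof. by move=> xL; apply: ccontM => //; exact: (ccont_ckernel a0 h0 j (La_ xL)). Qed.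

(** At t0 the exponent is linear in r, so a step integrates to a difference of exponentials over
    theta * (zeta - x); theta cancels against [c] and the Cauchy kernel is left. Summing in n
    telescopes from the full Cauchy integral to a decaying tail. *)
Let V_tail x n : x \in `[- L, L] ->
  V n (t0, x%:C) = (tail x n - tail x n.+1) / winding a h.
Proof.
move=> xL; rewrite /V /tail -sumrB mulr_suml; apply: eq_bigr => j _.
pose K q p := G (zeta j p) * cexp ((node n q)%:C * theta j * (zeta j p - x%:C)).
have cK : ccont2 K.
  apply: ccont2M; first exact: ccont2_r.
  apply: (eq_ccont2 _ (@ccont2_cexp R
    ((eta * n%:R)%:C * theta j * (vtx a h j - x%:C)) (eta%:C * theta j * (vtx a h j - x%:C))
    ((eta * n%:R)%:C * theta j * dir a h j) (eta%:C * theta j * dir a h j))) => q p.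
  by rewrite /biaffine /node /zeta !(rmorphM, rmorphD)/=; congr cexp; ring.
have E1 q : q \in `]0, 1[ -> E j n q (t0, x%:C) = c * eta%:C * cint (K q).
  move=> /subset_itv_oo_cc q1; rewrite E_psi -mulrA; congr (_ * _).
  rewrite mulrC /m -(cintZ _ (ccont2_l (cH j n) q1)).
  apply: eq_cint => p _; rewrite /H /K mulrCA -cexpD; congr (_ * cexp _).
  by rewrite /psi /al/= subrr mul0r addr0; ring.
rewrite (eq_cint E1) (cintZ _ (ccont2_cint cK)) (cint_fubini cK).
have c1 := ccontM (cGk j xL) (cX x j n); have c2 := ccontM (cGk j xL) (cX x j n.+1).
rewrite -(cintB c1 c2) -(cintZ _ (ccont2_cint (ccont2_C cK))) [RHS]mulrC -[RHS](cintZ _ (ccontB c1 c2)).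
apply: eq_cint => p /subset_itv_oo_cc p1.
pose y := zeta j p - x%:C.
have y0 : y != 0 by exact: (zeta_neq a0 h0 j p (La_ xL)).
have th0 := theta_neq0 a0 h0 j; have w0 := winding_neq0 a0 h0.
have cn : c = - (theta j * dir a h j) / winding a h.
  by rewrite theta_dir /c; congr (_ / _); apply: complex_ext; rewrite /= ?oppr0 ?opprK.
pose F q := cexp ((eta * n%:R)%:C * theta j * y + q%:C * (eta%:C * theta j * y)).
have cF : ccont F by exact: ccont_cexp.
have EK : cint (fun q => K q p) = G (zeta j p) * cint F.
  rewrite -cintZ//; apply: eq_cint => q _; rewrite /K /F; congr (_ * cexp _).
  by rewrite -/y /node !(rmorphM, rmorphD)/=; ring.
have EF : eta%:C * theta j * y * cint F = X x j n.+1 p - X x j n p.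
  rewrite -cintZ// (cint_FTC (F := F)); last 2 first.
  - by apply: ccontM => //; exact: ccont_cst.
  - by move=> q _; exact: cexp_cderiv.
  rewrite /F /X -/y mul1r mul0r addr0; congr (cexp _ - _).
  have -> : eta * n.+1%:R = eta * n%:R + eta by rewrite -natr1 mulrDr mulr1.
  by rewrite rmorphD/=; ring.
rewrite EK -mulrBr -(opprB (X x j n.+1 p)) -EF cn /ckernel -/y.
by field; rewrite w0 y0.
Qed.

(** The section hypothesis [phase_le] only secures convergence, uniformly on [hdom]; the final
    clause then bounds W at each point by the best decay available there. *)
Lemma superposition : exists2 W, hclass W &
  (forall x : R, x \in `[- L, L] -> W (t0, x%:C) = G x%:C) /\
  (forall tz (B ka : R), hdom tz -> 0 < ka ->
     (forall (j : 'I_4) (p r : R), p \in `[0, 1] -> 0 <= r ->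
        complex.Re (phase j p r tz) <= B - ka * r) ->
     nrm (W tz) <= 16 * nrm c * eta * M * expR B / (1 - expR (- (ka * eta)))).
Proof.
have rho1 (ka : R) : 0 < ka -> 0 <= expR (- (ka * eta)) < 1.
  by move=> ka1; rewrite expR_ge0/= expR_lt1 oppr_lt0 mulr_gt0.
pose A (B : R) := 16 * nrm c * eta * M * expR B.
have A0 B : 0 <= A B by rewrite !mulr_ge0 ?expR_ge0 ?nrm_ge0// ltW.
pose rho := expR (- (ka0 * eta)); have rr := rho1 _ ka00.
have cl := hclass_closed L0 T0 sT La' h'0.
have [W cW HW] := uniformly_closed_series cl (A0 B0) rr V_class
  (fun n i Di => V_le n Di ka00 (phase_le Di)).
(* Uniqueness of limits: a value approached by the partial sums at the rate rho ^+ N is that of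
   W. *)
have small (C : R) tz z : hdom tz ->
    (forall N, nrm (z - \sum_(n < N) V n tz) <= C * rho ^+ N) -> W tz = z.
  move=> Dtz Hz; apply: (nrm_small (K := 1)) => e e0.
  have [N HN] := geometric_lim (2 * A B0 / (1 - rho) + C) rr e0.
  rewrite mul1r; apply: le_trans HN.
  rewrite -(subrKA (\sum_(n < N) V n tz)); apply: le_trans (nrmD _ _) _.
  rewrite mulrDl lerD//; first by rewrite -[leRHS]mulrAC; exact: HW.
  by rewrite nrm_distC.
exists W => //; split.
- move=> x xL; have w0 := winding_neq0 a0 h0.
  have Dx : hdom (t0, x%:C) by exact: hdom_rect.
  have ck j := ccont_ckernel a0 h0 j (La_ xL).
  have /choice[Mk HMk] : forall j : 'I_4, exists M' : R, 0 < M' /\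
      forall p, p \in `[0, 1] -> nrm (ckernel a h x j p) <= M'.
    by move=> j; have [M' M'0 HM'] := ccont_bounded (ck j); exists M'.
  apply: (small ((\sum_j (2 * (M * Mk j * expR B0))) / nrm (winding a h))) => // N.
  have -> : \sum_(n < N) V n (t0, x%:C) = (tail x 0 - tail x N) / winding a h.
    elim: N => [|N IH]; first by rewrite big_ord0 subrr mul0r.
    by rewrite big_ord_recr/= IH V_tail// -mulrDl addrA subrK.
  have -> : tail x 0 = winding a h * G x%:C.
    rewrite -cauchyG//; apply: eq_bigr => j _; apply: eq_cint => p _.
    by rewrite /X mulr0 mul0r mul0r cexp0 mulr1.
  have -> : G x%:C - (winding a h * G x%:C - tail x N) / winding a h =
    tail x N / winding a h by field.
  rewrite nrmM nrmV mulrAC ler_wpM2r ?invr_ge0 ?nrm_ge0// mulr_suml.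
  apply: nrm_sum => j; rewrite -[leRHS]mulrA; apply: cint_le.
    by apply: ccontM; [exact: cGk|exact: cX].
  move=> p /subset_itv_oo_cc p1; rewrite nrmM nrmM -!mulrA.
  have [Mk0 HMkj] := HMk j.
  apply: ler_pM; rewrite ?mulr_ge0 ?nrm_ge0//; first exact: GM.
  apply: ler_pM; rewrite ?nrm_ge0//; first exact: HMkj.
  rewrite nrm_cexp /rho -expRM_natr -expRD ler_expR.
  have -> : (eta * N%:R)%:C * theta j * (zeta j p - x%:C) =
    phase j p (eta * N%:R) (t0, x%:C).
    by rewrite /phase/= subrr mulr0 mul0r addr0; ring.
  have N0 : 0 <= eta * N%:R by rewrite mulr_ge0// ltW.
  apply: le_trans (phase_le Dx j p1 N0) _.
  by rewrite mulNr mulrA.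
- move=> tz B ka Dtz ka1 Hph; apply/ler_addgt0Pr => e e0.
  have [N HN] := geometric_lim (2 * A B0 / (1 - rho)) rr e0.
  rewrite -(subrK (\sum_(n < N) V n tz) (W tz)) addrC.
  apply: le_trans (nrmD _ _) (lerD _ _); last first.
    apply: le_trans (HW tz Dtz N) _; rewrite -/rho -/(A B0) mulrAC.
    exact: HN.
  have /andP[r0 r1] := rho1 _ ka1; set r := expR (- _) in r0 r1 *.
  have r1' : 0 < 1 - r by rewrite subr_gt0.
  suff : nrm (\sum_(n < N) V n tz) <= A B / (1 - r) - A B * r ^+ N / (1 - r).
    move=> /le_trans; apply; rewrite lerBlDr lerDl divr_ge0 ?(ltW r1')//.
    by rewrite mulr_ge0 ?exprn_ge0.
  elim: N {HN} => [|N IH]; first by rewrite big_ord0 nrm0 mulr1 subrr.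
  rewrite big_ord_recr/=; apply: le_trans (nrmD _ _) (le_trans (lerD IH (V_le N Dtz ka1 Hph)) _).
  rewrite -/r -/(A B) exprS le_eqVlt; apply/orP; left; apply/eqP.
  by field; rewrite gt_eqF.
Qed.

End Superposition.

(** * Iteration *)

Section Neumann.
Context {R : realType}.
Variables (L a : R).
Hypotheses (L0 : 0 < L) (La : L < a).

(** Stands for analytic near the closed rhombus and bounded by M on its boundary; it constrains G on
    the contour and on [-L, L] only. *)
Definition cauchy_class (a h M : R) (G : R[i] -> R[i]) : Prop :=
  [/\ (forall j : 'I_4, ccont (fun p => G (zeta a h j p))),
      (forall (j : 'I_4) (p : R), p \in `[0, 1] -> nrm (G (zeta a h j p)) <= M) &
      (forall x : R, x \in `[- L, L] -> cauchy a h G x = winding a h * G x%:C)].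

Let a0 : 0 < a. Proof. exact: lt_trans La. Qed.

(** b < a leaves the margin a (a - b) to the backward step, and L < b the margin h (b - L) to the
    forward one. Any h strictly between 0 and b would do. *)
Let b : R := (L + a) / 2.
Let h : R := b / 2.

Let Lb : L < b. Proof. by rewrite /b; have := La; lra. Qed.
Let ba : b < a. Proof. by rewrite /b; have := La; lra. Qed.
Let b0 : 0 < b. Proof. exact: lt_trans Lb. Qed.
Let h0 : 0 < h. Proof. by rewrite divr_gt0. Qed.
Let hb : h < b. Proof. by rewrite /h; have := b0; lra. Qed.

Let Re_phase (c k : R) (j : 'I_4) (p r t t0 : R) (z : R[i]) :
  complex.Re (phase c k t0 j p r (t, z)) =
  - (r * complex.Re (theta c k j * (z - zeta c k j p))) +
  r ^+ 2 * (t - t0) * (k ^+ 2 - c ^+ 2).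
Proof.
rewrite /phase cReD [X in _ + X]cReM (Re_theta_sqr c k j) /= mul0r subr0.
congr (_ + _); rewrite -(opprK (_ * _)) -mulNr opprK -mulrA cReN; congr (- _).
by rewrite cReM/= mul0r subr0.
Qed.

(** When the quadratic part has the good sign it is dropped; the linear rate is the margin of z
    inside the rhombus. *)
Let phase_le0 (c k : R) (j : 'I_4) (p r t t0 kap : R) (z : R[i]) : 0 < c -> 0 < k -> 0 <= r ->
  kap <= c * k - k * `|complex.Re z| - c * `|complex.Im z| ->
  (t - t0) * (k ^+ 2 - c ^+ 2) <= 0 ->
  complex.Re (phase c k t0 j p r (t, z)) <= 0 - kap * r.
Proof.
move=> c0 k0 r0 H1 H2; rewrite Re_phase.
have K := le_trans H1 (Re_theta_zeta c0 k0 j p z).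
have := ler_wpM2l r0 K; have := ler_wpM2l (sqr_ge0 r) H2.
rewrite mulr0 mulrA; lra.
Qed.

(** C comes before T: on a square the quadratic part of the exponent has zero real part, so the rate
    kap ignores the times, and the rhombus (b, h) lies in S(b), at positive distance from the
    contour. *)
Lemma backward : exists2 C : R, 0 < C & forall T : R, 0 < T ->
  forall M G, 0 <= M -> cauchy_class a a M G -> exists2 W, hclass L T 0 b h W &
    (forall x : R, x \in `[- L, L] -> W (T, x%:C) = G x%:C) /\
    (forall tz, hdom L T 0 b h tz -> nrm (W tz) <= C * M).
Proof.
pose kap := a * (a - b); have kap0 : 0 < kap by rewrite mulr_gt0// subr_gt0.
pose c : R[i] := Complex 0 (a ^+ 2 + a ^+ 2) / winding a a.
have r1 : 0 < 1 - expR (- (kap * 1)) by rewrite subr_gt0 expR_lt1 oppr_lt0 mulr1.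
(* The bound of [superposition] with eta = 1 and B = 0; the added 1 makes it positive. *)
exists (16 * nrm c * 1 * expR 0 / (1 - expR (- (kap * 1))) + 1).
  by rewrite ltr_wpDl// divr_ge0 ?(ltW r1)// !mulr_ge0 ?nrm_ge0 ?expR_ge0.
move=> T T0 M G M0 [cG GM GC].
have T1 : 0 \in `[0, T] by rewrite in_itv/= lexx ltW.
have T2 : T \in `[0, T] by rewrite in_itv/= lexx ltW.
have ph tz : hdom L T 0 b h tz -> forall (j : 'I_4) (p r : R), p \in `[0, 1] ->
    0 <= r -> complex.Re (phase a a T j p r tz) <= 0 - kap * r.
  case: tz => t z Dtz j p r p1 r0; apply: phase_le0 => //; last by rewrite subrr mulr0.
  suff : `|complex.Re z| + `|complex.Im z| <= b.
    by move=> /(ler_wpM2l (ltW a0)); rewrite /kap; lra.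
  case: Dtz => [[_ [x xL /= ->]]|[_ [i [q [q1 /= ->]]]]].
    rewrite /= normr0 addr0 (le_trans _ (ltW Lb))// ler_norml.
    by move: xL; rewrite in_itv.
  move: (zeta b h i q) (rhombus_zeta b0 h0 i q1) => w /= H.
  rewrite -(ler_pM2l h0) mulrDr [leRHS]mulrC; apply: le_trans H.
  by rewrite lerD2l ler_wpM2r// ltW.
have [W cW [W1 W2]] := superposition L0 T0 T1 T2 Lb h0 La a0 ltr01 kap0 M0 cG GM GC ph.
exists W => //; split => // tz Dtz.
apply: le_trans (W2 tz 0 kap Dtz kap0 (ph tz Dtz)) _.
by rewrite -/c [leRHS]mulrDl [X in _ <= _ + X]mul1r; apply: ler_wpDr => //; rewrite le_eqVlt; apply/orP; left; apply/eqP; ring.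
Qed.

(** On the contour at time T the exponent is at most C0 r - g T r^2, whose exponential has an
    integral over r of order T^(-1/2). On the rectangle the points lie inside the rhombus and no
    largeness of T is involved. *)
Lemma forward (eps : R) : 0 < eps -> exists T : R, 0 < T /\ exists2 C : R, 0 < C &
  forall M G, 0 <= M -> cauchy_class b h M G -> exists2 W, hclass L T T a a W &
    [/\ (forall x : R, x \in `[- L, L] -> W (0, x%:C) = G x%:C),
        (forall t x : R, t \in `[0, T] -> x \in `[- L, L] -> nrm (W (t, x%:C)) <= C * M) &
        (forall (j : 'I_4) (p : R), p \in `[0, 1] -> nrm (W (T, zeta a a j p)) <= eps * M)].
Proof.
move=> eps0.
pose c : R[i] := Complex 0 (b ^+ 2 + h ^+ 2) / winding b h.
pose g := b ^+ 2 - h ^+ 2.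
have g0 : 0 < g by rewrite /g subr_gt0 ltr_pXn2r// nnegrE ltW.
(* Bounds h |x| + b |y| on S(a), hence the growth rate of the linear part. *)
pose C0 := a * h + a * b.
have C00 : 0 < C0 by rewrite addr_gt0// mulr_gt0.
have e1 : 0 < 1 - expR (- 1) :> R by rewrite subr_gt0 expR_lt1 oppr_lt0.
pose D := 16 * nrm c * expR g^-1 / (1 - expR (- 1)).
have D0 : 0 <= D by rewrite divr_ge0 ?(ltW e1)// !mulr_ge0 ?nrm_ge0 ?expR_ge0.
(* k is the decay rate imposed on the contour, the inverse of the step eta and the square root of T.
   Then (C0 + k)^2 / (4 g T) <= 1 / g since C0 <= k, and D / k <= eps. *)
pose k := C0 + D / eps.
have k0 : 0 < k by rewrite ltr_pwDl// divr_ge0// ltW.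
pose T := k ^+ 2; have T0 : 0 < T by rewrite exprn_gt0.
pose kap := h * (b - L); have kap0 : 0 < kap by rewrite mulr_gt0// subr_gt0.
have eta0 : 0 < k^-1 by rewrite invr_gt0.
have ek : 0 < 1 - expR (- (kap * k^-1)).
  by rewrite subr_gt0 expR_lt1 oppr_lt0 mulr_gt0.
exists T; split => //.
exists (16 * nrm c * k^-1 * expR 0 / (1 - expR (- (kap * k^-1))) + 1).
  by rewrite ltr_wpDl// divr_ge0 ?(ltW ek)// !mulr_ge0 ?nrm_ge0 ?expR_ge0 ?(ltW eta0).
move=> M G M0 [cG GM GC].
have T1 : 0 \in `[0, T] by rewrite in_itv/= lexx ltW.
have T2 : T \in `[0, T] by rewrite in_itv/= lexx ltW.
have phr t x : t \in `[0, T] -> x \in `[- L, L] -> forall (j : 'I_4) (p r : R),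
    p \in `[0, 1] -> 0 <= r -> complex.Re (phase b h 0 j p r (t, x%:C)) <= 0 - kap * r.
  rewrite !in_itv/= => /andP[t0 _] xL j p r p1 r0; apply: phase_le0 => //.
    rewrite /= normr0 mulr0 subr0 /kap.
    have : `|x| <= L by rewrite ler_norml.
    by move=> /(ler_wpM2l (ltW h0)); lra.
  by rewrite subr0 mulr_ge0_le0// subr_le0; move: g0; rewrite /g subr_gt0 => /ltW.
have phz (i : 'I_4) (q K : R) : q \in `[0, 1] -> 0 < K -> forall (j : 'I_4) (p r : R),
    p \in `[0, 1] -> 0 <= r ->
    complex.Re (phase b h 0 j p r (T, zeta a a i q)) <= (C0 + K) ^+ 2 / (4 * g * T) - K * r.
  move=> q1 K0 j p r p1 r0; rewrite Re_phase subr0.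
  have N : - C0 <= complex.Re (theta b h j * (zeta a a i q - zeta b h j p)).
    apply: le_trans (Re_theta_zeta b0 h0 j p _).
    move: (zeta a a i q) (rhombus_zeta a0 a0 i q1) => z; rewrite /rhombus/=.
    set u := complex.Re z; set v := complex.Im z; rewrite -mulrDr ler_pM2l// => H.
    have U : `|u| <= a by apply: le_trans H; rewrite lerDl.
    have V : `|v| <= a by apply: le_trans H; rewrite lerDr.
    have := ler_wpM2l (ltW h0) U; have := ler_wpM2l (ltW b0) V.
    have := mulr_gt0 b0 h0; rewrite /C0; lra.
  have := ler_wpM2l r0 N.
  have -> : h ^+ 2 - b ^+ 2 = - g by rewrite /g opprB.
  (* Completing the square trades the quadratic decay for any linear rate K, at the cost of a
     constant. *)
  have : 0 <= (C0 + K - 2 * g * T * r) ^+ 2 / (4 * g * T).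
    by rewrite divr_ge0 ?sqr_ge0// !mulr_ge0// ltW.
  have -> : (C0 + K - 2 * g * T * r) ^+ 2 / (4 * g * T) =
    (C0 + K) ^+ 2 / (4 * g * T) - (C0 + K) * r + g * T * r ^+ 2.
    by field; rewrite !gt_eqF.
  lra.
(* K = kap gives a rate common to the rectangle and the contour, for convergence; the size on the
   contour is read with K = k. *)
pose B0 := (C0 + kap) ^+ 2 / (4 * g * T).
have B00 : 0 <= B0 by rewrite divr_ge0 ?sqr_ge0// !mulr_ge0// ltW.
have ph tz : hdom L T T a a tz -> forall (j : 'I_4) (p r : R), p \in `[0, 1] ->
    0 <= r -> complex.Re (phase b h 0 j p r tz) <= B0 - kap * r.
  case: tz => t z [[tT [x xL /= ->]]|[/= -> [i [q [q1 ->]]]]] j p r p1 r0.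
    by apply: le_trans (phr _ _ tT xL j p r p1 r0) _; rewrite lerD2r.
  exact: phz.
have [W cW [W1 W2]] := superposition L0 T0 T2 T1 La a0 Lb h0 eta0 kap0 M0 cG GM GC ph.
exists W => //; split => //.
- move=> t x tT xL.
  apply: le_trans (W2 _ 0 kap (hdom_rect _ _ _ tT xL) kap0 (phr _ _ tT xL)) _.
  by rewrite -/c [leRHS]mulrDl [X in _ <= _ + X]mul1r; apply: ler_wpDr => //; rewrite le_eqVlt; apply/orP; left; apply/eqP; ring.
- move=> j p p1.
  apply: le_trans (W2 _ _ k (hdom_zeta _ _ _ _ _ _ p1) k0 (phz j p k p1 k0)) _.
  rewrite -/c mulfV ?gt_eqF//.
  have X : expR ((C0 + k) ^+ 2 / (4 * g * T)) <= expR g^-1.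
    rewrite ler_expR ler_pdivrMr ?mulr_gt0//.
    have -> : g^-1 * (4 * g * T) = (2 * k) ^+ 2 by rewrite /T; field; rewrite gt_eqF.
    have Ck : 0 <= C0 + k by apply: addr_ge0; exact: ltW.
    have k2 : 0 <= 2 * k by apply: mulr_ge0 => //; exact: ltW.
    rewrite ler_pXn2r ?nnegrE//.
    have : 0 <= D / eps by rewrite divr_ge0// ltW.
    by rewrite /k; lra.
  apply: le_trans (_ : D * k^-1 * M <= _).
    have -> : D * k^-1 * M = 16 * nrm c * k^-1 * M / (1 - expR (- 1)) * expR g^-1.
      by rewrite /D; ring.
    rewrite [leLHS]mulrAC; apply: ler_wpM2l X.
    by rewrite divr_ge0 ?(ltW e1)// !mulr_ge0 ?nrm_ge0 ?(ltW eta0).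
  rewrite ler_wpM2r// ler_pdivrMr//.
  rewrite /k mulrDr mulrCA divff ?gt_eqF// mulr1 lerDr.
  by apply: mulr_ge0; exact: ltW.
Qed.

End Neumann.

Section Iteration.
Context {R : realType}.
Variables (L a : R).
Hypotheses (L0 : 0 < L) (La : L < a).

(** The class used for the final sum: the condition on a time slice has been consumed by then. *)
Definition heat_pair (T : R) (U : R * R -> R[i]) : Prop :=
  heat L T (fun t x => complex.Re (U (t, x))) /\ heat L T (fun t x => complex.Im (U (t, x))).

Definition rectangle (T : R) : set (R * R) :=
  [set tx | tx.1 \in `[0, T] /\ tx.2 \in `[- L, L]].

Lemma heat_pair_comb T (c : R) U V : 0 < T -> heat_pair T U -> heat_pair T V ->
  heat_pair T (fun i => c%:C * U i + V i).
Proof.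
move=> T0 [u1 u2] [v1 v2]; split.
- apply: heat_ext (heat_comb L0 T0 c u1 v1) => t x.
  by rewrite cReD cReM/= mul0r subr0.
- apply: heat_ext (heat_comb L0 T0 c u2 v2) => t x.
  by rewrite cImD cImM/= mul0r addr0.
Qed.

Lemma heat_pair_closed T : 0 < T -> uniformly_closed (rectangle T) (heat_pair T).
Proof.
move=> T0; have K0 : heat_pair T (fun=> 0) by split; exact: heat0.
split=> //.
- move=> f g cf cg; have := heat_pair_comb 1 T0 cf cg.
  by under [fun i => _]funext => i do rewrite mul1r.
- move=> c f cf; have := heat_pair_comb c T0 cf K0.
  by under [fun i => _]funext => i do rewrite addr0.
- move=> U H; split; apply: heat_lim => // e /H[V [v1 v2] UV].
  + exists (fun t x => complex.Re (V (t, x))) => // t x tT xL.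
    by rewrite -cReN -cReD; apply: le_trans (Re_le _) (UV (t, x) _).
  + exists (fun t x => complex.Im (V (t, x))) => // t x tT xL.
    by rewrite -cImN -cImD; apply: le_trans (Im_le _) (UV (t, x) _).
Qed.

(** U is the backward solution minus the forward one, G' the final state of the latter. The bound on
    G over [-L, L], read off the backward solution, turns smallness on the contour into smallness on
    the interval. *)
Lemma reach_up_to_half : exists T : R, 0 < T /\ exists2 C : R, 0 < C &
  forall (M : R) G, 0 <= M -> cauchy_class L a a M G ->
  exists U G', [/\ heat_pair T U,
    (forall x : R, x \in `[- L, L] -> U (0, x) = 0 /\ U (T, x) = G x%:C - G' x%:C),
    (forall tx, rectangle T tx -> nrm (U tx) <= C * M),
    (forall x : R, x \in `[- L, L] -> nrm (G x%:C) <= C * M) &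
    cauchy_class L a a (M / 2) G'].
Proof.
have [C1 C10 back] := backward L0 La.
(* The forward step receives data of size C1 * M, so this factor returns M / 2. *)
have e0 : 0 < (2 * C1)^-1 by rewrite invr_gt0 mulr_gt0.
have [T [T0 [C2 C20 forw]]] := forward L0 La e0.
exists T; split=> //; exists (C1 + C2 * C1); first by rewrite addr_gt0// mulr_gt0.
have T1 : 0 \in `[0, T] by rewrite in_itv/= lexx ltW.
have T2 : T \in `[0, T] by rewrite in_itv/= lexx ltW.
move=> M G M0 cG.
have [W hW [WG WM]] := back T T0 M G M0 cG; have [w1 w2 w3 w4] := hW.
have CM : 0 <= C1 * M by rewrite mulr_ge0// ltW.
have cW : cauchy_class L ((L + a) / 2) ((L + a) / 2 / 2) (C1 * M) (fun z => W (0, z)).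
  by split=> // j p p1; apply: WM; exact: hdom_zeta.
have [Z hZ [ZW ZM Zs]] := forw _ _ CM cW; have [z1 z2 z3 z4] := hZ.
exists (fun tx => (-1)%:C * Z (tx.1, tx.2%:C) + W (tx.1, tx.2%:C)), (fun z => Z (T, z)).
have m1 : (-1)%:C = -1 :> R[i] by rewrite rmorphN1.
split.
- by apply: (@heat_pair_comb T (-1) (fun tx => Z (tx.1, tx.2%:C)) (fun tx => W (tx.1, tx.2%:C))).
- move=> x xL; rewrite /= m1 !mulN1r ZW// WG//; split; first by rewrite addrC subrr.
  by rewrite addrC.
- move=> [t x] [/= tT xL]; rewrite m1 mulN1r addrC mulrDl.
  apply: le_trans (nrmB _ _) (lerD _ _).
    by apply: WM; exact: hdom_rect.
  by rewrite -mulrA; exact: ZM.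
- move=> x xL; rewrite -WG//; apply: le_trans (WM _ (hdom_rect _ _ _ T2 xL)) _.
  by rewrite ler_wpM2r// lerDl mulr_ge0// ltW.
- split=> // j p p1; apply: le_trans (Zs j p p1) _.
  by rewrite le_eqVlt; apply/orP; left; apply/eqP; field; rewrite gt_eqF.
Qed.

(** T and C do not depend on the target, so the step can be repeated on its own error with the same
    T and the solutions added. *)
Lemma reach_cauchy_class : exists2 T : R, 0 < T &
  forall (M : R) G, 0 <= M -> cauchy_class L a a M G ->
  exists2 U, heat_pair T U &
    forall x : R, x \in `[- L, L] -> U (0, x) = 0 /\ U (T, x) = G x%:C.
Proof.
have [T [T0 [C C0 step]]] := reach_up_to_half; exists T => // M G M0 cG.
have T1 : 0 \in `[0, T] by rewrite in_itv/= lexx ltW.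
have T2 : T \in `[0, T] by rewrite in_itv/= lexx ltW.
(* The step becomes a total function of (M, G), with a dummy value where its hypotheses fail, so
   that the recursion is a plain fixpoint. *)
have /choice[f Hf] : forall MG : R * (R[i] -> R[i]), exists UG : (R * R -> R[i]) * (R[i] -> R[i]),
    0 <= MG.1 -> cauchy_class L a a MG.1 MG.2 -> [/\ heat_pair T UG.1,
    (forall x : R, x \in `[- L, L] -> UG.1 (0, x) = 0 /\ UG.1 (T, x) = MG.2 x%:C - UG.2 x%:C),
    (forall tx, rectangle T tx -> nrm (UG.1 tx) <= C * MG.1),
    (forall x : R, x \in `[- L, L] -> nrm (MG.2 x%:C) <= C * MG.1) &
    cauchy_class L a a (MG.1 / 2) UG.2].
  move=> [M' G']; have [[M'0 cG']|N] := pselect (0 <= M' /\ cauchy_class L a a M' G').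
    by have [U [G'' HU]] := step M' G' M'0 cG'; exists (U, G'').
  by exists (fun=> 0, G') => /= h1 h2; case: N.
pose Ms n : R := M * 2^-1 ^+ n.
(* The part of G still to be reached after n steps, bounded by M / 2^n on the contour. *)
pose Gs := fix F n := if n is k.+1 then (f (Ms k, F k)).2 else G.
have Ms0 n : 0 <= Ms n by rewrite mulr_ge0// exprn_ge0// invr_ge0.
have cGs n : cauchy_class L a a (Ms n) (Gs n).
  elim: n => [|n IH]; first by rewrite /Ms expr0 mulr1.
  by have [_ _ _ _] := Hf (Ms n, Gs n) (Ms0 n) IH; rewrite /Ms/= exprSr mulrA.
pose Us n := (f (Ms n, Gs n)).1.
have HU n := Hf (Ms n, Gs n) (Ms0 n) (cGs n).
have rr : 0 <= (2^-1 : R) < 1 by lra.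
have CM : 0 <= C * M by rewrite mulr_ge0// ltW.
have KU n : heat_pair T (Us n) by have [] := HU n.
have BU n tx : rectangle T tx -> nrm (Us n tx) <= C * M * 2^-1 ^+ n.
  by move=> Dtx; have [_ _ /(_ tx Dtx)] := HU n; rewrite /= mulrA.
have [U hU UE] := uniformly_closed_series (heat_pair_closed T0) CM rr KU BU.
exists U => // x xL.
have small z t : rectangle T (t, x) -> (exists A, forall N,
    nrm (z - \sum_(n < N) Us n (t, x)) <= A * 2^-1 ^+ N) -> U (t, x) = z.
  move=> Dtx [A HA]; apply: (nrm_small (K := 1)) => e e0.
  have [N HN] := geometric_lim (2 * (C * M) / (1 - 2^-1) + A) rr e0.
  rewrite mul1r; apply: le_trans HN; rewrite -(subrKA (\sum_(n < N) Us n (t, x))).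
  apply: le_trans (nrmD _ _) _; rewrite mulrDl; apply: lerD.
    by rewrite -[leRHS]mulrAC; exact: UE.
  by rewrite nrm_distC.
split.
- apply: small => //; exists 0 => N; rewrite mul0r sub0r nrmN big1 ?nrm0// => n _.
  by have [_ /(_ x xL)[+ _] _ _ _] := HU n.
- apply: small => //; exists (C * M) => N.
  have -> : \sum_(n < N) Us n (T, x) = G x%:C - Gs N x%:C.
    elim: N => [|N IH]; first by rewrite big_ord0 subrr.
    rewrite big_ord_recr/= IH; have [_ /(_ x xL)[_ E] _ _ _] := HU N.
    by rewrite /Us E/= addrA subrK.
  rewrite opprB addrC subrK; have [_ _ _ /(_ x xL) K _] := HU N.
  by rewrite -mulrA.
Qed.

End Iteration.

(** * Analytic functions *)

Section Analytic.
Context {R : realType}.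

Lemma cvg_nrm (S : nat -> R[i]) (l : R[i]) :
  ((S : nat -> R[i]^o) @ \oo --> (l : R[i]^o)) ->
  forall e : R, 0 < e -> exists N : nat, forall n, (N <= n)%N -> nrm (l - S n) <= e.
Proof.
move=> /cvgrPdist_le H e e0; have e0' : 0 < e%:C :> R[i] by rewrite ltcR.
have [N _ HN] := H _ e0'; exists N => n Nn.
by have := HN n Nn; rewrite /= normC_nrm lecR.
Qed.

Lemma nrmX (z : R[i]) n : nrm (z ^+ n) = nrm z ^+ n.
Proof.
elim: n => [|n IH]; first by rewrite !expr0 (nrm_C 1) normr1.
by rewrite !exprS nrmM IH.
Qed.

Lemma nrm_pow_sub (z w : R[i]) (d : R) n : nrm z <= d -> nrm w <= d ->
  nrm (w ^+ n.+1 - z ^+ n.+1) <= n.+1%:R * d ^+ n * nrm (w - z).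
Proof.
move=> zd wd; have d0 : 0 <= d by apply: le_trans zd; exact: nrm_ge0.
have zn k : nrm (z ^+ k) <= d ^+ k.
  by rewrite nrmX lerXn2r ?nnegrE ?nrm_ge0.
elim: n => [|n IH]; first by rewrite !expr1 expr0 !mul1r.
have -> : w ^+ n.+2 - z ^+ n.+2 = w * (w ^+ n.+1 - z ^+ n.+1) + (w - z) * z ^+ n.+1.
  by rewrite (exprS w n.+1) (exprS z n.+1); ring.
apply: le_trans (nrmD _ _) _; rewrite !nrmM.
apply: le_trans (lerD (ler_pM (nrm_ge0 _) (nrm_ge0 _) wd IH)
  (ler_wpM2l (nrm_ge0 _) (zn n.+1))) _.
by rewrite -(natr1 n.+1) exprS le_eqVlt; apply/orP; left; apply/eqP; ring.
Qed.

(** Only the centre of the series is treated: every point of the domain is the centre of its own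
    expansion. The terms of order 2 and more are Lipschitz near z0 with a small constant. *)
Lemma power_series_sdiff (F : R[i] -> R[i]) (z0 : R[i]) (a : nat -> R[i]) (r : R) :
  0 < r -> (forall z : R[i], `|z - z0| < r%:C ->
    ((fun N => \sum_(0 <= n < N) a n * (z - z0) ^+ n : R[i]^o) @ \oo --> (F z : R[i]^o))) ->
  sdiff F (a 1%N) z0.
Proof.
move=> r0 HF; pose S z N := \sum_(n < N) a n * (z - z0) ^+ n.
have HS z : nrm (z - z0) < r -> forall e : R, 0 < e -> exists N : nat,
    forall n, (N <= n)%N -> nrm (F z - S z n) <= e.
  move=> zr; have zr' : `|z - z0| < r%:C by rewrite normC_nrm ltcR.
  move=> e e0; have [N HN] := cvg_nrm (HF z zr') e0; exists N => n /HN.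
  by rewrite /S big_mkord.
pose rho := r / 2; have rho0 : 0 < rho by rewrite divr_gt0.
(* A term at z0 + rho is a difference of two partial sums, both within 1 of F from index N on, hence
   the 2; the sum covers the smaller indices. *)
have [M M0 HM] : exists2 M : R, 0 < M & forall n, nrm (a n) * rho ^+ n <= M.
  have zr : nrm (z0 + rho%:C - z0) < r.
    by rewrite addrAC subrr add0r nrm_C gtr0_norm// /rho ltr_pdivrMr// ltr_pMr// ltr1n.
  have [N HN] := HS _ zr 1 ltr01.
  have t n : nrm (a n) * rho ^+ n = nrm (S (z0 + rho%:C) n.+1 - S (z0 + rho%:C) n).
    rewrite /S; have -> : z0 + rho%:C - z0 = rho%:C by ring.
    rewrite big_ord_recr/= addrAC subrr add0r.
    by rewrite nrmM nrmX nrm_C gtr0_norm.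
  exists (2 + \sum_(n < N) nrm (a n) * rho ^+ n).
    by rewrite ltr_pwDl// sumr_ge0// => n _; rewrite mulr_ge0 ?nrm_ge0 ?exprn_ge0// ltW.
  have P n : 0 <= nrm (a n) * rho ^+ n by rewrite mulr_ge0 ?nrm_ge0 ?exprn_ge0// ltW.
  move=> n; have [nN|Nn] := ltnP n N.
    rewrite (bigD1 (Ordinal nN))//= addrCA lerDl addr_ge0// sumr_ge0// => i _.
  apply: ler_wpDr; first by apply: sumr_ge0.
  rewrite t; set f := F (z0 + rho%:C) in HN.
  have -> : forall x y : R[i], x - y = (f - y) - (f - x) by move=> x y; ring.
  apply: le_trans (nrmB _ _) _.
  by rewrite -[2]/(1 + 1) lerD// HN// leqW.
(* The radius is rho * x: x <= 1/4 makes the ratio 2 x at most 1/2, and the second bound makes the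
   total M / rho * 4 x at most e. *)
move=> e e0; pose x := Num.min 4^-1 (e * rho / (4 * M)).
have x0 : 0 < x by rewrite lt_min invr_gt0 ltr0n/= divr_gt0// mulr_gt0.
have x4 : x <= 4^-1 by rewrite ge_min lexx.
have xe : x <= e * rho / (4 * M) by rewrite ge_min lexx orbT.
exists (rho * x); first exact: mulr_gt0.
move=> z w zd wd.
have dr : rho * x < r.
  have : x < 2 by apply: le_lt_trans x4 _; lra.
  by rewrite /rho mulrAC ltr_pdivrMr// ltr_pM2l.
have Bn n : nrm (a n.+2 * (w - z0) ^+ n.+2 - a n.+2 * (z - z0) ^+ n.+2) <=
    nrm (w - z) * (M / rho * (2 * x) * 2^-1 ^+ n).
  rewrite -mulrBr nrmM; have := nrm_pow_sub n.+1 (ltW zd) (ltW wd).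
  have -> : w - z0 - (z - z0) = w - z by ring.
  move=> H; apply: le_trans (ler_wpM2l (nrm_ge0 _) H) _.
  rewrite [leRHS]mulrC mulrA; apply: ler_wpM2r; first exact: nrm_ge0.
  rewrite exprMn.
  have -> : nrm (a n.+2) * (n.+2%:R * (rho ^+ n.+1 * x ^+ n.+1)) =
    nrm (a n.+2) * rho ^+ n.+2 / rho * (n.+2%:R * x ^+ n.+1).
    by rewrite (exprSr rho n.+1); field; rewrite gt_eqF.
  rewrite -[leRHS]mulrA; apply: ler_pM.
  - apply: divr_ge0; last exact: ltW.
    by apply: mulr_ge0; [exact: nrm_ge0|apply: exprn_ge0; exact: ltW].
  - by apply: mulr_ge0 => //; apply: exprn_ge0; exact: ltW.
  - by rewrite ler_wpM2r ?invr_ge0 ?(ltW rho0).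
  (* The factor n + 2 from the difference of powers is absorbed by doubling x. *)
  have n2 : n.+2%:R <= 2 ^+ n.+1 :> R.
    by rewrite -natrX ler_nat ltn_expl.
  apply: le_trans (_ : (2 * x) ^+ n.+1 <= _).
    by rewrite exprMn ler_wpM2r ?exprn_ge0 ?(ltW x0).
  rewrite exprS ler_wpM2l ?mulr_ge0 ?(ltW x0)//.
  rewrite lerXn2r ?nnegrE ?mulr_ge0 ?invr_ge0 ?(ltW x0)//.
  by have := x4; lra.
have SN N : nrm (S w N.+2 - S z N.+2 - a 1%N * (w - z)) <=
    nrm (w - z) * (M / rho * (4 * x)).
  (* 2 - 2 / 2^N is the partial geometric sum, kept exact for the induction. *)
  suff H : nrm (S w N.+2 - S z N.+2 - a 1%N * (w - z)) <=
      nrm (w - z) * (M / rho * (2 * x) * (2 - 2 * 2^-1 ^+ N)).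
    apply: le_trans H _; apply: ler_wpM2l; first exact: nrm_ge0.
    have -> : M / rho * (4 * x) = M / rho * (2 * x) * 2 by ring.
    apply: ler_wpM2l; first by rewrite !mulr_ge0 ?invr_ge0 ?(ltW M0) ?(ltW rho0) ?(ltW x0).
    by rewrite gerBl mulr_ge0// exprn_ge0// invr_ge0.
  elim: N => [|N IH].
    rewrite expr0 mulr1 subrr mulr0 mulr0 /S !big_ord_recr !big_ord0/= !expr0 !expr1.
    by rewrite (_ : _ - _ - _ = 0) ?nrm0//; ring.
  have -> : S w N.+3 - S z N.+3 - a 1%N * (w - z) =
    (S w N.+2 - S z N.+2 - a 1%N * (w - z)) +
    (a N.+2 * (w - z0) ^+ N.+2 - a N.+2 * (z - z0) ^+ N.+2).
    by rewrite /S (big_ord_recr N.+2)/= [\sum_(i < N.+3) a i * (z - z0) ^+ i]big_ord_recr/=; ring.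
  apply: le_trans (nrmD _ _) (le_trans (lerD IH (Bn N)) _).
  by rewrite exprS le_eqVlt; apply/orP; left; apply/eqP; field; rewrite gt_eqF.
have fin : nrm (w - z) * (M / rho * (4 * x)) <= e * nrm (w - z).
  rewrite mulrC; apply: ler_wpM2r; first exact: nrm_ge0.
  apply: le_trans (_ : M / rho * (4 * (e * rho / (4 * M))) <= _).
    apply: ler_wpM2l; first by apply: divr_ge0; exact: ltW.
    exact: ler_wpM2l.
  by rewrite le_eqVlt; apply/orP; left; apply/eqP; field; rewrite !gt_eqF.
apply: le_trans fin; apply/ler_addgt0Pr => f f0.
have f2 : 0 < f / 2 by rewrite divr_gt0.
have [N1 H1] := HS z (lt_trans zd dr) _ f2.
have [N2 H2] := HS w (lt_trans wd dr) _ f2.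
pose N := maxn N1 N2.
have -> : F w - F z - a 1%N * (w - z) = (S w N.+2 - S z N.+2 - a 1%N * (w - z)) +
  ((F w - S w N.+2) - (F z - S z N.+2)) by ring.
apply: le_trans (nrmD _ _) (lerD (SN N) _).
rewrite [f]splitr; apply: le_trans (nrmB _ _) (lerD _ _).
  by apply: H2; apply: (leq_trans (leq_maxr N1 N2)); rewrite -/N -addn2 leq_addr.
by apply: H1; apply: (leq_trans (leq_maxl N1 N2)); rewrite -/N -addn2 leq_addr.
Qed.

Lemma analytic_on_sdiff (D : set R[i]) (F : R[i] -> R[i]) : analytic_on D F ->
  exists F' : R[i] -> R[i], forall z, D z -> sdiff F (F' z) z.
Proof.
move=> HF; have /choice[F' HF'] : forall z, exists l, D z -> sdiff F l z.
  move=> z; have [Dz|] := pselect (D z); last by exists 0.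
  by have [a [r [r0 H]]] := HF z Dz; exists (a 1%N) => _; exact: power_series_sdiff H.
by exists F'.
Qed.

End Analytic.

(** * Reachability *)

Section Transposition.
Context {R : realType}.
Local Notation mu := (@lebesgue_measure R).
Implicit Types (f g phi psi : R -> R).

Lemma cont_measurable (a b : R) f : cont a b f -> measurable_fun `]a, b[ f.
Proof. by move=> /cont_integrable /measurable_int /measurable_EFinP. Qed.

Lemma cont_L2 (a b : R) f : cont a b f -> L2 a b f.
Proof.
move=> cf; rewrite /L2 inE; apply/andP; split; rewrite inE/=.
  exact: (iffLR (measurable_restrictT f (measurable_itv `]a, b[)) (cont_measurable cf)).
rewrite /finite_norm unlock /=; apply: poweR_lty.
have /integrableP[_] := cont_integrable (contM cf cf).
rewrite integral_mkcond; apply: le_lt_trans; rewrite le_eqVlt; apply/orP; left.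
apply/eqP; apply: eq_integral => x _; rewrite /restrict/= /patch.
by case: ifPn => xD; rewrite /= powR_mulrn// ?normrM ?expr2// normr0 mulr0.
Qed.

Lemma L2_measurable (a b : R) f : L2 a b f -> measurable_fun `]a, b[ f.
Proof.
rewrite /L2 inE => /andP[]; rewrite inE/= => mf _.
exact: (iffRL (measurable_restrictT f (measurable_itv `]a, b[)) mf).
Qed.

(** Hoelder against the constant 1 on a bounded interval. *)
Lemma L2_integrable (a b : R) g : L2 a b g -> mu.-integrable setT (EFin \o (g \_ `]a, b[)).
Proof.
move=> g2; have := Lfun2_mul_Lfun1 g2 (cont_L2 (@cont_cst R a b 1)).
move=> /Lfun1_integrable; congr (_.-integrable _ (EFin \o _)).
by apply/funext => x /=; rewrite /patch; case: ifPn => _; rewrite ?mulr1 ?mulr0.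
Qed.

Variable L : R.
Hypothesis L0 : 0 < L.

Let LL : - L <= L. Proof. by rewrite ge0_cp ?ltW. Qed.

Lemma H10_cont phi g : H10 L phi g -> cont (- L) L phi.
Proof.
move=> [g2 phiE _]; have ig := L2_integrable g2; set g0 := g \_ _ in ig.
have igS (A : set R) : measurable A -> mu.-integrable A (EFin \o g0).
  by move=> mA; exact: integrableS ig.
have := parameterized_integral_continuous LL (igS _ (measurable_itv `[- L, L])).
apply: eq_cont => x xL; rewrite phiE// /parameterized_integral.
rewrite -(@Rintegral_itv_obnd_cbnd _ (- L) (BRight x)); last exact: igS.
rewrite -(@Rintegral_itv_bndo_bndc _ (BRight (- L)) x); last exact: igS.
apply: eq_Rintegral => y; rewrite inE /= in_itv/= => /andP[y1 y2].
rewrite /g0 patchE mem_set//= in_itv/= y1/=; apply: lt_le_trans y2 _.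
by move: xL; rewrite in_itv/= => /andP[].
Qed.

Lemma H10_norm_ge0 g : 0 <= H10_norm L g.
Proof. exact: sqrtr_ge0. Qed.

(** Embedding of H^1_0 into bounded functions. The constant comes from s = [H10_norm L g] in [key],
    where s * L + N2 / (2 * s) becomes L + 1/2 times the norm. *)
Lemma H10_le phi g x : H10 L phi g -> x \in `[- L, L] ->
  `|phi x| <= (L + 2^-1) * H10_norm L g.
Proof.
move=> [g2 phiE _] xL; have ig := L2_integrable g2.
have isq := Lfun2_integrable_sqr g2; set g0 := g \_ _ in ig isq.
have igS (A : set R) : measurable A -> mu.-integrable A (EFin \o g0).
  by move=> mA; exact: integrableS ig.
have isqS (A : set R) : measurable A -> mu.-integrable A (EFin \o (fun x => g0 x ^+ 2)).
  by move=> mA; exact: integrableS isq.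
have /andP[x1 x2] : - L <= x <= L by move: xL; rewrite in_itv.
have g0E y : y \in `]- L, L[ -> g0 y = g y by move=> yL; rewrite /g0 patchE mem_set.
have sub : `]- L, x[ `<=` `]- L, L[ by apply: subset_itvl; rewrite bnd_simp.
pose N2 := (\int[mu]_(y in `]- L, L[) (g y ^+ 2))%R.
have N20 : 0 <= N2 by apply: Rintegral_ge0 => y _; exact: sqr_ge0.
have NE : H10_norm L g ^+ 2 = N2 by rewrite sqr_sqrtr.
(* AM-GM: |g| <= s / 2 + g ^ 2 / (2 s). *)
have key s : 0 < s -> `|phi x| <= s * L + N2 / (2 * s).
  move=> s0; rewrite phiE//.
  have -> : (\int[mu]_(y in `]- L, x[) g y = \int[mu]_(y in `]- L, x[) g0 y)%R.
    by apply: eq_Rintegral => y; rewrite inE => /sub yL; rewrite g0E.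
  apply: le_trans (le_normr_Rintegral _ _) _ => //; first exact: igS.
  have ic : mu.-integrable `]- L, x[ (EFin \o (fun=> s / 2)).
    by apply: cont_integrable; exact: cont_cst.
  have iq : mu.-integrable `]- L, x[ (EFin \o (fun y => (2 * s)^-1 * g0 y ^+ 2)).
    by have := integrableZl _ (2 * s)^-1 (isqS _ (measurable_itv `]- L, x[)); exact.
  apply: (@le_trans _ _ (\int[mu]_(y in `]- L, x[) (s / 2 + (2 * s)^-1 * g0 y ^+ 2))%R).
    apply: le_Rintegral => //.
    - by have := integrable_norm (igS _ (measurable_itv `]- L, x[)); exact.
    - by have := integrableD _ ic iq; exact.
    move=> y _; rewrite -(real_normK (num_real (g0 y))).
    move: `|g0 y| => v; rewrite -subr_ge0.
    have -> : s / 2 + (2 * s)^-1 * v ^+ 2 - v = (s - v) ^+ 2 / (2 * s).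
      by field; rewrite gt_eqF.
    by rewrite divr_ge0 ?sqr_ge0// mulr_ge0// ltW.
  have EZ : (\int[mu]_(y in `]- L, x[) ((2 * s)^-1 * g0 y ^+ 2) =
      (2 * s)^-1 * \int[mu]_(y in `]- L, x[) (g0 y ^+ 2))%R.
    by apply: RintegralZl => //; exact: isqS.
  rewrite RintegralD// EZ.
  apply: lerD.
    have -> : (\int[mu]_(y in `]- L, x[) (s / 2))%R = RI (- L) x (fun=> s / 2) by [].
    rewrite RI_cst// mulrCA ler_pM2l// ler_pdivrMr//; lra.
  rewrite [leRHS]mulrC ler_wpM2l ?invr_ge0 ?mulr_ge0 ?(ltW s0)//.
  have -> : N2 = (\int[mu]_(y in `]- L, L[) (g0 y ^+ 2))%R.
    by apply: eq_Rintegral => y; rewrite inE => yL; rewrite g0E.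
  rewrite /Rintegral fine_le ?integrable_fin_num//; [exact: isqS|exact: isqS|].
  apply: ge0_subset_integral => //.
  - have := isqS _ (measurable_itv `]- L, L[); exact: measurable_int.
  - by move=> y _; rewrite lee_fin sqr_ge0.
(* If the norm is 0 that s is excluded; s is sent to 0 instead. *)
have [N0|Nn] := eqVneq (H10_norm L g) 0.
  rewrite N0 mulr0; move: key; rewrite -NE N0 expr0n/=.
  move=> key; apply/ler_addgt0Pr => e e0; rewrite add0r.
  apply: le_trans (key (e / L) (divr_gt0 e0 L0)) _.
  by rewrite mul0r addr0 divfK// gt_eqF.
have Np : 0 < H10_norm L g by rewrite lt_def Nn H10_norm_ge0.
apply: le_trans (key _ Np) _; rewrite -NE le_eqVlt; apply/orP; left; apply/eqP.
by field.
Qed.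

Lemma pairing_le (v phi g : R -> R) (e : R) : 0 <= e -> H10 L phi g -> cont (- L) L v ->
  (forall x, x \in `[- L, L] -> `|v x| <= e) ->
  `|RI (- L) L (fun x => v x * phi x)| <= (L - - L) * (e * ((L + 2^-1) * H10_norm L g)).
Proof.
move=> e0 hphi cv ve; apply: RI_le => //; first by apply: contM => //; exact: H10_cont hphi.
move=> x /subset_itv_oo_cc xL; rewrite normrM; apply: ler_pM => //; first exact: ve.
exact: H10_le hphi xL.
Qed.

Lemma functional_of_RI (w : R -> R[i]) phi : functional_of L w phi =
  Complex (RI (- L) L (fun x => complex.Re (w x) * phi x))
          (RI (- L) L (fun x => complex.Im (w x) * phi x)).
Proof.
rewrite /functional_of /intC; congr Complex; apply: eq_RI => x _.
- by rewrite cReM/= mulr0 subr0.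
- by rewrite cImM/= mulr0 add0r.
Qed.

Lemma functional_of_le (w : R -> R[i]) phi g (e : R) : 0 <= e -> H10 L phi g ->
  cont (- L) L (fun x => complex.Re (w x)) -> cont (- L) L (fun x => complex.Im (w x)) ->
  (forall x, x \in `[- L, L] -> nrm (w x) <= e) ->
  `|functional_of L w phi| <= (4 * L * (L + 2^-1) * e * H10_norm L g)%:C.
Proof.
move=> e0 hphi c1 c2 we; rewrite normC_nrm lecR functional_of_RI.
apply: le_trans (nrm_le _) _; rewrite [complex.Re _]/= [complex.Im _]/=.
have H1 := pairing_le e0 hphi c1 (fun x xL => le_trans (Re_le _) (we x xL)).
have H2 := pairing_le e0 hphi c2 (fun x xL => le_trans (Im_le _) (we x xL)).
by apply: le_trans (lerD H1 H2) _; rewrite le_eqVlt; apply/orP; left; apply/eqP; ring.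
Qed.

Lemma functional_of_sub (w v : R -> R[i]) phi g : H10 L phi g ->
  cont (- L) L (fun x => complex.Re (w x)) -> cont (- L) L (fun x => complex.Im (w x)) ->
  cont (- L) L (fun x => complex.Re (v x)) -> cont (- L) L (fun x => complex.Im (v x)) ->
  functional_of L w phi - functional_of L v phi =
  functional_of L (fun x => w x - v x) phi.
Proof.
move=> hphi w1 w2 v1 v2; have cp := H10_cont hphi.
rewrite !functional_of_RI; apply: complex_ext; rewrite ?cReD ?cImD ?cReN ?cImN/=.
- rewrite -RIB; [|exact: contM|exact: contM].
  by apply: eq_RI => x _; rewrite cReD cReN; ring.
- rewrite -RIB; [|exact: contM|exact: contM].
  by apply: eq_RI => x _; rewrite cImD cImN; ring.
Qed.

(** With zero initial state, [green] for both components is the transposition identity with the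
    boundary traces as controls. Uniform continuity on the rectangle gives continuity into H^{-1}
    through the sup bound on H^1_0. *)
Lemma heat_pair_reachable (T : R) (U : R * R -> R[i]) : 0 < T ->
  heat_pair L T U -> (forall x, x \in `[- L, L] -> U (0, x) = 0) ->
  reachable L (functional_of L (fun x => U (T, x))).
Proof.
move=> T0 [hr hi] U0; exists T => //.
have [L1 L2'] : - L \in `[- L, L] /\ L \in `[- L, L] by rewrite !in_itv/= !lexx LL.
have Tz : 0 \in `[0, T] by rewrite in_itv/= lexx ltW.
exists (fun t => U (t, - L)), (fun t => U (t, L)), (fun t => functional_of L (fun x => U (t, x))).
have row t : t \in `[0, T] -> cont (- L) L (fun x => complex.Re (U (t, x))) /\
    cont (- L) L (fun x => complex.Im (U (t, x))).
  by move=> tT; split; [exact: heat_row hr tT|exact: heat_row hi tT].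
have col x : x \in `[- L, L] -> L2C 0 T (fun t => U (t, x)).
  move=> xL; split; apply: cont_L2.
  - exact: (heat_col hr (lexx T) xL).
  - exact: (heat_col hi (lexx T) xL).
split => //; [exact: col|exact: col|split].
- move=> t tT; have [c1 c2] := row t tT; split.
    move=> a phi g psi k hphi hpsi.
    have cp := H10_cont hphi; have cq := H10_cont hpsi.
    rewrite !functional_of_RI; apply: complex_ext;
      rewrite ?cReD ?cImD ?cReM ?cImM/= ?mul0r ?subr0 ?addr0.
    - rewrite -RIZ; last exact: contM.
      rewrite -RID; [|by apply: contM; [exact: cont_cst|exact: contM]|exact: contM].
      by apply: eq_RI => x _; ring.
    - rewrite -RIZ; last exact: contM.
      rewrite -RID; [|by apply: contM; [exact: cont_cst|exact: contM]|exact: contM].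
      by apply: eq_RI => x _; ring.
  have [B1 H1] := cont_bounded LL c1; have [B2 H2] := cont_bounded LL c2.
  have B0 : 0 <= B1 + B2.
    by rewrite addr_ge0//; [apply: le_trans (H1 L L2')|apply: le_trans (H2 L L2')].
  exists (4 * L * (L + 2^-1) * (B1 + B2)) => phi g hphi.
  apply: functional_of_le hphi c1 c2 _ => // x xL.
  by apply: le_trans (nrm_le _) (lerD (H1 x xL) (H2 x xL)).
- move=> t0 t0T eps eps0.
  (* K is the constant of [functional_of_le]; the tolerance is shared between the two components. *)
  pose K := 4 * L * (L + 2^-1); have K0 : 0 < K by rewrite !mulr_gt0// addr_gt0.
  have e0 : 0 < eps / K / 2 by rewrite !divr_gt0.
  have [d1 d10 H1] := hr.1 _ e0; have [d2 d20 H2] := hi.1 _ e0.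
  exists (Num.min d1 d2); first by rewrite lt_min d10.
  move=> t tT; rewrite lt_min => /andP[td1 td2] phi g hphi.
  have [c1 c2] := row t tT; have [c3 c4] := row t0 t0T.
  rewrite (functional_of_sub hphi c1 c2 c3 c4).
  have -> : eps * H10_norm L g = K * (eps / K) * H10_norm L g by field; rewrite gt_eqF.
  apply: (functional_of_le _ hphi).
  + by rewrite divr_ge0// ltW.
  + by apply: eq_cont (contB c1 c3) => x _; rewrite cReD cReN.
  + by apply: eq_cont (contB c2 c4) => x _; rewrite cImD cImN.
  + move=> x xL; apply: le_trans (nrm_le _) _; rewrite cReD cImD cReN cImN [leRHS]splitr.
    by apply: lerD; [apply: H1|apply: H2] => //; rewrite subrr normr0.
- move=> phi g _; rewrite functional_of_RI; apply: complex_ext => /=.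
  + rewrite -[RHS](mul0r (RI (- L) L (fun=> 0))) -RIZ; last exact: cont_cst.
    by apply: eq_RI => x /subset_itv_oo_cc xL; rewrite U0//= !mul0r.
  + rewrite -[RHS](mul0r (RI (- L) L (fun=> 0))) -RIZ; last exact: cont_cst.
    by apply: eq_RI => x /subset_itv_oo_cc xL; rewrite U0//= !mul0r.
- move=> tau tauT phi aphi.
  have g1 := hr.2 tau tauT phi aphi; have g2 := hi.2 tau tauT phi aphi.
  have Z (h : R[i] -> R) : h 0 = 0 -> RI (- L) L (fun x => h (U (0, x)) * phi 0 x) = 0.
    move=> h0; rewrite -[RHS](mul0r (RI (- L) L (fun=> 0))) -RIZ; last exact: cont_cst.
    by apply: eq_RI => x /subset_itv_oo_cc xL; rewrite U0// h0 !mul0r.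
  rewrite (Z (@complex.Re R))// subr0 in g1; rewrite (Z (@complex.Im R))// subr0 in g2.
  rewrite functional_of_RI g1 g2 /intC; congr Complex; apply: eq_RI => t _.
  + by rewrite cReD cReN !cReM/=; ring.
  + by rewrite cImD cImN !cImM/=; ring.
Qed.

(** f agrees with its extension almost everywhere only, whereas the final state equals it pointwise;
    the pairing does not see the difference. *)
Lemma functional_of_ae (f w : R -> R[i]) phi g : H10 L phi g ->
  L2C (- L) L f -> cont (- L) L (fun x => complex.Re (w x)) ->
  cont (- L) L (fun x => complex.Im (w x)) ->
  {ae mu, forall x : R, x \in `]- L, L[ -> f x = w x} ->
  functional_of L f phi = functional_of L w phi.
Proof.
move=> hphi [f1 f2] w1 w2 fw; rewrite !functional_of_RI.
have mp : measurable_fun `]- L, L[ phi by apply: cont_measurable; exact: H10_cont hphi.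
have step (u v : R -> R) : measurable_fun `]- L, L[ u -> measurable_fun `]- L, L[ v ->
    {ae mu, forall x : R, x \in `]- L, L[ -> u x = v x} ->
    RI (- L) L (fun x => u x * phi x) = RI (- L) L (fun x => v x * phi x).
  move=> mu_ mv uv; rewrite /RI /Rintegral; congr fine; apply: ae_eq_integral => //.
  - by apply/measurable_EFinP; exact: measurable_funM.
  - by apply/measurable_EFinP; exact: measurable_funM.
  - by apply: (@filterS _ _ (ae_filter_ringOfSetsType mu) _ _ _ uv) => x H xL; rewrite H.
congr Complex; apply: step.
- exact: L2_measurable f1.
- exact: cont_measurable w1.
- by apply: (@filterS _ _ (ae_filter_ringOfSetsType mu) _ _ _ fw) => x H xL; rewrite H.
- exact: L2_measurable f2.
- exact: cont_measurable w2.
- by apply: (@filterS _ _ (ae_filter_ringOfSetsType mu) _ _ _ fw) => x H xL; rewrite H.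
Qed.

End Transposition.

Section Main.
Context {R : realType}.

(** Analyticity enters the proof here only: a < L0 puts the closed square S(a) inside the domain. *)
Lemma analytic_cauchy_class (L a L0 : R) (F : R[i] -> R[i]) : 0 < L -> L < a -> a < L0 ->
  analytic_on (square L0) F -> exists2 M : R, 0 <= M & cauchy_class L a a M F.
Proof.
move=> Lp La aL0 /analytic_on_sdiff[F' HF]; have a0 : 0 < a by exact: lt_trans La.
have HF' z : rhombus a a z -> sdiff F (F' z) z.
  rewrite /rhombus/= -mulrDr ler_pM2l// => za; apply: HF.
  exact: le_lt_trans aL0.
have cF (j : 'I_4) : ccont (fun p => F (zeta a a j p)).
  by apply: (ccont_sdiff (F' := F')) => p p1; apply/HF'/rhombus_zeta.
have /choice[M HM] : forall j : 'I_4, exists M : R, 0 < M /\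
    forall p, p \in `[0, 1] -> nrm (F (zeta a a j p)) <= M.
  by move=> j; have [M M0 HM] := ccont_bounded (cF j); exists M.
have M0 j : 0 <= M j by have [/ltW] := HM j.
exists (\sum_j M j); first exact: sumr_ge0.
split=> //.
- move=> j p p1; have [_ /(_ p p1) H] := HM j; apply: le_trans H _.
  by rewrite (bigD1 j)//= lerDl sumr_ge0.
- move=> x xL; apply: (cauchy_formula a0 a0 _ HF').
  by move: xL; rewrite in_itv/=; lra.
Qed.

End Main.

Theorem theorem1p1 (R : realType) (L : R) (L_gt0 : 0 < L) :
  \bigcup_(L0 in [set L0 : R | L < L0]) analytic_extendable L L0 `<=`
  [set f : R -> R[i] | reachable L (functional_of L f)].
Proof.
move=> f [L0 /= LL0 [f2 [F HF fF]]].
(* The midpoint leaves room on both sides: beyond L for the iteration, below L0 for Cauchy's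
   formula. *)
have La : L < (L + L0) / 2 by lra.
have aL : (L + L0) / 2 < L0 by lra.
have [M M0 cF] := analytic_cauchy_class L_gt0 La aL HF.
have [T T0 reach] := reach_cauchy_class L_gt0 La.
have [U hU UE] := reach M F M0 cF.
have [T' T'0 [vm [vp [u [h1 h2 h3 h4]]]]] :=
  heat_pair_reachable L_gt0 T0 hU (fun x xL => (UE x xL).1).
exists T' => //; exists vm, vp, u; split => // phi g hphi.
have [hr hi] := hU; have T1 : T \in `[0, T] by rewrite in_itv/= lexx ltW.
rewrite -(h4 phi g hphi).
apply: (functional_of_ae L_gt0 hphi f2 (heat_row hr T1) (heat_row hi T1)).
apply: (@filterS _ _ (ae_filter_ringOfSetsType (@lebesgue_measure R)) _ _ _ fF) => x H xL; rewrite H//.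
by have [_ ->] := UE x (subset_itv_oo_cc xL).
Qed.
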